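(* There is an absolute constant $c_0>0$ such that the following holds. Pick $\lambda$ such that $d\lambda=o(1)$ and $bn\lambda\ge12\pi M$. With probability at least $1-p^2\exp\big(-c_0\frac{b^2}{M^2}n\lambda^2\big)$, there exists $C_{b,B,M}>0$ depending on $b$, $B$ and $M$ only such that $$\|\breve\Theta^s_{nd}-\Theta^*\|_{\ell_1}\le 2\|\hat\Theta^s_{nd}-\Theta^*\|_{\ell_1}\le C_{b,B,M}\,d\lambda .$$
   Context: Model and rank correlation: $X=(X_1,\dots,X_p)$ follows the nonparanormal model, i.e. there are (unknown) univariate monotone increasing functions $f_1,\dots,f_p$ such that $(f_1(X_1),\dots,f_p(X_p))\sim N_p(0,\Sigma^* )$, where $\Sigma^*=(\sigma^*_{ij})$ is positive definite with unit diagonal; $\Theta^*=(\theta^*_{ij})=(\Sigma^* )^{-1}$. One observes $n$ i.i.d. copies $\mathbf x_1,\dots,\mathbf x_n$ of $X$, $\mathbf x_l=(x_{l1},\dots,x_{lp})$. For each $i$ let $(r_{1i},\dots,r_{ni})$ be the ranks of $x_{1i},\dots,x_{ni}$; $\hat r_{ij}$ (Spearman's rank correlation) is the Pearson sample correlation of the rank vectors of variables $i$ and $j$; $\hat r^s_{ij}=2\sin(\frac{\pi}{6}\hat r_{ij})$ and $\hat{\mathbf R}^s=(\hat r^s_{ij})_{1\le i,j\le p}$. For a $p\times p$ matrix $\mathbf R$ and index $k$: $\mathbf R_{(k)}$ is $\mathbf R$ with row and column $k$ removed; $\mathbf r_{(k)}$ is column $k$ with entry $k$ removed (and similarly $\theta_{(k)}$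 for $\Theta$). Rank-based neighborhood Dantzig selector with parameter $\lambda$: for each $k$, $\hat\beta^{s.nd}_k$ is a solution of $\min_{\beta\in\mathbb R^{p-1}}\|\beta\|_{\ell_1}$ subject to $\|\hat{\mathbf R}^s_{(k)}\beta-\hat{\mathbf r}^s_{(k)}\|_{\ell_\infty}\le\lambda$. The matrix $\hat\Theta^s_{nd}=(\hat\theta^{s.nd}_{ij})$ is defined by $\hat\theta^{s.nd}_{kk}=\big((\hat\beta^{s.nd}_k)^T\hat{\mathbf R}^s_{(k)}\hat\beta^{s.nd}_k-2(\hat\beta^{s.nd}_k)^T\hat{\mathbf r}^s_{(k)}+1\big)^{-1}$ and its $k$th column without the diagonal entry is $\hat\theta^{s.nd}_{(k)}=-\hat\theta^{s.nd}_{kk}\hat\beta^{s.nd}_k$, $k=1,\dots,p$. Its symmetrization is $\breve\Theta^s_{nd}=\arg\min_{\Theta:\Theta=\Theta'}\|\Theta-\hat\Theta^s_{nd}\|_{\ell_1}$ (matrix $\ell_1$ norm). Norms: for vectors $\|v\|_{\ell_1}=\sum_j|v_j|$, $\|v\|_{\ell_\infty}=\max_j|v_j|$; for matrices $\|A\|_{\ell_1}=\max_j\sum_i|a_{ij}|$. Constants: $b=\min_k\theta^*_{kk}$, $B=\lambda_{\max}(\Theta^* )$ (largest eigenvalue), $M=\|\Theta^*\|_{\ell_1}$, $d=\max_k|\{j\ne k:\theta^*_{kj}\ne0\}|$. *)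

(* Defs.v *)
From HB Require Import structures.
From mathcomp Require Import all_boot all_order all_algebra.
From mathcomp Require Import all_classical all_reals all_analysis.
Set Implicit Arguments.
Unset Strict Implicit.
Unset Printing Implicit Defensive.
Import Order.TTheory GRing.Theory Num.Theory.
Import numFieldNormedType.Exports.
Local Open Scope classical_set_scope.
Local Open Scope ring_scope.

Section linear_algebra.
Context {R : realType}.

Definition posdefmx (p : nat) (S : 'M[R]_p) : Prop :=
  S^T = S /\ forall a : 'cV[R]_p, a != 0 -> 0 < (a^T *m S *m a) 0 0.

Definition vec_l1 (m : nat) (v : 'cV[R]_m) : R := \sum_i `|v i 0|.

(* The l_infinity norm of a vector is the library norm [`|v|], which on
   matrices is the largest absolute value of an entry. *)

Definition mx_l1 (m n : nat) (A : 'M[R]_(m, n)) : R :=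
  \big[Num.max/0]_j \sum_i `|A i j|.

Definition mindiag (p : nat) (T : 'M[R]_p) : R :=
  inf [set T k k | k in [set: 'I_p]].

Definition lambda_max (p : nat) (T : 'M[R]_p) : R :=
  sup [set a : R | eigenvalue T a].

Definition maxdeg (p : nat) (T : 'M[R]_p) : nat :=
  \max_(k < p) #|[set j : 'I_p | (j != k) && (T k j != 0%R)]|.

(* [R_(k)] and [r_(k)] *)
Definition minor_mx (p : nat) (S : 'M[R]_p) (k : 'I_p) : 'M[R]_(p.-1) :=
  row' k (col' k S).

Definition minor_col (p : nat) (S : 'M[R]_p) (k : 'I_p) : 'cV[R]_(p.-1) :=
  row' k (col k S).

End linear_algebra.

Section model.
Context {R : realType} {d : measure_display} {Omega : measurableType d}.
Variable P : probability Omega R.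

(* Z ~ N_p(0, S): every nonzero linear combination a^T Z of the coordinates is
   distributed as N(0, a^T S a). The second parameter of [normal_prob] is the
   standard deviation; it is nonzero below because S is positive definite. *)
Definition centered_normal (p : nat) (Z : Omega -> 'I_p -> R) (S : 'M[R]_p) :
    Prop :=
  forall a : 'cV[R]_p, a != 0 -> forall A : set R, measurable A ->
    P [set w | A (\sum_i a i 0 * Z w i)] =
    normal_prob 0 (Num.sqrt ((a^T *m S *m a) 0 0)) A.

(* The f i are only required to be nondecreasing, which includes the strictly
   increasing case. *)
Definition nonparanormal (p : nat) (X : Omega -> p.-tuple R) (S : 'M[R]_p) :
    Prop :=
  exists2 f : 'I_p -> R -> R,
    forall i, {homo f i : s t / s <= t} &
    centered_normal (fun w i => f i (tnth (X w) i)) S.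

Definition iid_copies (n p : nat) (X : Omega -> p.-tuple R)
    (x : 'I_n -> Omega -> p.-tuple R) : Prop :=
  (forall l (A : set (p.-tuple R)), measurable A ->
     P (x l @^-1` A) = P (X @^-1` A)) /\
  (forall A : 'I_n -> set (p.-tuple R), (forall l, measurable (A l)) ->
     P [set w | forall l, A l (x l w)] = (\prod_(l < n) P (x l @^-1` A l))%E).

End model.

Section estimator.
Context {R : realType}.

Definition data_mx (Omega : Type) (n p : nat)
    (x : 'I_n -> Omega -> p.-tuple R) (w : Omega) : 'M[R]_(n, p) :=
  \matrix_(l < n, i < p) tnth (x l w) i.

(* Row l, column i: the rank of x_li among x_1i, ..., x_ni; almost surely
   there are no ties. *)
Definition rank_mx (n p : nat) (D : 'M[R]_(n, p)) : 'M[R]_(n, p) :=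
  \matrix_(l < n, i < p) #|[set m : 'I_n | D m i <= D l i]|%:R.

Definition mean (n : nat) (u : 'cV[R]_n) : R := (\sum_l u l 0) / n%:R.

Definition pearson (n : nat) (u v : 'cV[R]_n) : R :=
  (\sum_l (u l 0 - mean u) * (v l 0 - mean v)) /
  (Num.sqrt (\sum_l (u l 0 - mean u) ^+ 2) *
   Num.sqrt (\sum_l (v l 0 - mean v) ^+ 2)).

Definition spearman (n p : nat) (D : 'M[R]_(n, p)) (i j : 'I_p) : R :=
  pearson (col i (rank_mx D)) (col j (rank_mx D)).

Definition spearman_mx (n p : nat) (D : 'M[R]_(n, p)) : 'M[R]_p :=
  \matrix_(i, j) (2 * sin (pi / 6 * spearman D i j)).

Definition dantzig_feasible (p : nat) (lambda : R) (S : 'M[R]_p) (k : 'I_p)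
    (beta : 'cV[R]_(p.-1)) : Prop :=
  `|minor_mx S k *m beta - minor_col S k| <= lambda.

(* The linear program may have several solutions. *)
Definition dantzig_solution (p : nat) (lambda : R) (S : 'M[R]_p) (k : 'I_p)
    (beta : 'cV[R]_(p.-1)) : Prop :=
  dantzig_feasible lambda S k beta /\
  forall beta' : 'cV[R]_(p.-1),
    dantzig_feasible lambda S k beta' -> vec_l1 beta <= vec_l1 beta'.

Definition neighborhood_dantzig (p : nat) (lambda : R) (S T : 'M[R]_p) :
    Prop :=
  exists beta : 'I_p -> 'cV[R]_(p.-1), forall k : 'I_p,
    [/\ dantzig_solution lambda S k (beta k),
        T k k = (((beta k)^T *m minor_mx S k *m beta k) 0 0
                 - 2 * ((beta k)^T *m minor_col S k) 0 0 + 1)^-1 &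
        minor_col T k = - (T k k *: beta k)].

Definition symmetrization (p : nat) (T U : 'M[R]_p) : Prop :=
  U^T = U /\
  forall V : 'M[R]_p, V^T = V -> mx_l1 (U - T) <= mx_l1 (V - T).

(* The outcomes where the estimator exists and every version of it (whatever
   the minimizers chosen) satisfies
     |U - T0|_1 <= 2 |T - T0|_1 <= r. *)
Definition nds_event (Omega : Type) (n p : nat)
    (x : 'I_n -> Omega -> p.-tuple R) (lambda : R) (T0 : 'M[R]_p) (r : R) :
    set Omega :=
  [set w | let S := spearman_mx (data_mx x w) in
     (exists T U, neighborhood_dantzig lambda S T /\ symmetrization T U) /\
     (forall T U, neighborhood_dantzig lambda S T -> symmetrization T U ->
        mx_l1 (U - T0) <= 2 * mx_l1 (T - T0) /\ 2 * mx_l1 (T - T0) <= r)].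

End estimator.

(* Main.v *)
Require Import Defs.
From HB Require Import structures.
From mathcomp Require Import all_boot all_order all_algebra.
From mathcomp Require Import all_classical all_reals all_analysis.
From mathcomp Require Import measurable_realfun.
From mathcomp Require Import ring lra.
Import Order.TTheory GRing.Theory Num.Theory.
Import numFieldNormedType.Exports.
Set Implicit Arguments.
Unset Strict Implicit.
Unset Printing Implicit Defensive.
Local Open Scope classical_set_scope.
Local Open Scope ring_scope.

(** The argument splits into a deterministic statement about matrices close to
[Sigma] and a concentration inequality for the rank correlations.

Deterministic part.  Write [Theta] for the inverse of [Sigma], and let [S] be
within [b * lambda / M] of [Sigma] in every entry.  The residual of the
regression of variable [k] on the others has the coefficient vector
[v0 = Theta e_k / Theta_kk] ([oracle]).  Since [Sigma v0 = e_k / Theta_kk] and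
[v0] has l1 norm at most [M / b], it satisfies the Dantzig constraint, so a solution [v] exists and its
l1 norm is at most that of [v0].  Both nearly annihilate the rows [j != k] of
[Sigma], so [Sigma (v - v0)] is of order [lambda] off row [k]; row [k] follows
from [(v - v0)_k = 0], and multiplying by [Theta] bounds [v - v0] entrywise.
As [v0] has at most [d] nonzero entries besides the [k]th one and [v] has the
smaller l1 norm, an entrywise bound becomes an l1 bound at the cost of a
factor [2 d].  The diagonal entry of the estimator is the inverse of a residual
variance that is close to [1 / Theta_kk], and [d * lambda -> 0] keeps it away
from 0; this is [column_error].  The symmetrization costs a factor 2 because
[Theta] itself is a symmetric competitor ([symmetrization_le]).

Concentration part.  Without ties, Spearman's correlation is a multiple of a
sum over triples of observations of [sg (u_l - u_a) * sg (v_l - v_b)]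
([spearmanE]).  Signs of differences do not see increasing transformations, so
[u] and [v] may be taken to be the Gaussian coordinates.  Changing one
observation moves the sum by [O(n^2)], so it concentrates by the bounded
differences inequality ([mcdiarmid]); the triples with a repeated index also
account for only [O(n^2)], which [12 * pi * M <= b * n * lambda] absorbs.  For
distinct indices the two differences are jointly normal with correlation
[Sigma i j / 2], and the expected product of their signs is
[2 / pi * asin (Sigma i j / 2)] ([gaussian_sign_correlation]).  The map
[r |-> 2 * sin (pi / 6 * r)] undoes exactly this arcsine, and a union bound
over the pairs [i < j] gives [spearman_mx_deviation].

The arcsine formula needs some care, because joint normality is given through
the laws of linear combinations rather than through a joint density.  It is
read off from the identity, valid for all reals [x] and [y],
[\int_(t > 0) (ln |x + t y| - ln |x - t y|) / t = pi^2 / 2 * sg (x y)]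
([integral_log_ridge]), whose left side involves only linear combinations.
The expected logarithm of a centered normal variable is the logarithm of its
standard deviation plus a constant, so taking expectations leaves an explicit
integral in [t], equal to [pi] times the arcsine of the correlation
([integral_log_ratio]). *)

(** * A kernel with two elementary integrals *)

Section kernel.
Context {R : realType}.
Implicit Types a phi t s c : R.

(** The integrand of a double integral over [t > 0] and [0 < phi < phi0] that is
elementary in both orders: integrating in [t] first gives an arctangent,
integrating in [phi] first gives [log_ratio]. *)
Definition sgn_kernel a phi t : R :=
  a * cos phi / (1 + 2 * (a * t) * sin phi + (a * t) ^+ 2) +
  a * cos phi / (1 - 2 * (a * t) * sin phi + (a * t) ^+ 2).

Lemma quad_gt0 (u s : R) : `|s| < 1 -> 0 < 1 + 2 * u * s + u ^+ 2.
Proof.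
move=> s1; have : 0 < 1 - s ^+ 2.
  by rewrite subr_gt0 -real_normK ?num_real// expr_lt1.
have := sqr_ge0 (u + s); rewrite !expr2; lra.
Qed.

Lemma cos_gt0_lt1 phi : 0 <= phi < pi / 2 -> 0 < cos phi /\ `|sin phi| < 1.
Proof.
move=> /andP[p0 p1].
have c0 : 0 < cos phi.
  by apply: cos_gt0_pihalf; rewrite p1 andbT (lt_le_trans _ p0)// oppr_lt0 divr_gt0 ?pi_gt0.
split=> //; rewrite -(@expr_lt1 _ 2)// real_normK ?num_real// sin2cos2.
by rewrite ltrBlDr ltrDl exprn_gt0.
Qed.

Lemma sgn_kernel_ge0 a phi t : 0 < a -> 0 <= phi < pi / 2 ->
  0 <= sgn_kernel a phi t.
Proof.
move=> a0 /cos_gt0_lt1[c0 s1].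
rewrite addr_ge0// mulr_ge0 ?invr_ge0// ltW ?mulr_gt0 ?quad_gt0//.
by rewrite -mulrN quad_gt0// normrN.
Qed.

Lemma is_derive_atan_affine (a s c t : R) : c != 0 ->
  is_derive t 1 (fun t => atan ((a * t + s) / c))
    (a * c / (c ^+ 2 + (a * t + s) ^+ 2)).
Proof.
move=> c0.
have -> : a * c / (c ^+ 2 + (a * t + s) ^+ 2) =
  (1 + ((a * t + s) / c) ^+ 2)^-1 * (a / c).
  have : 0 < c ^+ 2 by rewrite exprn_even_gt0.
  move=> ?; have : 0 < c ^+ 2 + (a * t + s) ^+ 2 by rewrite ltr_wpDr ?sqr_ge0.
  by move=> ?; field; rewrite c0 gt_eqF.
pose g t := (a * t + s) / c.
have dg : is_derive t 1 g (a / c).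
  by apply: is_derive_eq; rewrite /GRing.scale/=; ring.
exact: (@is_derive1_comp _ atan g).
Qed.

Lemma is_derive_continuous (f : R -> R) (x df : R) :
  is_derive x 1 f df -> {for x, continuous f}.
Proof. by case=> fx _; apply: differentiable_continuous; exact/derivable1_diffP. Qed.

Lemma continuous_div_sum (f g1 g2 : R -> R) (x : R) :
  derivable f x 1 -> derivable g1 x 1 -> derivable g2 x 1 ->
  g1 x != 0 -> g2 x != 0 ->
  {for x, continuous (fun x => f x / g1 x + f x / g2 x)}.
Proof.
move=> df dg1 dg2 g10 g20.
have c (h : R -> R) : derivable h x 1 -> {for x, continuous h}.
  by move=> dh; apply: differentiable_continuous; exact/derivable1_diffP.
apply: cvgD.
  by apply: cvgM; [exact: c|apply: cvgV => //; exact: c].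
by apply: cvgM; [exact: c|apply: cvgV => //; exact: c].
Qed.

(** Completing the square turns both denominators into [c^2 + (a t +- s)^2], so an
antiderivative is a sum of two arctangents.  Their values at [t = 0] cancel and
each tends to [pi / 2], which is why the result depends on neither [a] nor
[phi]. *)
Lemma integral_sgn_kernel_t a phi : 0 < a -> 0 <= phi < pi / 2 ->
  (\int[lebesgue_measure]_(t in `[0%R, +oo[) (sgn_kernel a phi t)%:E = pi%:E)%E.
Proof.
move=> a0 p0; have [c0 s1] := cos_gt0_lt1 p0.
have cn0 : cos phi != 0 by rewrite gt_eqF.
pose F t := atan ((a * t + sin phi) / cos phi) + atan ((a * t - sin phi) / cos phi).
have dF t : is_derive t 1 F (sgn_kernel a phi t).
  rewrite /F.
  have -> : sgn_kernel a phi t =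
     a * cos phi / (cos phi ^+ 2 + (a * t + sin phi) ^+ 2) +
     a * cos phi / (cos phi ^+ 2 + (a * t + - sin phi) ^+ 2).
    by rewrite /sgn_kernel cos2sin2; congr (_ / _ + _ / _); ring.
  by apply: is_deriveD; [exact: is_derive_atan_affine | exact: is_derive_atan_affine].
have cvF s : atan ((a * t + s) / cos phi) @[t --> +oo] --> (pi / 2 : R).
  apply: cvg_comp; last exact: cvgy_atan.
  apply: gt0_cvgMly; first by rewrite invr_gt0.
  apply: cvg_comp (cvg_addrr _).
  by apply: gt0_cvgMry.
have cF : continuous F.
  by move=> t; apply: differentiable_continuous; apply/derivable1_diffP; have [] := dF t.
rewrite (@ge0_continuous_FTC2y _ (sgn_kernel a phi) F 0 pi).
- rewrite /F mulr0 !add0r mulNr atanN subrr.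
  by rewrite sube0.
- by move=> x _; exact: sgn_kernel_ge0.
- apply: continuous_subspaceT => t.
  apply: (@continuous_div_sum (cst (a * cos phi))
    (fun t => 1 + 2 * (a * t) * sin phi + (a * t) ^+ 2)
    (fun t => 1 - 2 * (a * t) * sin phi + (a * t) ^+ 2)) => //.
  - by rewrite gt_eqF ?quad_gt0.
  - by rewrite gt_eqF// -mulrN quad_gt0 ?normrN.
- have -> : (pi : R) = pi / 2 + pi / 2 by field.
  by apply: cvgD; exact: cvF.
- by move=> t _; have [] := dF t.
- exact: cvg_at_right_filter (cF 0).
- by move=> t _; rewrite derive1E; have [_] := dF t.
Qed.

Lemma ln_quad_derive (u phi : R) : 0 < 1 + 2 * u * sin phi + u ^+ 2 ->
  is_derive phi 1 (fun p => ln (1 + 2 * u * sin p + u ^+ 2))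
    (2 * u * cos phi / (1 + 2 * u * sin phi + u ^+ 2)).
Proof.
move=> h; rewrite [X in is_derive _ _ _ X]mulrC.
pose g p := 1 + 2 * u * sin p + u ^+ 2.
have dg : is_derive phi 1 g (2 * u * cos phi).
  by apply: is_derive_eq; rewrite /GRing.scale/=; ring.
have dl : is_derive (g phi) 1 (@ln R) (g phi)^-1 by exact: is_derive1_ln.
exact: (@is_derive1_comp _ (@ln R) g).
Qed.

Definition log_ratio a phi t : R :=
  (ln (1 + 2 * (a * t) * sin phi + (a * t) ^+ 2)
   - ln (1 - 2 * (a * t) * sin phi + (a * t) ^+ 2)) / (2 * t).

(** The quadratic vanishes for [u = 1] and [s = - 1]; away from [u = 1] the value
[|s| = 1], that is [phi = pi / 2], is allowed. *)
Lemma quad_gt0_neq1 (u s : R) : 0 < u -> u != 1 -> `|s| <= 1 -> 0 < 1 + 2 * u * s + u ^+ 2.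
Proof.
move=> u0 u1; rewrite ler_norml => /andP[s1 s2].
have : 0 < (1 - u) ^+ 2 by rewrite exprn_even_gt0//= subr_eq0 eq_sym.
have : 0 <= u * (s + 1) by rewrite mulr_ge0 ?(ltW u0)//; lra.
rewrite !expr2; lra.
Qed.

(** As a function of [phi], the kernel is the derivative of [log_ratio].  For
[a * t = 1] the kernel has a singularity at [phi = pi / 2]. *)
Lemma integral_sgn_kernel_phi a phi0 t : 0 < a -> 0 < t -> 0 < phi0 <= pi / 2 ->
  a * t != 1 ->
  (\int[lebesgue_measure]_(phi in `[0%R, phi0]) (sgn_kernel a phi t)%:E =
   (log_ratio a phi0 t)%:E)%E.
Proof.
move=> a0 t0 /andP[p0 p1] at1.
have u0 : 0 < a * t by rewrite mulr_gt0.
have q1 p : 0 < 1 + 2 * (a * t) * sin p + (a * t) ^+ 2.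
  by apply: quad_gt0_neq1 => //; rewrite ler_norml sin_geN1 sin_le1.
have q2 p : 0 < 1 + 2 * (a * t) * - sin p + (a * t) ^+ 2.
  by apply: quad_gt0_neq1 => //; rewrite normrN ler_norml sin_geN1 sin_le1.
have dF (p : R) : is_derive p 1 (fun p : R => log_ratio a p t) (sgn_kernel a p t).
  have d1 := ln_quad_derive (q1 p).
  have d2 : is_derive p 1 (fun p : R => ln (1 - 2 * (a * t) * sin p + (a * t) ^+ 2))
      (- 2 * (a * t) * cos p / (1 - 2 * (a * t) * sin p + (a * t) ^+ 2)).
    have h : 0 < 1 + 2 * - (a * t) * sin p + (- (a * t)) ^+ 2.
      by have := q2 p; rewrite !mulrN mulNr sqrrN.
    have e (s : R) : 1 - 2 * (a * t) * s + (a * t) ^+ 2 =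
        1 + 2 * - (a * t) * s + (- (a * t)) ^+ 2 by ring.
    have -> : - 2 * (a * t) * cos p = 2 * - (a * t) * cos p by ring.
    by under eq_fun do rewrite e; rewrite e; exact: ln_quad_derive.
  apply: is_derive_eq.
  rewrite /GRing.scale/= /sgn_kernel.
  have := q1 p; have := q2 p; rewrite mulrN => ? ?.
  by field; rewrite !gt_eqF.
rewrite (@continuous_FTC2 _ (sgn_kernel a ^~ t) (fun p => log_ratio a p t))//.
- have -> : log_ratio a 0 t = 0.
    by rewrite /log_ratio sin0 !mulr0 subr0 addr0 subrr mul0r.
  by rewrite sube0.
- apply: continuous_subspaceT => p.
  apply: (@continuous_div_sum (fun p => a * cos p)
    (fun p => 1 + 2 * (a * t) * sin p + (a * t) ^+ 2)
    (fun p => 1 - 2 * (a * t) * sin p + (a * t) ^+ 2)) => //.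
  - by rewrite gt_eqF.
  - by rewrite gt_eqF// -mulrN.
- split.
  + by move=> p _; have [] := dF p.
  + exact: cvg_at_right_filter (is_derive_continuous (dF 0)).
  + exact: cvg_at_left_filter (is_derive_continuous (dF phi0)).
- by move=> p _; rewrite derive1E; have [_] := dF p.
Qed.

End kernel.

Lemma measurable_funV (R : realType) : measurable_fun [set: R] (@GRing.inv R).
Proof.
have -> : [set: R] = `]-oo, 0[ `|` ([set 0] `|` `]0, +oo[).
  apply/seteqP; split => // x _ /=; rewrite !in_itv/= andbT.
  by have [?|?|->] := ltgtP x 0; [left|right; right|right; left].
apply/measurable_funU => //; first exact: measurableU.
split.
  apply: measurable_realfun.open_continuous_measurable_fun; first exact: interval_open.
  move=> x; rewrite inE/= in_itv/= => x0; apply: inv_continuous; by rewrite lt_eqF.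
apply/measurable_funU => //; split; first exact: measurable_fun_set1.
apply: measurable_realfun.open_continuous_measurable_fun; first exact: interval_open.
by move=> x; rewrite inE/= in_itv/= andbT => x0; apply: inv_continuous; rewrite gt_eqF.
Qed.

Section kernel_tonelli.
Context {R : realType}.
Implicit Types a phi t s c : R.

Lemma measurable_sgn_kernel a :
  measurable_fun [set: R * R] (fun z : R * R => sgn_kernel a z.2 z.1).
Proof.
have mq (e : R) : measurable_fun [set: R * R] (fun z : R * R =>
    a * cos z.2 / (1 + e * (2 * (a * z.1) * sin z.2) + (a * z.1) ^+ 2)).
  have m1 : measurable_fun [set: R * R] (fun z : R * R => a * z.1).
    by apply: measurable_funM => //; exact: measurable_cst.
  have ms : measurable_fun [set: R * R] (fun z : R * R => sin z.2).
    by apply: measurableT_comp => //; apply: continuous_measurable_fun; exact: continuous_sin.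
  have mc : measurable_fun [set: R * R] (fun z : R * R => cos z.2).
    by apply: measurableT_comp => //; apply: continuous_measurable_fun; exact: continuous_cos.
  apply: measurable_funM; first exact: measurable_funM.
  apply: (measurableT_comp (@measurable_funV R)).
  apply: measurable_funD; last exact: measurable_funX.
  apply: measurable_funD => //; apply: measurable_funM => //.
  by apply: measurable_funM => //; exact: measurable_funM.
have -> : (fun z : R * R => sgn_kernel a z.2 z.1) = fun z : R * R =>
   a * cos z.2 / (1 + 1 * (2 * (a * z.1) * sin z.2) + (a * z.1) ^+ 2) +
   a * cos z.2 / (1 + -1 * (2 * (a * z.1) * sin z.2) + (a * z.1) ^+ 2).
  by apply/funext => z; rewrite /sgn_kernel mul1r mulN1r.
exact: measurable_funD.
Qed.

Lemma measurable_log_ratio a phi : measurable_fun [set: R] (log_ratio a phi).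
Proof.
have mq (e : R) : measurable_fun [set: R] (fun t : R =>
    ln (1 + e * (2 * (a * t) * sin phi) + (a * t) ^+ 2)).
  have m1 : measurable_fun [set: R] (fun t : R => a * t).
    by apply: measurable_funM => //; exact: measurable_cst.
  apply: measurableT_comp; first exact: measurable_ln.
  apply: measurable_funD; last exact: measurable_funX.
  apply: measurable_funD => //; apply: measurable_funM => //.
  by apply: measurable_funM => //; exact: measurable_funM.
apply: measurable_funM; last first.
  by apply: (measurableT_comp (@measurable_funV R)); exact: measurable_funM.
have := measurable_funB (mq 1) (mq (-1)).
by apply: eq_measurable_fun => t _ /=; rewrite mul1r mulN1r.
Qed.

(** Tonelli for [sgn_kernel]: the inner integral in [phi] is [log_ratio], the inner
integral in [t] is the constant [pi]. *)
Lemma integral_log_ratio a phi0 : 0 < a -> 0 <= phi0 <= pi / 2 ->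
  (\int[lebesgue_measure]_(t in `]0%R, +oo[) (log_ratio a phi0 t)%:E =
   (pi * phi0)%:E)%E.
Proof.
move=> a0 /andP[]; rewrite le_eqVlt => /predU1P[<- _|p0 p1].
  rewrite mulr0 integral0_eq// => t _.
  by rewrite /log_ratio sin0 !mulr0 subr0 addr0 subrr mul0r.
pose D := `]0%R, +oo[%classic : set R; pose E := `[0%R, phi0[%classic : set R.
pose K (z : R * R) := (sgn_kernel a z.2 z.1)%:E.
pose g := K \_ (D `*` E).
have mDE : measurable (D `*` E) by apply: measurableX; exact: measurable_itv.
have mK : measurable_fun setT K by apply/measurable_EFinP; exact: measurable_sgn_kernel.
have mg : measurable_fun setT g.
  by apply/(measurable_restrictT _ _).1 => //; exact: measurable_funTS.
have gE x y : g (x, y) = if x \in D then (if y \in E then K (x, y) else 0%E) else 0%E.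
  by rewrite /g patchE in_setX/=; case: (x \in D).
have Ep y : y \in E -> 0 <= y < pi / 2.
  rewrite inE /E/= in_itv/= => /andP[y0 y1]; rewrite y0/=.
  exact: lt_le_trans y1 p1.
have g0 z : (0 <= g z)%E.
  case: z => x y; rewrite gE; case: ifP => // _; case: ifPn => // /Ep yE.
  by rewrite lee_fin sgn_kernel_ge0.
have := @fubini_tonelli _ _ _ _ _ (@lebesgue_measure R) (@lebesgue_measure R) g mg g0.
have mK1 x (A : set R) : measurable_fun A (fun y => K (x, y)).
  by apply: measurable_funTS; exact: measurableT_comp.
have mK2 y (A : set R) : measurable_fun A (fun x => K (x, y)).
  apply: measurable_funTS; apply: (measurableT_comp mK).
  exact: measurable_fun_pair.
rewrite (_ : (fun x => _) = (fun x => \int[lebesgue_measure]_(y in E) K (x, y)) \_ D)%E; last first.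
  apply/funext => x; rewrite patchE.
  case: ifPn => xD; last first.
    by rewrite integral0_eq// => y _; rewrite gE (negbTE xD).
  rewrite [RHS]integral_mkcond; apply: eq_integral => y _.
  by rewrite gE xD patchE.
rewrite -integral_mkcond.
under [X in _ = X -> _]eq_integral.
  move=> y _.
  rewrite (_ : \int[_]_x _ = ((cst pi%:E) \_ E) y)%E; last first.
    rewrite patchE; case: ifPn => yE; last first.
      by rewrite integral0_eq// => x _; rewrite gE (negbTE yE) if_same.
    transitivity (\int[lebesgue_measure]_(x in D) K (x, y))%E.
      rewrite [RHS]integral_mkcond; apply: eq_integral => x _.
      by rewrite gE yE patchE.
    by rewrite /D integral_itv_obnd_cbnd//= integral_sgn_kernel_t// Ep.
  over.
rewrite -integral_mkcond integral_cst//=; last exact: measurable_itv.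
rewrite lebesgue_measure_itv/= lte_fin p0 oppr0 adde0.
rewrite EFinM => <-.
(* The two integrands may differ at the single point where a * t = 1. *)
have mDa : measurable (D `\ a^-1) by apply: measurableD => //; exact: measurable_itv.
have eqDa : {in D `\ a^-1, (EFin \o log_ratio a phi0) =1
   fun x => (\int[lebesgue_measure]_(y in E) K (x, y))%E}.
  move=> x; rewrite inE => -[]; rewrite /D/= in_itv/= andbT => x0 /eqP xa.
  rewrite /E integral_itv_bndo_bndc//= integral_sgn_kernel_phi// ?p0//.
  by apply: contra xa => /eqP h; rewrite -(mulKf (lt0r_neq0 a0) x) h mulr1.
have mL (A : set R) : measurable_fun A (EFin \o log_ratio a phi0).
  by apply: measurable_funTS; apply/measurable_EFinP; exact: measurable_log_ratio.
rewrite -(@integral_setD1 _ _ a^-1)//.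
rewrite -[RHS](@integral_setD1 _ _ a^-1)//.
  exact: eq_integral.
exact: eq_measurable_fun (mL _).
Qed.

End kernel_tonelli.

(** * The sign of a product as an integral of logarithms *)

Section sign_integral.
Context {R : realType}.
Implicit Types x y t r : R.

(** Depends on [x] and [y] only through the two linear combinations [x + t * y] and
[x - t * y]. *)
Definition log_ridge x y t : R := (ln `|x + t * y| - ln `|x - t * y|) / t.

Lemma log_ratio_pihalf a t : 0 < a -> 0 < t -> a * t != 1 ->
  log_ratio a (pi / 2) t = (ln `|1 + a * t| - ln `|1 - a * t|) / t :> R.
Proof.
move=> a0 t0 at1; rewrite /log_ratio sin_pihalf !mulr1.
have -> : 1 + 2 * (a * t) + (a * t) ^+ 2 = `|1 + a * t| ^+ 2.
  by rewrite real_normK ?num_real//; ring.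
have -> : 1 - 2 * (a * t) + (a * t) ^+ 2 = `|1 - a * t| ^+ 2.
  by rewrite real_normK ?num_real//; ring.
rewrite !lnXn ?normr_gt0 ?subr_eq0 1?eq_sym//; last first.
  by rewrite lt_eqF// addr_gt0// mulr_gt0.
by field; rewrite gt_eqF.
Qed.

(** Factor out [x]: what remains is [log_ratio] at the end point [phi = pi / 2],
where the quadratics in [log_ratio] are perfect squares, and replacing [y / x]
by its opposite only changes the sign. *)
Lemma log_ridgeE x y t : x * y != 0 -> 0 < t -> `|y / x| * t != 1 ->
  log_ridge x y t = Num.sg (x * y) * log_ratio `|y / x| (pi / 2) t.
Proof.
rewrite mulf_eq0 negb_or => /andP[x0 y0] t0 at1.
have r0 : y / x != 0 by rewrite mulf_neq0// invr_eq0.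
have -> : Num.sg (x * y) = Num.sg (y / x) by rewrite sgrM sgrM sgrV mulrC.
rewrite log_ratio_pihalf ?normr_gt0// /log_ridge.
have -> : x + t * y = x * (1 + y / x * t) by field.
have -> : x - t * y = x * (1 - y / x * t) by field.
move: (y / x) r0 at1 => r r0 at1.
have : r * t != 1 /\ r * t != -1.
  split; apply: contra at1 => /eqP h.
    by rewrite -{1}(gtr0_norm t0) -normrM h normr1.
  by rewrite -{1}(gtr0_norm t0) -normrM h normrN normr1.
rewrite -subr_eq0 -[r * t == -1]subr_eq0 opprK => -[h1 h2].
rewrite !normrM !lnM ?posrE ?normr_gt0//; last 2 first.
- by rewrite -opprB oppr_eq0.
- by rewrite addrC.
case: (ltgtP r 0) r0 => // r0 _.
  by rewrite (ltr0_norm r0) (ltr0_sg r0) mulN1r mulNr opprK; field; rewrite gt_eqF.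
by rewrite (gtr0_norm r0) (gtr0_sg r0) mul1r; field; rewrite gt_eqF.
Qed.

Lemma log_ridge0 x y t : x * y = 0 -> log_ridge x y t = 0.
Proof.
move/eqP; rewrite mulf_eq0 /log_ridge => /orP[]/eqP->.
  by rewrite add0r sub0r normrN subrr mul0r.
by rewrite mulr0 addr0 subr0 subrr mul0r.
Qed.

Lemma measurable_log_ridge d (T : measurableType d) (D : set T) (f g h : T -> R) :
  measurable_fun D f -> measurable_fun D g -> measurable_fun D h ->
  measurable_fun D (fun w => log_ridge (f w) (g w) (h w)).
Proof.
move=> mf mg mh; apply: measurable_funM; last first.
  exact: (measurableT_comp (@measurable_funV R)).
by apply: measurable_funB; apply: (measurableT_comp (@measurable_ln R));
  apply: (measurableT_comp (@normr_measurable R setT));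
  [apply: measurable_funD|apply: measurable_funB] => //; exact: measurable_funM.
Qed.

(** The integrand keeps the sign of [x * y] for all [t > 0].  The finiteness,
uniform in [x] and [y], is what permits Fubini under an expectation. *)
Lemma integral_abs_log_ridge x y :
  (\int[lebesgue_measure]_(t in `]0%R, +oo[) `|(log_ridge x y t)%:E| =
   (`|Num.sg (x * y)| * (pi * (pi / 2)))%:E)%E.
Proof.
have [xy0|xy0] := eqVneq (x * y) 0.
  rewrite integral0_eq ?xy0 ?sgr0 ?normr0 ?mul0r// => t _.
  by rewrite log_ridge0// abse0.
have a0 : 0 < `|y / x|.
  by move: xy0; rewrite normr_gt0 mulf_eq0 negb_or => /andP[x0 y0]; rewrite mulf_neq0// invr_eq0.
rewrite normr_sg xy0 mul1r -(@integral_log_ratio _ `|y / x|)//; last first.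
  by rewrite lexx andbT divr_ge0 ?pi_ge0.
have mS (A : set R) : measurable_fun A (EFin \o log_ratio `|y / x| (pi / 2)).
  by apply: measurable_funTS; apply/measurable_EFinP; exact: measurable_log_ratio.
have mL (A : set R) : measurable_fun A (fun t => `|(log_ridge x y t)%:E|%E).
  apply: measurableT_comp => //; apply/measurable_EFinP.
  exact: measurable_log_ridge.
have mDa : measurable ([set` `]0%R, +oo[] `\ `|y / x|^-1 : set R).
  by apply: measurableD => //; exact: measurable_itv.
rewrite -(@integral_setD1 _ _ `|y / x|^-1)//.
rewrite -[RHS](@integral_setD1 _ _ `|y / x|^-1)//.
apply: eq_integral => t; rewrite inE => -[]; rewrite /= in_itv/= andbT => t0 /eqP ta.
have at1 : `|y / x| * t != 1.
  by apply: contra ta => /eqP h; rewrite -(mulKf (lt0r_neq0 a0) t) h mulr1.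
rewrite log_ridgeE//= normrM normr_sg xy0 mul1r ger0_norm//.
rewrite log_ratio_pihalf// divr_ge0 ?(ltW t0)// subr_ge0 ler_ln ?posrE ?normr_gt0.
- have u0 : 0 < `|y / x| * t by rewrite mulr_gt0.
  rewrite (@ger0_norm _ (1 + `|y / x| * t)) ?addr_ge0 ?(ltW u0)// ler_norml; lra.
- by rewrite subr_eq0 eq_sym.
- by rewrite gt_eqF// addr_gt0// mulr_gt0.
Qed.

(** The scale [|y / x|] disappears because the integral of [log_ratio] does not
depend on it; only the sign of [x * y] is left. *)
Lemma integral_log_ridge x y :
  (\int[lebesgue_measure]_(t in `]0%R, +oo[) (log_ridge x y t)%:E =
   (Num.sg (x * y) * (pi * (pi / 2)))%:E)%E.
Proof.
have [xy0|xy0] := eqVneq (x * y) 0.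
  rewrite integral0_eq ?xy0 ?sgr0 ?mul0r// => t _.
  by rewrite log_ridge0.
have a0 : 0 < `|y / x|.
  by move: xy0; rewrite normr_gt0 mulf_eq0 negb_or => /andP[x0 y0]; rewrite mulf_neq0// invr_eq0.
have h := @integral_log_ratio _ `|y / x| (pi / 2) a0.
have pp : 0 <= (pi : R) / 2 <= pi / 2 by rewrite lexx andbT divr_ge0 ?pi_ge0.
have mS (A : set R) : measurable_fun A (EFin \o log_ratio `|y / x| (pi / 2)).
  by apply: measurable_funTS; apply/measurable_EFinP; exact: measurable_log_ratio.
have mL (A : set R) : measurable_fun A (fun t => (log_ridge x y t)%:E).
  by apply/measurable_EFinP; exact: measurable_log_ridge.
have mDa : measurable ([set` `]0%R, +oo[] `\ `|y / x|^-1 : set R).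
  by apply: measurableD => //; exact: measurable_itv.
rewrite EFinM -h// -(@integral_setD1 _ _ `|y / x|^-1)//.
rewrite -[X in _ = (_ * X)%E](@integral_setD1 _ _ `|y / x|^-1)//.
transitivity (\int[lebesgue_measure]_(t in [set` `]0%R, +oo[] `\ (`|y / x|^-1)%R)
   ((Num.sg (x * y)%R)%:E * (log_ratio `|y / x|%R (pi / 2)%R t)%:E))%E.
  apply: eq_integral => t; rewrite inE => -[]; rewrite /= in_itv/= andbT => t0 /eqP ta.
  rewrite log_ridgeE//.
  by apply: contra ta => /eqP h'; rewrite -(mulKf (lt0r_neq0 a0) t) h' mulr1.
rewrite integralZl//.
apply: integrableS; [exact: (measurable_itv `]0%R, +oo[)|exact: mDa|by move=> t []|].
apply/integrableP; split; first exact: mS.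
rewrite [X in (X < _)%E](_ : _ = (pi * (pi / 2))%:E) ?ltry//.
rewrite -h//; rewrite -[LHS](@integral_setD1 _ _ `|y / x|^-1)//; last first.
  exact: measurableT_comp.
rewrite -[RHS](@integral_setD1 _ _ `|y / x|^-1)//.
apply: eq_integral => t; rewrite inE => -[]; rewrite /= in_itv/= andbT => t0 /eqP ta.
have at1 : `|y / x| * t != 1.
  by apply: contra ta => /eqP h'; rewrite -(mulKf (lt0r_neq0 a0) t) h' mulr1.
rewrite ger0_norm//.
rewrite log_ratio_pihalf// divr_ge0 ?(ltW t0)// subr_ge0 ler_ln ?posrE ?normr_gt0.
- have u0 : 0 < `|y / x| * t by rewrite mulr_gt0.
  rewrite (@ger0_norm _ (1 + `|y / x| * t)) ?addr_ge0 ?(ltW u0)// ler_norml; lra.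
- by rewrite subr_eq0 eq_sym.
- by rewrite gt_eqF// addr_gt0// mulr_gt0.
Qed.

End sign_integral.

(** * Integrals and sums of normal variables *)

Section normal.
Context {R : realType}.
Local Notation leb := (@lebesgue_measure R).

(** The density [normal_pdf] is a version of the Radon-Nikodym derivative of
[normal_prob]. *)
Lemma ge0_integral_normal_prob (m s : R) (f : R -> \bar R) :
  measurable_fun [set: R] f -> (forall x, (0 <= f x)%E) ->
  (\int[normal_prob m s]_x f x = \int[leb]_x (f x * (normal_pdf m s x)%:E))%E.
Proof.
move=> mf f0.
have dom := @normal_prob_dominates R m s.
rewrite -(Radon_Nikodym_SigmaFinite.change_of_variables dom)//.
have iRN : leb.-integrable [set: R] (Radon_Nikodym_SigmaFinite.f (normal_prob m s) leb).
  exact: Radon_Nikodym_SigmaFinite.f_integrable.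
have mpdf : measurable_fun [set: R] (fun x => (normal_pdf m s x)%:E).
  by apply/measurable_EFinP; exact: measurable_normal_pdf.
apply: ae_eq_integral => //.
- apply: emeasurable_funM => //; exact: measurable_int iRN.
- by apply: emeasurable_funM.
- apply: ae_eqe_mul2l; apply: integral_ae_eq => // A _ mA.
  by rewrite -Radon_Nikodym_SigmaFinite.f_integral.
Qed.

Lemma lebesgue_measure_translation (y : R) (A : set R) : measurable A ->
  pushforward leb ((fun x => x + y) : _ -> measurableTypeR R) A = leb A.
Proof.
move=> mA; apply/esym/lebesgue_measure_unique => //=; first exact: measurable_funD.
move=> _ _ [[a b]] _ <-.
rewrite /pushforward.
have -> : (fun x : R => x + y) @^-1` [set` `]a, b]] = [set` `]a - y, b - y]].
  by apply/seteqP; split=> x /=; rewrite !in_itv/= ltrBlDr lerBrDr.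
rewrite !lebesgue_measure_itv/= !lte_fin ltrD2r; case: ifP => // _.
by rewrite -!EFinB; congr (_%:E); ring.
Qed.

Lemma ge0_integral_translation (y : R) (f : R -> \bar R) :
  measurable_fun [set: R] f -> (forall x, (0 <= f x)%E) ->
  (\int[leb]_x f (x + y)%R = \int[leb]_x f x)%E.
Proof.
move=> mf f0.
have mp : measurable_fun [set: R] ((fun x => x + y) : R -> measurableTypeR R).
  exact: measurable_funD.
transitivity (\int[pushforward leb ((fun x => x + y)%R : _ -> measurableTypeR R)]_x f x)%E.
  by rewrite ge0_integral_pushforward.
by apply: eq_measure_integral => A mA _; exact: lebesgue_measure_translation.
Qed.

(** Completing the square in [y]: the second factor on the right is a probability
density in [y], so integrating it out leaves the density of the sum. *)
Lemma normal_pdf_convolution (s1 s2 y z : R) : 0 < s1 -> 0 < s2 ->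
  let s := Num.sqrt (s1 ^+ 2 + s2 ^+ 2) in
  normal_pdf 0 s1 y * normal_pdf 0 s2 (z - y) =
  normal_pdf 0 s z * normal_pdf (z * s1 ^+ 2 / s ^+ 2) (s1 * s2 / s) y.
Proof.
move=> s1_gt0 s2_gt0 s.
have q0 : 0 < s1 ^+ 2 + s2 ^+ 2 by rewrite addr_gt0 ?exprn_gt0.
have s0 : 0 < s by rewrite sqrtr_gt0.
have ss : s ^+ 2 = s1 ^+ 2 + s2 ^+ 2 by rewrite sqr_sqrtr// ltW.
rewrite !normal_pdfE ?gt_eqF ?divr_gt0 ?mulr_gt0//.
rewrite mulrACA [RHS]mulrACA; congr (_ * _).
  rewrite /normal_peak -!invfM -!sqrtrM; last 2 first.
  - by rewrite mulrn_wge0// mulr_ge0 ?sqr_ge0 ?pi_ge0.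
  - by rewrite mulrn_wge0// mulr_ge0 ?sqr_ge0 ?pi_ge0.
  congr (Num.sqrt _)^-1; rewrite expr_div_n exprMn; field.
  by rewrite gt_eqF.
rewrite /normal_fun -!expRD; congr expR.
rewrite expr_div_n exprMn ss; field.
by rewrite !gt_eqF ?exprn_gt0//.
Qed.

Lemma ge0_integral_law d d' (T : measurableType d) (T' : measurableType d')
    (m : probability T R) (g : T -> T') (nu : {measure set T' -> \bar R}) :
  measurable_fun [set: T] g ->
  (forall A, measurable A -> m (g @^-1` A) = nu A) ->
  forall k : T' -> \bar R, measurable_fun [set: T'] k -> (forall x, (0 <= k x)%E) ->
  (\int[m]_x k (g x) = \int[nu]_y k y)%E.
Proof.
move=> mg lg k mk k0.
pose g' : {mfun T >-> T'} := HB.pack g (isMeasurableFun.Build _ _ _ _ _ mg).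
rewrite -(@eq_measure_integral _ _ _ _ _ (distribution m g')).
  by rewrite ge0_integral_distribution.
by move=> A mA _; exact: lg.
Qed.

Lemma integral_law d d' (T : measurableType d) (T' : measurableType d')
    (m : probability T R) (g : T -> T') (nu : {measure set T' -> \bar R}) :
  measurable_fun [set: T] g ->
  (forall A, measurable A -> m (g @^-1` A) = nu A) ->
  forall k : T' -> \bar R, measurable_fun [set: T'] k ->
  (\int[m]_x k (g x) = \int[nu]_y k y)%E.
Proof.
move=> mg lg k mk; rewrite [LHS]integralE [RHS]integralE.
have mp := measurable_funepos mk; have mn := measurable_funeneg mk.
rewrite -(ge0_integral_law mg lg mp (funepos_ge0 _)).
rewrite -(ge0_integral_law mg lg mn (funeneg_ge0 _)).
by congr (_ - _)%E; apply: eq_integral => w _; rewrite unlock.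
Qed.

(** Independence is expressed by the two variables living on the two factors of a
product, so that the lemma can be iterated along the recursive definition of
the law of a sample. *)
Lemma normal_prob_sum d1 d2 (T1 : measurableType d1) (T2 : measurableType d2)
    (m1 : probability T1 R) (m2 : probability T2 R) (f : T1 -> R) (g : T2 -> R)
    (s1 s2 : R) : 0 < s1 -> 0 < s2 ->
  measurable_fun [set: T1] f -> measurable_fun [set: T2] g ->
  (forall A, measurable A -> m1 (f @^-1` A) = normal_prob 0 s1 A) ->
  (forall A, measurable A -> m2 (g @^-1` A) = normal_prob 0 s2 A) ->
  forall A, measurable A ->
  (m1 \x m2)%E [set z | A (f z.1 + g z.2)] =
  normal_prob 0 (Num.sqrt (s1 ^+ 2 + s2 ^+ 2)) A.
Proof.
move=> s10 s20 mf mg lf lg A mA; set s := Num.sqrt _.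
have mpdf (m t : R) : measurable_fun [set: R] (fun x => (normal_pdf m t x)%:E).
  by apply/measurable_EFinP; exact: measurable_normal_pdf.
pose h (x : R) : \bar R := (\1_A x : R)%:E.
have mh : measurable_fun [set: R] h.
  by apply/measurable_EFinP; exact: measurable_indic.
have h0 x : (0 <= h x)%E by rewrite lee_fin.
have mB : measurable [set z : T1 * T2 | A (f z.1 + g z.2)].
  rewrite -[X in measurable X]setTI.
  have := @measurable_funD _ _ _ setT (f \o fst : T1 * T2 -> R) (g \o snd).
  apply => //; exact: measurableT_comp.
have pdf0 (m t x : R) : (0 <= (normal_pdf m t x)%:E)%E by rewrite lee_fin normal_pdf_ge0.
transitivity (\int[m1]_x \int[m2]_y h (f x + g y)%R)%E.
  rewrite /product_measure1; apply: eq_integral => x _ /=.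
  transitivity (\int[m2]_y (\1_(xsection [set z : T1 * T2 | A (f z.1 + g z.2)] x) y)%:E)%E.
    by rewrite integral_indic ?setIT//; exact: measurable_xsection.
  apply: eq_integral => y _; rewrite /h !indicE; congr (_%:R%:E); congr nat_of_bool.
  by apply/idP/idP; rewrite !inE/= /xsection/= inE.
have e2 (x : T1) : (\int[m2]_y h (f x + g y)%R =
    \int[leb]_z (h (f x + z)%R * (normal_pdf 0 s2 z)%:E))%E.
  have m' : measurable_fun [set: R] (fun z => h (f x + z)).
    by apply: measurableT_comp => //; exact: measurable_funD.
  rewrite -ge0_integral_normal_prob//.
  by rewrite (@ge0_integral_law _ _ _ (measurableTypeR R) m2 g (normal_prob 0 s2) mg lg _ m').
under eq_integral do rewrite e2.
pose k (u z : R) := (h (u + z)%R * (normal_pdf 0 s2 z)%:E)%E.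
have mk : measurable_fun [set: R * R] (fun p : R * R => k p.1 p.2).
  apply: emeasurable_funM.
    by apply: measurableT_comp => //; exact: measurable_funD.
  exact: (measurableT_comp (mpdf _ _)).
have k0 u z : (0 <= k u z)%E by rewrite mule_ge0.
have mK : measurable_fun [set: R] (fun u => \int[leb]_z k u z)%E.
  exact: (@measurable_fun_fubini_tonelli_F _ _ _ _ _ leb (fun p : R * R => k p.1 p.2)).
have K0 u : (0 <= \int[leb]_z k u z)%E by exact: integral_ge0.
rewrite (@ge0_integral_law _ _ _ (measurableTypeR R) m1 f (normal_prob 0 s1) mf lf _ mK)//.
rewrite ge0_integral_normal_prob//.
transitivity (\int[leb]_u \int[leb]_z
    (h z * ((normal_pdf 0 s2 (z - u))%:E * (normal_pdf 0 s1 u)%:E)))%E.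
  apply: eq_integral => u _.
  pose F z : \bar R := (h z * (normal_pdf 0 s2 (z - u)%R)%:E)%E.
  have mF : measurable_fun [set: R] F.
    apply: emeasurable_funM => //.
    by apply: (measurableT_comp (mpdf _ _)); exact: measurable_funB.
  have F0 z : (0 <= F z)%E by rewrite mule_ge0.
  have -> : (\int[leb]_z k u z = \int[leb]_z F z)%E.
    rewrite -(ge0_integral_translation u mF F0).
    by apply: eq_integral => z _; rewrite /F /k addrK addrC.
  rewrite -(ge0_integralZr leb measurableT mF)//.
  by apply: eq_integral => z _; rewrite /F muleA.
pose q (p : R * R) := (h p.2 * ((normal_pdf 0 s2 (p.2 - p.1))%:E * (normal_pdf 0 s1 p.1)%:E))%E.
have mq : measurable_fun [set: R * R] q.
  apply: emeasurable_funM; first exact: measurableT_comp.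
  apply: emeasurable_funM; last exact: (measurableT_comp (mpdf _ _)).
  by apply: (measurableT_comp (mpdf _ _)); exact: measurable_funB.
have q0 p : (0 <= q p)%E by rewrite !mule_ge0.
rewrite (@fubini_tonelli _ _ _ _ _ leb leb q)//.
rewrite /normal_prob [RHS]integral_mkcond; apply: eq_integral => z _.
rewrite /q/= patchE.
transitivity (\int[leb]_u (h z * ((normal_pdf 0 s z)%:E * (normal_pdf (z * s1 ^+ 2 / s ^+ 2) (s1 * s2 / s) u)%:E)))%E.
  apply: eq_integral => u _; congr (_ * _)%E.
  by rewrite -!EFinM mulrC normal_pdf_convolution.
rewrite ge0_integralZl//; last 2 first.
- by apply: emeasurable_funM; [exact: measurable_cst|exact: mpdf].
- by move=> u _; rewrite mule_ge0.
rewrite ge0_integralZl//; last exact: mpdf.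
rewrite integral_normal_pdf mule1 /h indicE.
by case: (z \in A); rewrite ?mul1e ?mul0e.
Qed.

End normal.

(** * The logarithmic moment of a normal variable *)

Section log_moment.
Context {R : realType}.
Local Notation leb := (@lebesgue_measure R).

(** The density is at most its peak. *)
Lemma normal_prob_itv_le (s r : R) : 0 < s -> 0 <= r ->
  (normal_prob 0 s [set x | (`|x| < r)%R] <= (normal_peak s * (r + r))%:E)%E.
Proof.
move=> s0 r0.
have -> : [set x : R | (`|x| < r)%R] = [set` `](- r)%R, r[].
  by apply/seteqP; split => x/=; rewrite in_itv/= ltr_norml.
have mpdf (A : set R) : measurable_fun A (fun x => (normal_pdf 0 s x)%:E).
  by apply: measurable_funTS; apply/measurable_EFinP; exact: measurable_normal_pdf.
apply: (@le_trans _ _ (\int[leb]_(x in [set` `](- r)%R, r[]) (normal_peak s)%:E)%E).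
  apply: ge0_le_integral => //.
  - by move=> x _; rewrite lee_fin normal_pdf_ge0.
  - exact: mpdf.
  - by move=> x _; rewrite lee_fin normal_pdf_ub// gt_eqF.
rewrite integral_cst//= lebesgue_measure_itv/= lte_fin.
case: ifPn => _; first by rewrite -EFinB -EFinM opprK.
by rewrite mule0 lee_fin mulr_ge0 ?normal_peak_ge0// addr_ge0.
Qed.

Lemma integral_expRN_lty (k : R) : 0 <= k ->
  (\int[leb]_(r in `[0%R, +oo[) (k * expR (- r))%:E < +oo)%E.
Proof.
move=> k0.
have dF (x : R) : is_derive x 1 (fun r : R => - (k * expR (- r))) (k * expR (- x)).
  pose g (r : R) := - r.
  have dg : is_derive x 1 g (- 1) by exact: is_deriveN.
  have de := @is_derive1_comp _ (@expR R) g x _ _ (is_derive_expR (g x)) dg.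
  have := is_deriveN (is_deriveZ k de).
  by move=> h; apply: is_derive_eq; rewrite /GRing.scale/= mulrN1 mulrN opprK.
have cexp : continuous (fun r : R => k * expR (- r)).
  move=> x; apply: cvgM; first exact: cvg_cst.
  apply: (@continuous_comp _ _ _ (fun r : R => - r) (@expR R)).
    exact: opp_continuous.
  exact: continuous_expR.
rewrite (@ge0_continuous_FTC2y _ (fun r => k * expR (- r))
   (fun r => - (k * expR (- r))) 0 0).
- by rewrite -EFinB ltry.
- by move=> x _; rewrite mulr_ge0// expR_ge0.
- exact: continuous_subspaceT.
- rewrite -[X in _ --> X]oppr0; apply: cvgN; rewrite -[X in _ --> X](mulr0 k).
  apply: cvgM; [exact: cvg_cst|exact: cvgr_expR].
- by move=> x _; have [] := dF x.
- exact: cvg_at_right_filter (is_derive_continuous (dF 0)).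
- by move=> x _; rewrite derive1E; have [_] := dF x.
Qed.

Lemma measurable_ln_norm : measurable_fun [set: R] (fun x : R => ln `|x|).
Proof.
apply: (measurableT_comp (@measurable_ln R)).
exact: (@normr_measurable R setT).
Qed.

(** Integrate the tails: [- ln |x| > r] means [|x| < exp (- r)], an event of
probability at most a constant times [exp (- r)]. *)
Lemma integral_neg_ln_normal (s : R) : 0 < s ->
  (\int[normal_prob 0 s]_x (Num.max 0 (- ln `|x|))%:E < +oo)%E.
Proof.
move=> s0.
pose A (x : R) : R := Num.max 0 (- ln `|x|).
have mA : measurable_fun [set: measurableTypeR R] (A : measurableTypeR R -> R).
  apply: measurable_maxr => //.
  by apply: measurableT_comp => //; exact: measurable_ln_norm.
pose A' : {mfun measurableTypeR R >-> R} := HB.pack A (isMeasurableFun.Build _ _ _ _ _ mA).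
have A0 x : 0 <= A x by rewrite le_max lexx.
have := @ge0_expectation_ccdf _ _ _ (normal_prob 0 s) A' A0.
rewrite expectation_def => ->.
apply: le_lt_trans (@integral_expRN_lty (normal_peak s * 2) _); last first.
  by rewrite mulr_ge0 ?normal_peak_ge0.
apply: ge0_le_integral => //.
- by apply: measurable_funTS; exact: ccdf_measurable.
- apply: measurable_funTS; apply/measurable_EFinP; apply: measurable_funM => //.
  by apply: measurableT_comp; [exact: measurable_expR|exact: oppr_measurable].
- move=> r; rewrite /= in_itv/= andbT => r0.
  apply: (@le_trans _ _ (normal_prob 0 s [set x | (`|x| < expR (- r))%R])).
    rewrite /ccdf /distribution /pushforward/=; apply: le_measure; rewrite ?inE.
    + rewrite -[X in measurable X]setTI; exact: (mA measurableT _ (measurable_itv _)).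
    + rewrite (_ : [set _ | _] = [set` `](- expR (- r))%R, (expR (- r))[]); first exact: measurable_itv.
      by apply/seteqP; split => x/=; rewrite in_itv/= ltr_norml.
    + move=> x/=; rewrite in_itv/= andbT /A lt_max ltNge r0/= ltrNr => h.
      have [x0|x0] := eqVneq x 0; first by rewrite x0 normr0 expR_gt0.
      by rewrite -ltr_ln ?posrE ?normr_gt0 ?expR_gt0// expRK.
  rewrite (le_trans (normal_prob_itv_le _ _))// ?expR_ge0// lee_fin.
  by rewrite -mulrA -mulr2n mulr_natl.
Qed.

(** Multiplying the density of standard deviation [s] by this exponential gives a
multiple of the density of standard deviation [sqrt 2 * s]. *)
Lemma integral_expR_sqr_normal (s : R) : 0 < s ->
  (\int[normal_prob 0 s]_x (expR (x ^+ 2 / (4 * s ^+ 2)))%:E < +oo)%E.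
Proof.
move=> s0.
have me : measurable_fun [set: R] (fun x : R => (expR (x ^+ 2 / (4 * s ^+ 2)))%:E).
  apply/measurable_EFinP; apply: (measurableT_comp (@measurable_expR R)).
  apply: measurable_funM => //; exact: measurable_funX.
rewrite ge0_integral_normal_prob//.
pose t := Num.sqrt 2 * s.
have t0 : 0 < t by rewrite mulr_gt0// sqrtr_gt0.
have t2 : t ^+ 2 = 2 * s ^+ 2 by rewrite exprMn sqr_sqrtr.
have -> : (fun x : R => ((expR (x ^+ 2 / (4 * s ^+ 2)))%:E * (normal_pdf 0 s x)%:E)%E) =
   fun x => ((normal_peak s / normal_peak t)%:E * (normal_pdf 0 t x)%:E)%E.
  apply/funext => x; rewrite -!EFinM; congr (_%:E).
  rewrite !normal_pdfE ?gt_eqF// mulrCA [in RHS]mulrA divfK ?gt_eqF ?normal_peak_gt0 ?gt_eqF//.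
  congr (_ * _); rewrite /normal_fun -expRD t2; congr expR.
  by field; rewrite gt_eqF.
rewrite ge0_integralZl//.
- by rewrite integral_normal_pdf mule1 ltry.
- by apply/measurable_EFinP; exact: measurable_normal_pdf.
- by move=> x _; rewrite lee_fin normal_pdf_ge0.
- by rewrite lee_fin divr_ge0// normal_peak_ge0.
Qed.

(** Large values of the logarithm are dominated through
[ln |x| <= 1 + x^2 <= (1 + 4 s^2) * exp (x^2 / (4 s^2))]. *)
Lemma integrable_ln_normal (s : R) : 0 < s ->
  (normal_prob 0 s).-integrable [set: R] (fun x => (ln `|x|)%:E).
Proof.
move=> s0; apply/integrableP; split.
  by apply/measurable_EFinP; exact: measurable_ln_norm.
pose f1 (x : R) : \bar R := (Num.max 0 (- ln `|x|))%:E.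
pose f2 (x : R) : \bar R := ((1 + 4 * s ^+ 2) * expR (x ^+ 2 / (4 * s ^+ 2)))%:E.
have m1 : measurable_fun [set: R] f1.
  apply/measurable_EFinP; apply: measurable_maxr => //.
  by apply: measurableT_comp => //; exact: measurable_ln_norm.
have me : measurable_fun [set: R] (fun x : R => (expR (x ^+ 2 / (4 * s ^+ 2)))%:E).
  apply/measurable_EFinP; apply: (measurableT_comp (@measurable_expR R)).
  apply: measurable_funM => //; exact: measurable_funX.
have m2 : measurable_fun [set: R] f2.
  by apply/measurable_EFinP; apply: measurable_funM => //; apply/measurable_EFinP.
have k0 : 0 <= 1 + 4 * s ^+ 2 by rewrite addr_ge0// mulr_ge0// sqr_ge0.
apply: (@le_lt_trans _ _ (\int[normal_prob 0 s]_x (f1 x + f2 x))%E).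
  apply: ge0_le_integral => //.
  - apply: measurableT_comp => //; apply/measurable_EFinP; exact: measurable_ln_norm.
  - exact: emeasurable_funD.
  - move=> x _; rewrite /f1 /f2 lee_fin.
    have e1 := expR_ge1Dx (x ^+ 2 / (4 * s ^+ 2)).
    have f20 : 1 + x ^+ 2 <= (1 + 4 * s ^+ 2) * expR (x ^+ 2 / (4 * s ^+ 2)).
      apply: (@le_trans _ _ ((1 + 4 * s ^+ 2) * (1 + x ^+ 2 / (4 * s ^+ 2)))); last first.
        by rewrite ler_pM2l// ltr_wpDr// mulr_ge0// sqr_ge0.
      have -> : (1 + 4 * s ^+ 2) * (1 + x ^+ 2 / (4 * s ^+ 2)) =
         1 + x ^+ 2 + (4 * s ^+ 2 + x ^+ 2 / (4 * s ^+ 2)).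
        by field; rewrite gt_eqF.
      have s4 : 0 <= 4 * s ^+ 2 by rewrite mulr_ge0// sqr_ge0.
      by rewrite lerDl addr_ge0// divr_ge0// sqr_ge0.
    rewrite ler_norml; apply/andP; split.
      have : - ln `|x| <= Num.max 0 (- ln `|x|) by rewrite le_max lexx orbT.
      have : 0 <= 1 + x ^+ 2 by rewrite addr_ge0 ?sqr_ge0.
      lra.
    have : ln `|x| <= 1 + x ^+ 2.
      have [->|x0] := eqVneq x 0; first by rewrite normr0 ln0// addr_ge0 ?sqr_ge0.
      have := @ln_sublinear R `|x|; rewrite normr_gt0 => /(_ x0).
      have := sqr_ge0 (`|x| - 1); rewrite sqrrB1 real_normK ?num_real//.
      have := normr_ge0 x; rewrite mulr2n; lra.
    have : 0 <= Num.max 0 (- ln `|x|) by rewrite le_max lexx.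
    lra.
have f10 x : (0 <= f1 x)%E by rewrite lee_fin le_max lexx.
have f20 x : (0 <= f2 x)%E by rewrite lee_fin mulr_ge0// expR_ge0.
rewrite ge0_integralD//; apply: lte_add_pinfty.
  exact: integral_neg_ln_normal.
rewrite (_ : f2 = fun x : R => ((1 + 4 * s ^+ 2)%R%:E * (expR (x ^+ 2 / (4 * s ^+ 2)))%:E)%E)//.
rewrite ge0_integralZl// ?lee_fin//.
by rewrite lte_mul_pinfty// ?lee_fin//; exact: integral_expR_sqr_normal.
Qed.

Lemma normal_prob_set1 (s x : R) : normal_prob 0 s [set x] = 0%E.
Proof. by rewrite /normal_prob integral_set1. Qed.

End log_moment.

(** * The sign correlation of a Gaussian pair *)

Lemma measurable_sg (R : realType) d (T : measurableType d) (f : T -> R) :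
  measurable_fun [set: T] f -> measurable_fun [set: T] (fun w => Num.sg (f w)).
Proof.
move=> mf; have -> : (fun w => Num.sg (f w)) =
    fun w => if 0 < f w then 1 else if f w < 0 then -1 else 0.
  by apply/funext => w; case: sgrP.
apply: measurable_fun_ifT => //; first exact: measurable_fun_ltr.
by apply: measurable_fun_ifT => //; exact: measurable_fun_ltr.
Qed.

Section gaussian_sign.
Context {R : realType} d (T : measurableType d) (P : probability T R).
Local Notation leb := (@lebesgue_measure R).
Variables (U V : T -> R) (s0 phi : R).
Hypotheses (mU : measurable_fun [set: T] U) (mV : measurable_fun [set: T] V).
Hypotheses (s0_gt0 : 0 < s0) (phi_gt : - (pi / 2) < phi) (phi_lt : phi < pi / 2).
Hypothesis normalUV : forall a b : R, a != 0 -> b != 0 ->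
  forall A : set R, measurable A ->
  P [set w | A (a * U w + b * V w)] =
  normal_prob 0 (s0 * Num.sqrt (a ^+ 2 + 2 * a * b * sin phi + b ^+ 2)) A.

Let sin_lt1 : `|sin phi| < 1.
Proof.
have c0 : 0 < cos phi by apply: cos_gt0_pihalf; rewrite phi_gt phi_lt.
rewrite -(@expr_lt1 _ 2)// real_normK ?num_real// sin2cos2.
by rewrite ltrBlDr ltrDl exprn_gt0.
Qed.

(** This constant cancels between [U + t V] and [U - t V]. *)
Let kappa : \bar R := (\int[normal_prob 0 s0]_x (ln `|x|)%:E)%E.

Let kappaE : kappa = (fine kappa)%:E.
Proof. by rewrite fineK// integrable_fin_num//; exact: integrable_ln_normal. Qed.

Let mUV (a b : R) : measurable_fun [set: T] (fun w => a * U w + b * V w).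
Proof. by apply: measurable_funD; apply: measurable_funM => //; exact: measurable_cst. Qed.

Let integrable_unit (a b : R) : a != 0 -> b != 0 ->
  a ^+ 2 + 2 * a * b * sin phi + b ^+ 2 = 1 ->
  P.-integrable [set: T] (fun w => (ln `|a * U w + b * V w|)%:E) /\
  (\int[P]_w (ln `|a * U w + b * V w|)%:E = kappa)%E.
Proof.
move=> a0 b0 q1.
have law A : measurable A -> P ((fun w => a * U w + b * V w) @^-1` A) = normal_prob 0 s0 A.
  by move=> mA; rewrite (normalUV a0 b0)// q1 sqrtr1 mulr1.
have ml := measurable_ln_norm (R := R).
have m1 := measurableT_comp ml (mUV a b).
have ge0law := @ge0_integral_law _ _ _ T (measurableTypeR R) P _ (normal_prob 0 s0) (mUV a b) law.
split.
  apply/integrableP; split; first exact/measurable_EFinP.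
  have ml' : measurable_fun [set: measurableTypeR R] (fun x : measurableTypeR R => `|(ln `|x|)%:E|%E).
    by apply: measurableT_comp => //; exact/measurable_EFinP.
  rewrite (ge0law _ ml')//.
  by have /integrableP[] := integrable_ln_normal s0_gt0.
have mle : measurable_fun [set: measurableTypeR R] (fun x : measurableTypeR R => (ln `|x|)%:E).
  exact/measurable_EFinP.
exact: (@integral_law _ _ _ T (measurableTypeR R) P _ (normal_prob 0 s0) (mUV a b) law _ mle).
Qed.

Let q (t : R) := 1 + 2 * t * sin phi + t ^+ 2.
Let q_gt0 t : 0 < q t. Proof. exact: quad_gt0. Qed.

(** The variable [U + t * V] is [sqrt (q t)] times a variable with the law
[normal_prob 0 s0], which shifts the expected logarithm by [ln (q t) / 2]. *)
Let integrable_ray (t : R) : t != 0 ->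
  P.-integrable [set: T] (fun w => (ln `|U w + t * V w|)%:E) /\
  (\int[P]_w (ln `|U w + t * V w|)%:E = (fine kappa + ln (q t) / 2)%:E)%E.
Proof.
move=> t0; pose r := Num.sqrt (q t).
have r0 : 0 < r by rewrite sqrtr_gt0.
have rr : r ^+ 2 = q t by rewrite sqr_sqrtr// ltW.
have rV0 : r^-1 != 0 by rewrite invr_eq0 gt_eqF.
have tr0 : t / r != 0 by rewrite mulf_neq0.
have [|i1 e1] := integrable_unit rV0 tr0.
  have -> : r^-1 ^+ 2 + 2 * r^-1 * (t / r) * sin phi + (t / r) ^+ 2 = q t / r ^+ 2.
    by rewrite /q; field; rewrite gt_eqF.
  by rewrite rr divff// gt_eqF.
pose W w := r^-1 * U w + t / r * V w.
pose g w : \bar R := ((ln `|W w|)%:E + (ln (q t) / 2)%:E)%E.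
have ig : P.-integrable [set: T] g.
  by apply: integrableD => //; exact: finite_measure_integrable_cst.
have eg : (\int[P]_w g w = (fine kappa + ln (q t) / 2)%:E)%E.
  rewrite integralD//; last exact: finite_measure_integrable_cst.
  by rewrite e1 integral_cst//= probability_setT mule1 kappaE EFinD.
have mf : measurable_fun [set: T] (fun w => (ln `|U w + t * V w|)%:E).
  apply/measurable_EFinP; apply: (measurableT_comp (@measurable_ln_norm R)).
  by have := mUV 1 t; apply: eq_measurable_fun => w _; rewrite mul1r.
(* The logarithm of the product splits except where W = 0, a null set. *)
have ae : ae_eq P [set: T] g (fun w => (ln `|U w + t * V w|)%:E).
  exists (W @^-1` [set 0]); split.
  - by rewrite -[X in measurable X]setTI; apply: mUV.
  - exact: etrans (normalUV rV0 tr0 (measurable_set1 0)) (normal_prob_set1 _ _).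
  - move=> w /= /not_implyP[_ h]; apply/eqP; apply: contra_notT h => W0.
    rewrite /g -EFinD; congr (_%:E).
    have -> : U w + t * V w = r * W w by rewrite /W; field; rewrite gt_eqF.
    rewrite normrM lnM ?posrE ?normr_gt0 ?(lt0r_neq0 r0)// (gtr0_norm r0) addrC.
    by rewrite -rr lnXn//; congr (_ + _); rewrite mulr2n; field.
split.
  apply/integrableP; split => //; have /integrableP[mg] := ig.
  rewrite (@ge0_ae_eq_integral _ _ _ P setT (fun w => `|g w|%E)
     (fun w => `|(ln `|U w + t * V w|)%:E|%E))//; try exact: measurableT_comp.
  exact: (ae_eq_comp _ ae).
rewrite -eg; apply: ae_eq_integral => //; first exact: measurable_int ig.
exact: ae_eq_sym.
Qed.

Let integral_ridge (t : R) : 0 < t ->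
  (\int[P]_w (log_ridge (U w) (V w) t)%:E = (log_ratio 1 phi t)%:E)%E.
Proof.
move=> t0.
have [i1 e1] := integrable_ray (lt0r_neq0 t0).
have [|i2 e2] := @integrable_ray (- t); first by rewrite oppr_eq0 gt_eqF.
have -> : (\int[P]_w (log_ridge (U w) (V w) t)%:E =
  \int[P]_w ((t^-1)%:E * ((ln `|U w + t * V w|)%:E - (ln `|U w + - t * V w|)%:E)))%E.
  by apply: eq_integral => w _; rewrite /log_ridge -EFinB -EFinM mulrC mulNr.
rewrite integralZl//; last exact: integrableB.
rewrite integralB// e1 e2 -EFinB -EFinM /log_ratio /q; congr (_%:E).
rewrite !mul1r mulrN mulNr sqrrN; field; rewrite gt_eqF//.
Qed.

(** Both sides are odd in [phi]. *)
Let integral_log_ratio_signed :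
  (\int[leb]_(t in `]0%R, +oo[) (log_ratio 1 phi t)%:E = (pi * phi)%:E)%E.
Proof.
have [p0|p0] := leP 0 phi.
  by rewrite integral_log_ratio// p0 ltW.
have -> : (fun t => (log_ratio 1 phi t)%:E) = (fun t => - (log_ratio 1 (- phi) t)%:E)%E.
  apply/funext => t; rewrite -EFinN; congr (_%:E).
  by rewrite /log_ratio sinN !mulrN opprK -[RHS]mulNr opprB.
have np : 0 <= - phi <= pi / 2 by rewrite oppr_ge0 ltW//= lerNl ltW.
rewrite integral_ge0N.
  by rewrite integral_log_ratio// -EFinN mulrN opprK.
move=> t; rewrite /= in_itv/= andbT => t0; rewrite lee_fin.
have sp0 : 0 <= sin (- phi) by rewrite sin_ge0_pi// oppr_ge0 ltW//= lerNl; have := pi_gt0 R; lra.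
rewrite divr_ge0 ?mulr_ge0 ?(ltW t0)// subr_ge0 !mul1r ler_ln ?posrE ?quad_gt0 ?normrN//.
- have := mulr_ge0 (ltW t0) sp0; lra.
- by rewrite -mulrN quad_gt0// normrN sinN normrN.
- by rewrite sinN normrN.
Qed.

(** Exchange the expectation with the integral in [t] that represents the sign of
[U * V].  Here [sin phi] is the correlation.  The law of a combination is
assumed only for nonzero coefficients, since only the lines [U + t * V] with
[t != 0] occur. *)
Lemma gaussian_sign_correlation :
  (\int[P]_w (Num.sg (U w * V w))%:E = (2 / pi * phi)%:E)%E.
Proof.
pose D := `]0%R, +oo[%classic : set R.
pose F (z : T * R) : \bar R := (log_ridge (U z.1) (V z.1) z.2)%:E.
pose f := F \_ (setT `*` D).
have mD : measurable D by exact: measurable_itv.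
have mTD : measurable ([set: T] `*` D) by exact: measurableX.
have mF : measurable_fun setT F.
  by apply/measurable_EFinP; apply: measurable_log_ridge => //; exact: measurableT_comp.
have mf : measurable_fun setT f.
  by apply/(measurable_restrictT _ _).1 => //; exact: measurable_funTS.
have fE w t : f (w, t) = if t \in D then F (w, t) else 0%E.
  by rewrite /f patchE in_setX in_setT.
have fD w : (fun t => f (w, t)) = (fun t => F (w, t)) \_ D.
  by apply/funext => t; rewrite fE patchE.
have pi20 : (0 : R) < pi * (pi / 2) by rewrite mulr_gt0 ?divr_gt0 ?pi_gt0.
have i1 : (P \x leb)%E.-integrable setT f.
  apply/integrable12ltyP => //.
  apply: (@le_lt_trans _ _ (\int[P]_w (pi * (pi / 2))%:E)%E); last first.
    by rewrite integral_cst//= probability_setT mule1 ltry.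
  apply: ge0_le_integral => //.
  - by move=> w _; exact: integral_ge0.
  - have mfa : measurable_fun [set: T * measurableTypeR R] (abse \o f).
      exact: measurableT_comp.
    have fa0 z : (0 <= (abse \o f) z)%E by rewrite /= abse_ge0.
    exact: (@measurable_fun_fubini_tonelli_F _ _ T (measurableTypeR R) R leb _ mfa fa0).
  - move=> w _.
    have -> : (fun t => `|f (w, t)|%E) = (fun t => `|F (w, t)|%E) \_ D.
      by apply/funext => t; rewrite fE patchE; case: ifP => //; rewrite abse0.
    rewrite -integral_mkcond /F/= integral_abs_log_ridge lee_fin.
    rewrite normr_sg; case: (_ != _); rewrite ?mul1r ?mul0r//; exact: ltW.
have := Fubini i1.
under eq_integral do rewrite fD -integral_mkcond /F/= integral_log_ridge EFinM.
have -> : (fun t => \int[P]_w f (w, t))%E = (fun t => (log_ratio 1 phi t)%:E) \_ D.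
  apply/funext => t; rewrite patchE; case: ifPn => tD.
    under eq_integral do rewrite fE tD.
    by move: tD; rewrite inE /D/= in_itv/= andbT => t0; exact: integral_ridge.
  by rewrite integral0_eq// => w _; rewrite fE (negbTE tD).
have isg : P.-integrable [set: T] (fun w => (Num.sg (U w * V w))%:E).
  apply: (@le_integrable _ _ _ _ _ measurableT _ (cst 1%E)).
  - by apply/measurable_EFinP; apply: measurable_sg; exact: measurable_funM.
  - by move=> w _; rewrite /= normr1 lee_fin normr_sg lern1 leq_b1.
  - exact: finite_measure_integrable_cst.
rewrite -integral_mkcond integral_log_ratio_signed integralZr//.
set I := (\int[P]_w _)%E => e.
have If : I \is a fin_num by exact: integrable_fin_num.
rewrite -(fineK If) in e *; congr (_%:E).
move: e; rewrite -EFinM => -[e].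
have solve (p f' x : R) : p != 0 -> x * (p * (p / 2)) = p * f' -> x = 2 / p * f'.
  move=> p0 h; apply: (mulIf (x := p * (p / 2))); first by rewrite !mulf_neq0.
  by rewrite h; field.
by apply: solve => //; rewrite gt_eqF ?pi_gt0.
Qed.

End gaussian_sign.

(** * The law of an i.i.d. sample *)

(** The constant 4 is a bound for [exp 1], chosen for simplicity: it enters only
the absolute constant of the final exponent. *)
Lemma expR_le_quad (R : realType) (x : R) : `|x| <= 1 -> expR x <= 1 + x + 4 * x ^+ 2.
Proof.
move=> x1.
(* From exp (- 1/2) >= 1/2. *)
have e4 : expR 1 <= 4 :> R.
  have := @expR_ge1Dx R (- 2^-1); rewrite expRN => h.
  have h2 : expR (2^-1) <= 2 :> R.
    by move: h; rewrite -[leRHS]mul1r ler_pdivlMr ?expR_gt0//; lra.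
  have -> : (1 : R) = 2^-1 + 2^-1 by field.
  rewrite expRD; have := expR_ge0 (2^-1 : R); nra.
have := expR_gt0 x; have h := expR_ge1Dx (- x).
have [x0|x0] := leP 0 x.
  have ex4 : expR x <= 4 by rewrite (le_trans _ e4)// ler_expR; move: x1; rewrite ger0_norm.
  have h1 : expR x * (1 - x) <= 1.
    by rewrite -[leRHS](expRxMexpNx_1 x) ler_wpM2l ?expR_ge0//; lra.
  rewrite expr2 => ex0.
  have h3 : expR x - 1 <= x * expR x by lra.
  have h4 : x * (expR x - 1) <= x * (x * expR x) by rewrite ler_wpM2l.
  have h5 : x * (x * expR x) <= x * (x * 4) by rewrite !ler_wpM2l.
  lra.
have h1 : expR x * (1 - x) <= 1.
  by rewrite -[leRHS](expRxMexpNx_1 x) ler_wpM2l ?expR_ge0//; lra.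
rewrite expr2 => ex0.
have d0 : 0 < 1 - x by lra.
have : expR x <= (1 - x)^-1 by rewrite -[leRHS]mul1r ler_pdivlMr.
move/le_trans; apply; rewrite -[leLHS]mul1r ler_pdivrMr//.
have : 0 <= x * x by rewrite -expr2 sqr_ge0.
have : x * x * x <= 0 by rewrite mulr_ge0_le0 ?(ltW x0)// -expr2 sqr_ge0.
lra.
Qed.

Section iid_law.
Context {R : realType} d (T : measurableType d) (mu : probability T R).

Definition cons_pair n (z : T * n.-tuple T) : n.+1.-tuple T :=
  [the n.+1.-tuple T of z.1 :: z.2].

Lemma measurable_cons_pair n : measurable_fun [set: T * n.-tuple T] (@cons_pair n).
Proof. exact: measurable_cons. Qed.

HB.instance Definition _ n := isMeasurableFun.Build _ _ _ _ (@cons_pair n)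
  (@measurable_cons_pair n).

(** A recursion on the size, by product with one more factor: both the bounded
differences inequality and the laws of sums proceed by splitting off the first
observation. *)
Fixpoint iid_law n : probability (n.-tuple T) R :=
  match n with
  | 0 => \d_ [tuple]
  | m.+1 => distribution (mu \x iid_law m)%E (@cons_pair m)
  end.

Lemma ge0_integral_iid_lawS n (g : n.+1.-tuple T -> \bar R) :
  measurable_fun [set: n.+1.-tuple T] g -> (forall s, (0 <= g s)%E) ->
  (\int[iid_law n.+1]_s g s =
   \int[mu]_t \int[iid_law n]_s g (cons_pair (t, s)))%E.
Proof.
move=> mg g0 /=; rewrite ge0_integral_distribution//.
have mgc : measurable_fun setT (g \o @cons_pair n).
  by apply: measurableT_comp => //; exact: measurable_cons_pair.
exact: (fubini_tonelli1 _ mgc (fun z => g0 _)).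
Qed.

Definition rectangle n (A : 'I_n -> set T) : set (n.-tuple T) :=
  [set s | forall l, A l (tnth s l)].

Lemma rectangleE n (A : 'I_n -> set T) :
  rectangle A = \big[setI/setT]_(l < n) ((fun s : n.-tuple T => tnth s l) @^-1` A l).
Proof.
rewrite -bigcap_seq; apply/seteqP; split => s /=.
  by move=> h l _; exact: h.
by move=> h l; apply: (h l); rewrite /= mem_index_enum.
Qed.

Lemma measurable_rectangle n (A : 'I_n -> set T) :
  (forall l, measurable (A l)) -> measurable (rectangle A).
Proof.
move=> mA; rewrite rectangleE; apply: bigsetI_measurable => l _.
by rewrite -[X in measurable X]setTI; apply: measurable_tnth.
Qed.

Lemma iid_law_rectangle n (A : 'I_n -> set T) : (forall l, measurable (A l)) ->
  iid_law n (rectangle A) = (\prod_(l < n) mu (A l))%E.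
Proof.
elim: n A => [|n IH] A mA.
  by rewrite big_ord0 /= diracE mem_set// => -[].
rewrite big_ord_recl -(IH (fun l => A (lift ord0 l)))// /= /distribution /pushforward/=.
rewrite -product_measure1E//; last exact: measurable_rectangle.
congr (_ _); apply/seteqP; split => -[t s] /=.
  move=> h; split=> /=; first exact: (h ord0).
  by move=> l; have := h (lift ord0 l); rewrite tnthS.
move=> [/= h1 h2] l; case: (unliftP ord0 l) => [j|] -> //.
by rewrite tnthS; exact: h2.
Qed.

(** Rectangles are stable under intersection and generate the sigma-algebra of
tuples. *)
Lemma iid_law_unique n (nu : probability (n.-tuple T) R) :
  (forall A : 'I_n -> set T, (forall l, measurable (A l)) ->
     nu (rectangle A) = (\prod_(l < n) mu (A l))%E) ->
  forall A, measurable A -> nu A = iid_law n A.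
Proof.
move=> nuE B mB.
pose G : set (set (n.-tuple T)) :=
  [set C | exists2 A : 'I_n -> set T, (forall l, measurable (A l)) & rectangle A = C].
apply: (@g_sigma_algebra_measure_unique _ _ _ G _ (fun=> setT)).
- by move=> _ [A mA <-]; exact: measurable_rectangle.
- by move=> _; exists (fun=> setT) => //; apply/seteqP; split.
- by rewrite bigcup_const.
- move=> _ _ [A mA <-] [A' mA' <-]; exists (fun l => A l `&` A' l).
    by move=> l; exact: measurableI.
  apply/seteqP; split => s /=; first by move=> h; split=> l; have [] := h l.
  by move=> [h h'] l; split.
- by move=> _ [A mA <-]; exact: etrans (nuE _ mA) (esym (iid_law_rectangle mA)).
- by move=> _ /=; rewrite (@probability_setT _ _ _ nu) ltry.
- move: B mB; apply: smallest_sub; first exact: smallest_sigma_algebra.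
  move=> C; rewrite -bigcup_seq => -[i _ [A mA <-]].
  apply: sub_sigma_algebra; exists (fun l => if l == i then A else setT).
    by move=> l; case: ifP.
  apply/seteqP; split => s /=; first by move=> /(_ i); rewrite eqxx.
  by move=> [_ h] l; case: eqP => [->|].
Qed.

(** Expand the exponential to second order when the exponent is at most 1; the first
order term has mean zero.  Otherwise [|s| * c > 1], and the exponent itself is
below [s^2 * c^2]. *)
Lemma hoeffding_exp (Y : T -> R) (B c s : R) : measurable_fun [set: T] Y ->
  (forall t, 0 <= Y t <= B) -> (forall t t', `|Y t - Y t'| <= c) ->
  (\int[mu]_t (expR (s * (Y t - fine (\int[mu]_t' (Y t')%:E))))%:E <=
   (expR (4 * s ^+ 2 * c ^+ 2))%:E)%E.
Proof.
move=> mY YB Yc.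
set y := fine _.
have mYE : measurable_fun [set: T] (EFin \o Y) by exact/measurable_EFinP.
have intB (f : T -> R) (b : R) : measurable_fun [set: T] f -> (forall t, `|f t| <= b) ->
    mu.-integrable [set: T] (EFin \o f).
  move=> mf fb; apply: (@le_integrable _ _ _ _ _ measurableT _ (cst b%:E)).
  - exact/measurable_EFinP.
  - by move=> t _; rewrite /= lee_fin (le_trans (fb t))// ler_norm.
  - exact: finite_measure_integrable_cst.
have iY : mu.-integrable [set: T] (EFin \o Y).
  apply: (intB _ B) => // t; have /andP[Y0 YB'] := YB t; by rewrite ger0_norm.
have yE : (\int[mu]_t (Y t)%:E = y%:E)%E by rewrite fineK//; exact: integrable_fin_num.
have Dc t : `|Y t - y| <= c.
  have le1 (b : R) : (forall t', Y t' <= b) -> y <= b.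
    move=> h; rewrite -lee_fin -yE.
    have -> : (b%:E = \int[mu]_t (cst b%:E) t)%E by rewrite integral_cst//= probability_setT mule1.
    apply: le_integral => //; first exact: finite_measure_integrable_cst.
    by move=> t' _; rewrite lee_fin.
  have le2 (b : R) : (forall t', b <= Y t') -> b <= y.
    move=> h; rewrite -lee_fin -yE.
    have -> : (b%:E = \int[mu]_t (cst b%:E) t)%E by rewrite integral_cst//= probability_setT mule1.
    apply: le_integral => //; first exact: finite_measure_integrable_cst.
    by move=> t' _; rewrite lee_fin.
  rewrite ler_norml; apply/andP; split.
    rewrite lerBrDr addrC -lerBrDr opprK; apply: le1 => t'.
    by have := Yc t t'; rewrite ler_norml => /andP[h _]; lra.
  rewrite lerBlDr addrC -lerBlDr; apply: le2 => t'.
  by have := Yc t t'; rewrite ler_norml => /andP[_ h]; lra.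
have mD : measurable_fun [set: T] (fun t => s * (Y t - y)).
  by apply: measurable_funM => //; exact: measurable_funB.
have mE : measurable_fun [set: T] (fun t => (expR (s * (Y t - y)))%:E).
  by apply/measurable_EFinP; apply: (measurableT_comp (@measurable_expR R)).
have c0 : 0 <= c by have := Yc point point; rewrite subrr normr0.
have sDc t : `|s * (Y t - y)| <= `|s| * c by rewrite normrM ler_wpM2l.
have s2 : (`|s| * c) ^+ 2 = s ^+ 2 * c ^+ 2 by rewrite exprMn real_normK ?num_real.
have [sc|sc] := leP (`|s| * c) 1; last first.
  apply: (@le_trans _ _ (\int[mu]_t (cst (expR (4 * s ^+ 2 * c ^+ 2))%:E) t)%E); last first.
    by rewrite integral_cst//= probability_setT mule1.
  apply: ge0_le_integral => //.
  - move=> t _; rewrite lee_fin ler_expR (le_trans (ler_norm _))// (le_trans (sDc t))//.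
    rewrite -mulrA -s2; have := sqr_ge0 (`|s| * c); rewrite expr2.
    have : 0 <= (`|s| * c - 1) * (`|s| * c) by apply: mulr_ge0; [rewrite subr_ge0 ltW|rewrite mulr_ge0].
    lra.
pose k := 4 * s ^+ 2 * c ^+ 2.
apply: (@le_trans _ _ (\int[mu]_t ((1 + k - s * y)%:E + (s * Y t)%:E))%E).
  apply: ge0_le_integral => //.
  - apply/measurable_EFinP; apply: measurable_funD => //; exact: measurable_funM.
  - move=> t _; rewrite -EFinD lee_fin.
    apply: (le_trans (expR_le_quad (le_trans (sDc t) sc))).
    have : (s * (Y t - y)) ^+ 2 <= s ^+ 2 * c ^+ 2.
      by rewrite -s2 -real_normK ?num_real// ler_sqr ?nnegrE ?mulr_ge0.
    rewrite /k; lra.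
rewrite integralD//; last 2 first.
- exact: finite_measure_integrable_cst.
- rewrite (_ : (fun t => _) = (fun t => s%:E * (EFin \o Y) t)%E)//; exact: integrableZl.
under [X in (_ + X)%E]eq_integral do rewrite EFinM.
rewrite integralZl// yE integral_cst//= probability_setT mule1 -EFinM -EFinD lee_fin.
rewrite subrK; exact: expR_ge1Dx.
Qed.

End iid_law.

(** * The bounded differences inequality *)

Section mcdiarmid.
Context {R : realType} d (T : measurableType d) (mu : probability T R).

Definition bounded_difference n (c : R) (g : n.-tuple T -> R) :=
  forall (s s' : n.-tuple T) (i : 'I_n),
    (forall j, j != i -> tnth s j = tnth s' j) -> `|g s - g s'| <= c.

Lemma integral_le_cst d' (S : measurableType d') (m : probability S R)
    (f : S -> \bar R) (b : R) : measurable_fun [set: S] f ->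
  (forall t, (0 <= f t)%E) -> (forall t, (f t <= b%:E)%E) ->
  (\int[m]_t f t <= b%:E)%E.
Proof.
move=> mf f0 fb.
apply: (@le_trans _ _ (\int[m]_t (cst b%:E) t)%E).
  exact: ge0_le_integral.
by rewrite integral_cst//= probability_setT mule1.
Qed.

(** Condition on the first coordinate: with it fixed, the remaining coordinates are
handled by induction, and the conditional mean as a function of the first
coordinate varies by at most [c], so that [hoeffding_exp] applies to it. *)
Lemma mcdiarmid_exp n (g : n.-tuple T -> R) (B c s : R) :
  measurable_fun [set: n.-tuple T] g -> (forall t, 0 <= g t <= B) ->
  bounded_difference c g ->
  (\int[iid_law mu n]_t (expR (s * (g t - fine (\int[iid_law mu n]_t' (g t')%:E))))%:E
   <= (expR (4 * n%:R * s ^+ 2 * c ^+ 2))%:E)%E.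
Proof.
elim: n g => [|n IH] g mg gB gc.
  have g0 t : g t = g [tuple] by rewrite (tuple0 t).
  have -> : (\int[iid_law mu 0]_t' (g t')%:E = (g [tuple])%:E)%E.
    under eq_integral do rewrite g0.
    by rewrite integral_cst//= probability_setT mule1.
  under eq_integral do rewrite g0 /= subrr mulr0 expR0.
  rewrite integral_cst//= probability_setT mule1.
  by rewrite mulr0 !mul0r expR0.
have mgE : measurable_fun [set: n.+1.-tuple T] (EFin \o g) by exact/measurable_EFinP.
have g0 t : (0 <= (g t)%:E)%E by rewrite lee_fin; have /andP[] := gB t.
have mgc : measurable_fun setT (g \o @cons_pair _ T n).
  by apply: measurableT_comp => //; exact: measurable_cons_pair.
have mgct t : measurable_fun setT (fun u => g (cons_pair (t, u))).
  by apply: (measurableT_comp mgc); exact: measurable_pair1.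
pose G t : R := fine (\int[iid_law mu n]_u (g (cons_pair (t, u)))%:E)%E.
have Gfin t : (\int[iid_law mu n]_u (g (cons_pair (t, u)))%:E = (G t)%:E)%E.
  rewrite fineK// ge0_fin_numE ?integral_ge0//.
  apply: le_lt_trans (ltry B); apply: integral_le_cst => //.
    exact/measurable_EFinP.
  by move=> u; rewrite lee_fin; have /andP[] := gB (cons_pair (t, u)).
have GB t : 0 <= G t <= B.
  rewrite -2!lee_fin -Gfin integral_ge0//=; apply: integral_le_cst => //.
    exact/measurable_EFinP.
  by move=> u; rewrite lee_fin; have /andP[] := gB (cons_pair (t, u)).
have mG : measurable_fun [set: T] G.
  apply/measurable_EFinP.
  have h : measurable_fun [set: T] (fun t => \int[iid_law mu n]_u (g (cons_pair (t, u)))%:E)%E.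
    apply: (measurable_fun_fubini_tonelli_F (EFin \o (g \o @cons_pair _ T n))) => //=.
    exact/measurable_EFinP.
  by apply: eq_measurable_fun h => t _; rewrite Gfin.
have yE : (\int[iid_law mu n.+1]_t' (g t')%:E = \int[mu]_t (G t)%:E)%E.
  rewrite (ge0_integral_iid_lawS mu mgE)//.
  by apply: eq_integral => t _; exact: Gfin.
rewrite yE; set y := fine _.
have mexp : measurable_fun [set: n.+1.-tuple T] (fun t => (expR (s * (g t - y)))%:E).
  apply/measurable_EFinP; apply: (measurableT_comp (@measurable_expR R)).
  by apply: measurable_funM => //; exact: measurable_funB.
rewrite (ge0_integral_iid_lawS mu mexp); last by move=> ?; rewrite lee_fin expR_ge0.
pose k := 4 * n%:R * s ^+ 2 * c ^+ 2.
have mexpG : measurable_fun [set: T] (fun t => (expR (s * (G t - y)))%:E).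
  apply/measurable_EFinP; apply: (measurableT_comp (@measurable_expR R)).
  by apply: measurable_funM => //; exact: measurable_funB.
apply: (@le_trans _ _ (\int[mu]_t ((expR k)%:E * (expR (s * (G t - y)))%:E))%E).
  apply: ge0_le_integral => //.
  - by move=> t _; apply: integral_ge0 => u _; rewrite lee_fin expR_ge0.
  - apply: (measurable_fun_fubini_tonelli_F (fun z => (expR (s * (g (cons_pair z) - y)))%:E)) => //=.
    apply: (measurableT_comp mexp); exact: measurable_cons_pair.
  - by apply: emeasurable_funM => //; exact: measurable_cst.
  - move=> t _.
    have meg : measurable_fun [set: n.-tuple T]
        (fun u => (expR (s * (g (cons_pair (t, u)) - G t)))%:E).
      apply/measurable_EFinP; apply: (measurableT_comp (@measurable_expR R)).
      by apply: measurable_funM => //; exact: measurable_funB.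
    have -> : (\int[iid_law mu n]_u (expR (s * (g (cons_pair (t, u)) - y)))%:E =
        (\int[iid_law mu n]_u (expR (s * (g (cons_pair (t, u)) - G t)))%:E) *
        (expR (s * (G t - y)))%:E)%E.
      rewrite -(ge0_integralZr _ measurableT meg)//.
      by apply: eq_integral => u _; rewrite -EFinM -expRD; congr (expR _)%:E; ring.
    rewrite lee_wpmul2r ?lee_fin ?expR_ge0//.
    apply: (IH (fun u => g (cons_pair (t, u)))) => // u u' i ui.
    apply: (gc _ _ (lift ord0 i)) => j ji.
    case: (unliftP ord0 j) ji => [j'|] -> // ji.
    by rewrite /cons_pair/= !tnthS; apply: ui; apply: contra ji => /eqP ->.
rewrite ge0_integralZl//.
have h := @hoeffding_exp _ _ _ mu G B c s mG GB.
apply: (@le_trans _ _ ((expR k)%:E * (expR (4 * s ^+ 2 * c ^+ 2))%:E)%E).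
  rewrite lee_wpmul2l ?lee_fin ?expR_ge0//; apply: h => t t'.
  have lec (a b : T) : G a <= G b + c.
    rewrite -lee_fin EFinD -!Gfin.
    have -> : (c%:E = \int[iid_law mu n]_u (cst c%:E) u)%E.
      by rewrite integral_cst//= probability_setT mule1.
    have c0 : 0 <= c.
      by have := gc point point ord0 (fun _ _ => erefl); rewrite subrr normr0.
    rewrite -ge0_integralD//; last exact/measurable_EFinP.
    apply: ge0_le_integral => //.
    - exact/measurable_EFinP.
    - by apply: emeasurable_funD => //; exact/measurable_EFinP.
    - move=> u _; rewrite -EFinD lee_fin -lerBlDl.
      have : `|g (cons_pair (a, u)) - g (cons_pair (b, u))| <= c.
        apply: (gc _ _ ord0) => j j0.
        by case: (unliftP ord0 j) j0 => [j'|] -> // _; rewrite /cons_pair/= !tnthS.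
      by rewrite ler_norml => /andP[].
  have := lec t t'; have := lec t' t; rewrite ler_norml; lra.
rewrite -EFinM -expRD lee_fin ler_expR /k -[n.+1]addn1 natrD; lra.
Qed.

(** The exponential Markov inequality with the optimal parameter. *)
Lemma mcdiarmid_upper n (g : n.-tuple T -> R) (B c a : R) :
  measurable_fun [set: n.-tuple T] g -> (forall t, 0 <= g t <= B) ->
  bounded_difference c g -> (0 < n)%N -> 0 < c -> 0 < a ->
  (iid_law mu n [set t | (a <= g t - fine (\int[iid_law mu n]_t' (g t')%:E))%R]
   <= (expR (- (a ^+ 2 / (16 * n%:R * c ^+ 2))))%:E)%E.
Proof.
move=> mg gB gc n0 c0 a0.
set y := fine _.
have mX : measurable_fun [set: n.-tuple T] (fun t => g t - y) by exact: measurable_funB.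
pose X : {mfun n.-tuple T >-> R} := HB.pack (fun t => g t - y) (isMeasurableFun.Build _ _ _ _ _ mX).
have nR : (0 : R) < n%:R by rewrite ltr0n.
(* The minimizer of 4 n s^2 c^2 - s a. *)
pose s := a / (8 * n%:R * c ^+ 2).
have s0 : 0 < s by rewrite divr_gt0// !mulr_gt0// exprn_gt0.
have := @chernoff _ _ _ (iid_law mu n) X s a s0.
move/le_trans; apply.
rewrite /mmt_gen_fun expectation_def.
apply: (@le_trans _ _ ((expR (4 * n%:R * s ^+ 2 * c ^+ 2))%:E * (expR (- (s * a)))%:E)%E).
  rewrite lee_wpmul2r ?lee_fin ?expR_ge0//.
  have := @mcdiarmid_exp n g B c s mg gB gc.
  apply: le_trans; rewrite le_eqVlt; apply/orP; left; apply/eqP; apply: eq_integral => t _ /=.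
  by rewrite mulrC.
rewrite -EFinM -expRD lee_fin ler_expR /s le_eqVlt; apply/orP; left; apply/eqP.
by field; rewrite !gt_eqF.
Qed.

(** The lower tail of [g] is the upper tail of [B - g]. *)
Lemma mcdiarmid n (g : n.-tuple T -> R) (B c a : R) :
  measurable_fun [set: n.-tuple T] g -> (forall t, 0 <= g t <= B) ->
  bounded_difference c g -> (0 < n)%N -> 0 < c -> 0 < a ->
  (iid_law mu n [set t | (a <= `|g t - fine (\int[iid_law mu n]_t' (g t')%:E)|)%R]
   <= (2 * expR (- (a ^+ 2 / (16 * n%:R * c ^+ 2))))%:E)%E.
Proof.
move=> mg gB gc n0 c0 a0.
have h1 := mcdiarmid_upper mg gB gc n0 c0 a0.
pose g' t := B - g t.
have mg' : measurable_fun [set: n.-tuple T] g' by exact: measurable_funB.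
have gB' t : 0 <= g' t <= B by have := gB t; rewrite /g'; lra.
have gc' : bounded_difference c g'.
  by move=> u u' i ui; rewrite /g' opprB addrC addrA subrK distrC; exact: gc ui.
have h2 := mcdiarmid_upper mg' gB' gc' n0 c0 a0.
move: h1 h2.
have ig : (iid_law mu n).-integrable setT (fun t => (g t)%:E).
  apply: (@le_integrable _ _ _ _ _ measurableT _ (cst B%:E)).
  - exact/measurable_EFinP.
  - move=> t _; rewrite /= lee_fin; have /andP[gt0 gtB] := gB t.
    by rewrite !ger0_norm// (le_trans gt0).
  - exact: finite_measure_integrable_cst.
have -> : fine (\int[iid_law mu n]_t' (g' t')%:E)%E = B - fine (\int[iid_law mu n]_t' (g t')%:E)%E.
  rewrite (_ : (fun t => _) = (fun t => B%:E - (g t)%:E)%E)//.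
  rewrite integralB//; last exact: finite_measure_integrable_cst.
  rewrite integral_cst//= probability_setT mule1 fineB//.
  exact: integrable_fin_num.
set y := fine _ => h1 h2.
have mS (h : n.-tuple T -> R) : measurable_fun [set: n.-tuple T] h ->
    measurable [set t | (a <= h t)%R].
  move=> mh; rewrite -[X in measurable X]setTI.
  have := mh measurableT _ (measurable_itv `[a, +oo[).
  congr (measurable _); apply/seteqP; split => t/=; rewrite in_itv/= andbT//.
have m1 : measurable [set t | (a <= g t - y)%R] by apply: mS; exact: measurable_funB.
have m2 : measurable [set t | (a <= g' t - (B - y))%R] by apply: mS; exact: measurable_funB.
have mn : measurable [set t | (a <= `|g t - y|)%R].
  apply: mS; apply: (measurableT_comp (@normr_measurable R setT)).
  exact: measurable_funB.
apply: (@le_trans _ _ (iid_law mu n ([set t | (a <= g t - y)%R] `|` [set t | (a <= g' t - (B - y))%R]))).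
  apply: le_measure; rewrite ?inE//; first exact: measurableU.
  move=> t/=; rewrite ler_normr => /orP[|h]; [by left|right].
  by rewrite /g'; lra.
apply: (le_trans (measureU2 _ m1 m2)).
by rewrite mulr_natl mulr2n EFinD leeD.
Qed.

End mcdiarmid.

(** * Signs of differences within a sample *)

Section triple.
Context {R : realType} d (T : measurableType d) (mu : probability T R).
Local Notation law n := (iid_law mu n).

Lemma iid_law1 (A : set T) : measurable A ->
  law 1 [set s | A (thead s)] = mu A.
Proof.
move=> mA; have -> : [set s : 1.-tuple T | A (thead s)] = rectangle (fun=> A).
  apply/seteqP; split => s /= h; last exact: (h ord0).
  by move=> l; rewrite (ord1 l); exact: h.
by rewrite iid_law_rectangle// big_ord1.
Qed.

(** A function of a sample that is a function of the first observation plus a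
function of the others is a sum of two independent variables. *)
Lemma iid_law_sum n (f : T -> R) (g : n.-tuple T -> R) (h : n.+1.-tuple T -> R)
    (s1 s2 : R) : 0 < s1 -> 0 < s2 ->
  measurable_fun [set: T] f -> measurable_fun [set: n.-tuple T] g ->
  (forall A, measurable A -> mu (f @^-1` A) = normal_prob 0 s1 A) ->
  (forall A, measurable A -> law n (g @^-1` A) = normal_prob 0 s2 A) ->
  (forall t s, h (cons_pair (t, s)) = f t + g s) ->
  forall A, measurable A ->
    law n.+1 (h @^-1` A) = normal_prob 0 (Num.sqrt (s1 ^+ 2 + s2 ^+ 2)) A.
Proof.
move=> s10 s20 mf mg lf lg hE A mA.
rewrite -(normal_prob_sum s10 s20 mf mg lf lg mA).
have -> : [set z | A (f z.1 + g z.2)] = @cons_pair _ T n @^-1` (h @^-1` A) => //.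
by apply/seteqP; split => -[t s]; rewrite /= hE.
Qed.

Lemma tnth_cons_pair0 n (t : T) (s : n.-tuple T) : tnth (cons_pair (t, s)) ord0 = t.
Proof. by []. Qed.

Lemma tnth_cons_pairS n (t : T) (s : n.-tuple T) i :
  tnth (cons_pair (t, s)) (lift ord0 i) = tnth s i.
Proof. exact: tnthS. Qed.

Variables (u v : T -> R) (sigma : R).
Hypotheses (mu_u : measurable_fun [set: T] u) (mu_v : measurable_fun [set: T] v).
Hypothesis sigma1 : `|sigma| < 1.
Hypothesis law_uv : forall a b : R, (a != 0) || (b != 0) ->
  forall A : set R, measurable A ->
  mu [set t | A (a * u t + b * v t)] =
  normal_prob 0 (Num.sqrt (a ^+ 2 + 2 * a * b * sigma + b ^+ 2)) A.

Lemma quadform_gt0 (a b s : R) : (a != 0) || (b != 0) -> `|s| < 1 ->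
  0 < a ^+ 2 + 2 * a * b * s + b ^+ 2.
Proof.
have [->|b0] := eqVneq b 0.
  by rewrite orbF => a0 _; rewrite mulr0 mul0r !expr0n/= !addr0 exprn_even_gt0.
move=> _ s1; have -> : a ^+ 2 + 2 * a * b * s + b ^+ 2 =
    b ^+ 2 * (1 + 2 * (a / b) * s + (a / b) ^+ 2) by field.
by rewrite mulr_gt0 ?quad_gt0// exprn_even_gt0.
Qed.

Local Notation i30 := (@ord0 2).
Local Notation i31 := (lift ord0 (@ord0 1)).
Local Notation i32 := (lift ord0 (lift ord0 (@ord0 0))).

(** The combination is [(a u_0 + b v_0) - a u_1 - b v_2], a sum of three independent
normal variables with total variance [2 (a^2 + a b sigma + b^2)]: the two
differences have correlation [sigma / 2] because they share one observation. *)
Lemma law_differences (a b : R) : a != 0 -> b != 0 -> forall A : set R, measurable A ->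
  law 3 [set s | A (a * (u (tnth s i30) - u (tnth s i31)) + b * (v (tnth s i30) - v (tnth s i32)))] =
  normal_prob 0 (Num.sqrt 2 * Num.sqrt (a ^+ 2 + 2 * a * b * (sigma / 2) + b ^+ 2)) A.
Proof.
move=> a0 b0 A mA.
have mab (a' b' : R) : measurable_fun [set: T] (fun t => a' * u t + b' * v t).
  by apply: measurable_funD; apply: measurable_funM => //; exact: measurable_cst.
have na0 : (- a != 0) || ((0 : R) != 0) by rewrite oppr_eq0 a0.
have nb0 : ((0 : R) != 0) || (- b != 0) by rewrite oppr_eq0 b0 orbT.
pose g1 (s : 1.-tuple T) := 0 * u (thead s) + - b * v (thead s).
have mth n : measurable_fun [set: n.+1.-tuple T] (fun s : n.+1.-tuple T => thead s).
  exact: measurable_tnth.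
have mg1 : measurable_fun [set: 1.-tuple T] g1.
  exact: (measurableT_comp (mab 0 (- b)) (mth 0)).
have lg1 B : measurable B -> law 1 (g1 @^-1` B) = normal_prob 0 `|b| B.
  move=> mB; have := law_uv nb0 mB.
  rewrite mulr0 !mul0r expr0n/= !add0r sqrrN sqrtr_sqr => <-.
  rewrite -iid_law1//.
  rewrite -[X in measurable X]setTI; exact: mab.
pose g2 (s : 2.-tuple T) := - a * u (tnth s ord0) + - b * v (tnth s (lift ord0 ord0)).
have mg2 : measurable_fun [set: 2.-tuple T] g2.
  apply: measurable_funD; apply: measurable_funM => //.
  - exact: (measurableT_comp mu_u (measurable_tnth _)).
  - exact: (measurableT_comp mu_v (measurable_tnth _)).
have lf2 B : measurable B -> mu ((fun t => - a * u t + 0 * v t) @^-1` B) = normal_prob 0 `|a| B.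
  move=> mB; have := law_uv na0 mB.
  by rewrite mulr0 mul0r expr0n/= !addr0 sqrrN sqrtr_sqr => <-.
have lg2 B : measurable B -> law 2 (g2 @^-1` B) = normal_prob 0 (Num.sqrt (`|a| ^+ 2 + `|b| ^+ 2)) B.
  apply: (iid_law_sum _ _ (mab _ _) mg1 lf2 lg1); rewrite ?normr_gt0// => t s.
  rewrite /g2 /g1 tnth_cons_pair0.
  by rewrite tnth_cons_pairS /thead; ring.
pose f3 t := a * u t + b * v t.
have ab0 : (a != 0) || (b != 0) by rewrite a0.
have q0 : 0 < a ^+ 2 + 2 * a * b * sigma + b ^+ 2 by exact: quadform_gt0.
have s10 : 0 < Num.sqrt (a ^+ 2 + 2 * a * b * sigma + b ^+ 2) by rewrite sqrtr_gt0.
have s20 : 0 < Num.sqrt (`|a| ^+ 2 + `|b| ^+ 2).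
  by rewrite sqrtr_gt0 addr_gt0// exprn_gt0// normr_gt0.
have := iid_law_sum (h := fun s : 3.-tuple T => a * (u (tnth s i30) - u (tnth s i31)) + b * (v (tnth s i30) - v (tnth s i32))) s10 s20 (mab a b) mg2 (law_uv ab0) lg2 _ mA.
move=> ->; last first.
  move=> t s; rewrite /g2 tnth_cons_pair0.
  by rewrite !tnth_cons_pairS; ring.
congr (normal_prob 0 _ A).
rewrite -sqrtrM// !sqr_sqrtr ?(ltW q0)//.
congr Num.sqrt; rewrite !real_normK ?num_real//; by field.
Qed.

(** The angle is [asin (sigma / 2)]; stating it through [2 * sin phi = sigma] is the
form in which the sine transform of Spearman's correlation inverts it. *)
Lemma sign_correlation :
  exists2 phi : R, (\int[law 3]_s (Num.sg ((u (tnth s i30) - u (tnth s i31)) * (v (tnth s i30) - v (tnth s i32))))%:E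
    = (2 / pi * phi)%:E)%E & 2 * sin phi = sigma.
Proof.
have h1 : -1 <= sigma / 2 <= 1.
  by have := ltW sigma1; rewrite ler_norml; lra.
have h2 : sigma / 2 \in `[(-1), 1] by rewrite in_itv.
exists (asin (sigma / 2)); last by rewrite asinK// mulrC divfK.
have m1 (w : T -> R) i : measurable_fun [set: T] w ->
    measurable_fun [set: 3.-tuple T] (fun s : 3.-tuple T => w (tnth s i)).
  by move=> mw; exact: (measurableT_comp mw (measurable_tnth _)).
apply: (@gaussian_sign_correlation R _ _ (law 3)
  (fun s => u (tnth s i30) - u (tnth s i31)) (fun s => v (tnth s i30) - v (tnth s i32))
  (Num.sqrt 2)).
- by apply: measurable_funB; exact: m1.
- by apply: measurable_funB; exact: m1.
- by rewrite sqrtr_gt0.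
- by apply: asin_gtNpi2; have := sigma1; rewrite ltr_norml; lra.
- by apply: asin_ltpi2; have := sigma1; rewrite ltr_norml; lra.
- by move=> a b a0 b0 A mA; rewrite asinK//; exact: law_differences.
Qed.

(** The difference of two independent observations is normal, hence has no atoms. *)
Lemma no_tie : law 2 [set s | u (tnth s ord0) = u (tnth s (lift ord0 ord0))] = 0%E.
Proof.
have mab (a' b' : R) : measurable_fun [set: T] (fun t => a' * u t + b' * v t).
  by apply: measurable_funD; apply: measurable_funM => //; exact: measurable_cst.
have n1 : ((1 : R) != 0) || ((0 : R) != 0) by rewrite oner_eq0.
have n2 : (- (1 : R) != 0) || ((0 : R) != 0) by rewrite oppr_eq0 oner_eq0.
have l1 := law_uv n1; have l2 := law_uv n2.
pose g1 (s : 1.-tuple T) := -1 * u (thead s) + 0 * v (thead s).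
have mg1 : measurable_fun [set: 1.-tuple T] g1.
  apply: (measurableT_comp (mab (-1) 0)); exact: measurable_tnth.
have s0 : 0 < Num.sqrt (1 ^+ 2 + 2 * 1 * 0 * sigma + 0 ^+ 2) :> R.
  by rewrite sqrtr_gt0 mulr0 mul0r expr0n/= !addr0 expr1n.
have s0' : 0 < Num.sqrt ((-1) ^+ 2 + 2 * (-1) * 0 * sigma + 0 ^+ 2) :> R.
  by rewrite sqrtr_gt0 mulr0 mul0r expr0n/= !addr0 sqrrN expr1n.
have lg1 B : measurable B -> law 1 (g1 @^-1` B) = normal_prob 0 (Num.sqrt ((-1) ^+ 2 + 2 * (-1) * 0 * sigma + 0 ^+ 2)) B.
  move=> mB; rewrite -(l2 B mB) -iid_law1//.
  rewrite -[X in measurable X]setTI; exact: mab.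
have := iid_law_sum (h := fun s : 2.-tuple T => u (tnth s ord0) - u (tnth s (lift ord0 ord0)))
  s0 s0' (mab 1 0) mg1 l1 lg1 _ (measurable_set1 0).
rewrite normal_prob_set1 => <-.
  have -> // : [set s : 2.-tuple T | u (tnth s ord0) = u (tnth s (lift ord0 ord0))] =
     (fun s : 2.-tuple T => u (tnth s ord0) - u (tnth s (lift ord0 ord0))) @^-1` [set 0].
  apply/seteqP; split => s /=; first by move=> ->; rewrite subrr.
  by move/eqP; rewrite subr_eq0 => /eqP.
move=> t s; rewrite /g1 tnth_cons_pair0.
by rewrite tnth_cons_pairS /thead; ring.
Qed.

End triple.

(** * Subsamples *)

Section sample.
Context {R : realType} d (T : measurableType d) d' (Omega : measurableType d').
Variables (P : probability Omega R) (n : nat) (X : {mfun Omega >-> T}).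
Variable x : 'I_n -> {mfun Omega >-> T}.
Hypothesis x_law : forall l A, measurable A -> P (x l @^-1` A) = P (X @^-1` A).
Hypothesis x_indep : forall A : 'I_n -> set T, (forall l, measurable (A l)) ->
  P [set w | forall l, A l (x l w)] = (\prod_(l < n) P (x l @^-1` A l))%E.

Definition subsample m (iota : 'I_m -> 'I_n) (w : Omega) : m.-tuple T :=
  [tuple x (iota l) w | l < m].

Lemma measurable_subsample m (iota : 'I_m -> 'I_n) :
  measurable_fun [set: Omega] (subsample iota).
Proof.
apply/measurable_fun_tnthP => i.
rewrite (_ : _ \o _ = x (iota i)); first exact: measurable_funP.
by apply/funext => w /=; rewrite tnth_mktuple.
Qed.

(** It suffices to compare rectangles, where the coordinates outside the subsample
are constrained by the whole space only. *)
Lemma subsample_law m (iota : 'I_m -> 'I_n) : injective iota ->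
  forall A, measurable A ->
  P (subsample iota @^-1` A) = iid_law (distribution P X) m A.
Proof.
move=> iota_inj A mA.
pose Z : {mfun Omega >-> m.-tuple T} :=
  HB.pack (subsample iota) (isMeasurableFun.Build _ _ _ _ _ (measurable_subsample iota)).
apply: (@iid_law_unique _ _ _ (distribution P X) m (distribution P Z)) => // {}A {}mA.
pose A' (j : 'I_n) : set T := if [pick l | iota l == j] is Some l then A l else setT.
have A'E l : A' (iota l) = A l.
  by rewrite /A'; case: pickP => [l' /eqP/iota_inj -> //|/(_ l)]; rewrite eqxx.
have mA' j : measurable (A' j) by rewrite /A'; case: pickP.
transitivity (P [set w | forall j, A' j (x j w)]).
  rewrite /distribution /pushforward; congr (P _); apply/seteqP; split => w /= h.
    move=> j; rewrite /A'; case: pickP => // l /eqP <-.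
    by have := h l; rewrite tnth_mktuple.
  by move=> l; rewrite tnth_mktuple -A'E.
rewrite x_indep// (bigID (mem [set iota l | l : 'I_m]%SET))/= [X in (_ * X)%E]big1 ?mule1.
  rewrite big_imset/=; last by move=> ? ? _ _; exact: iota_inj.
  apply: eq_big => l; first by rewrite inE.
  by move=> _; rewrite A'E x_law.
move=> j jN; rewrite /A'; case: pickP => [l /eqP lj|_].
  by move: jN; rewrite -lj imset_f.
by rewrite preimage_setT probability_setT.
Qed.

End sample.

(** * Spearman's correlation as a sum over triples *)

Lemma card_classical (I : finType) (b : pred I) :
  #|[set m : I | b m]| = #|b|.
Proof.
by apply: eq_card => m; apply/idP/idP; rewrite inE.
Qed.

Section rank.
Context {R : realType} (n : nat).
Implicit Types u v : 'I_n -> R.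

Definition rk u (l : 'I_n) : nat := #|[pred m | u m <= u l]|.

Definition centered_rank u (l : 'I_n) : R := \sum_m Num.sg (u l - u m).

(** Another observation counts 1 if it is smaller and 0 if it is larger, that is
[(1 + sg) / 2]; the observation itself counts 1 instead of 1/2. *)
Lemma rk_sg u l : injective u -> (rk u l)%:R = (n%:R + 1) / 2 + centered_rank u l / 2 :> R.
Proof.
move=> u_inj; rewrite /rk -sum1_card natr_sum.
have -> : \sum_(m in [pred m | u m <= u l]) (1%N)%:R =
   \sum_m ((1 + Num.sg (u l - u m)) / 2 + (m == l)%:R / 2) :> R.
  rewrite big_mkcond/=; apply: eq_bigr => m _; rewrite inE.
  have [->|ml] := eqVneq m l; first by rewrite lexx subrr sgr0 addr0 -splitr.
  have : u m != u l by rewrite (inj_eq u_inj).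
  case: (ltgtP (u m) (u l)) => // h _.
    by rewrite gtr0_sg ?subr_gt0//=; field.
  by rewrite ltr0_sg ?subr_lt0//=; field.
have e : \sum_m (m == l)%:R = 1 :> R.
  rewrite (bigD1 l)// eqxx big1/=; first by rewrite addr0.
  by move=> m /negbTE ->.
rewrite big_split/= -!mulr_suml big_split/= sumr_const card_ord.
by rewrite e /centered_rank; field.
Qed.

Lemma sum_centered_rank u : \sum_l centered_rank u l = 0.
Proof.
suff : \sum_l centered_rank u l = - \sum_l centered_rank u l by lra.
rewrite /centered_rank -sumrN [in LHS]exchange_big/=; apply: eq_bigr => l _.
by rewrite -sumrN; apply: eq_bigr => m _; rewrite -opprB sgrN.
Qed.

Lemma mean_rk u : injective u -> (0 < n)%N -> (\sum_l (rk u l)%:R) / n%:R = (n%:R + 1) / 2 :> R.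
Proof.
move=> u_inj n0; under eq_bigr do rewrite (rk_sg _ u_inj).
rewrite big_split/= -[X in (_ + X)]mulr_suml sum_centered_rank mul0r addr0 sumr_const card_ord -mulr_natr.
by field; rewrite pnatr_eq0 -lt0n.
Qed.

Lemma sum_sqr_shift : \sum_(k < n) (k.+1%:R - (n%:R + 1) / 2) ^+ 2 =
  n%:R * (n%:R ^+ 2 - 1) / 12 :> R.
Proof.
have h m (c : R) : \sum_(k < m) (k.+1%:R - c) ^+ 2 =
   m%:R * (m%:R + 1) * (2 * m%:R + 1) / 6 - c * m%:R * (m%:R + 1) + m%:R * c ^+ 2.
  elim: m => [|m IH]; first by rewrite big_ord0; ring.
  by rewrite big_ord_recr /= IH -[m.+1]addn1 natrD; field.
by rewrite h; field.
Qed.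

(** Without ties, the ranks are a permutation of [1, ..., n]. *)
Lemma sum_sqr_rk u : injective u ->
  \sum_l ((rk u l)%:R - (n%:R + 1) / 2) ^+ 2 = n%:R * (n%:R ^+ 2 - 1) / 12 :> R.
Proof.
move=> u_inj; rewrite -sum_sqr_shift.
have rk_gt0 l : (0 < rk u l)%N.
  by apply/card_gt0P; exists l; rewrite inE.
have rk_lt l : ((rk u l).-1 < n)%N.
  by rewrite prednK// -[X in (_ <= X)%N]card_ord max_card.
pose f l : 'I_n := Ordinal (rk_lt l).
have f_inj : injective f.
  move=> l m /(congr1 val)/= e.
  have {}e : rk u l = rk u m by rewrite -(prednK (rk_gt0 l)) e prednK.
  have lem a b : u a < u b -> (rk u a < rk u b)%N.
    move=> ab; apply: proper_card; apply/properP; split.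
      by apply/fintype.subsetP => c; rewrite !inE => /le_trans; apply; exact: ltW.
    by exists b; rewrite !inE// -ltNge.
  apply: u_inj; case: (ltgtP (u l) (u m)) => // /lem; rewrite e ltnn//.
rewrite [RHS](reindex_inj f_inj)/=.
by apply: eq_bigr => l _; rewrite /= prednK.
Qed.

Definition triple_sum u v : R :=
  \sum_l \sum_a \sum_b Num.sg (u l - u a) * Num.sg (v l - v b).

Lemma triple_sumE u v : triple_sum u v = \sum_l centered_rank u l * centered_rank v l.
Proof.
apply: eq_bigr => l _; rewrite /centered_rank mulr_suml; apply: eq_bigr => a _.
by rewrite mulr_sumr.
Qed.

End rank.

(** The ranks minus their mean are half the centered ranks, and their sums of squares
do not depend on the data.  For [n = 1] both sides are a division by zero. *)
Lemma spearmanE (R : realType) n p (D : 'M[R]_(n, p)) (i j : 'I_p) :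
  (0 < n)%N -> injective (fun l => D l i) -> injective (fun l => D l j) ->
  spearman D i j = 3 * triple_sum (fun l => D l i) (fun l => D l j)
     / (n%:R * (n%:R ^+ 2 - 1)).
Proof.
move=> n0 inji injj.
have rE k l : (col k (rank_mx D)) l 0 = (rk (fun l => D l k) l)%:R.
  by rewrite !mxE card_classical.
have mE k : injective (fun l => D l k) -> mean (col k (rank_mx D)) = (n%:R + 1) / 2.
  move=> injk; rewrite /mean -(mean_rk injk n0).
  by under eq_bigr do rewrite rE.
have vE k : injective (fun l => D l k) ->
    \sum_l ((col k (rank_mx D)) l 0 - mean (col k (rank_mx D))) ^+ 2 =
    n%:R * (n%:R ^+ 2 - 1) / 12.
  by move=> injk; under eq_bigr do rewrite rE mE//; exact: sum_sqr_rk.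
rewrite /spearman /pearson !vE// -expr2 sqr_sqrtr; last first.
  rewrite divr_ge0// mulr_ge0// subr_ge0 exprn_ege1// ler1n//.
under eq_bigr do rewrite !rE !mE// !rk_sg//.
rewrite triple_sumE.
have -> : \sum_(l < n) ((n%:R + 1) / 2 + centered_rank (D^~ i) l / 2 - (n%:R + 1) / 2) *
    ((n%:R + 1) / 2 + centered_rank (D^~ j) l / 2 - (n%:R + 1) / 2) =
    (\sum_(l < n) centered_rank (D^~ i) l * centered_rank (D^~ j) l) / 4.
  by rewrite mulr_suml; apply: eq_bigr => l _; field.
have [e|e] := eqVneq (n%:R ^+ 2 - 1 : R) 0.
  by rewrite e mulr0 mul0r !invr0 !mulr0.
by field; rewrite e pnatr_eq0 -lt0n n0.
Qed.

Section triple_sum_props.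
Context {R : realType} (n : nat).
Implicit Types u v : 'I_n -> R.
Local Notation I3 := ('I_n * 'I_n * 'I_n)%type.

Definition triple_sign u v (p : I3) : R :=
  Num.sg (u p.1.1 - u p.1.2) * Num.sg (v p.1.1 - v p.2).

Lemma triple_sum_pair u v : triple_sum u v = \sum_(p : I3) triple_sign u v p.
Proof. by rewrite /triple_sum pair_bigA pair_bigA. Qed.

(** A bound for the number of exceptional triples, counted by three families of
indicators: each family, summed over one of its indices, is at most 1, which
leaves [n^2] values of the other two. *)
Lemma sum_triple_diag (e1 e2 e3 : 'I_n -> 'I_n -> 'I_n -> R) :
  (forall a b, \sum_l e1 l a b <= 1) -> (forall l b, \sum_a e2 l a b <= 1) ->
  (forall l a, \sum_b e3 l a b <= 1) ->
  \sum_(p : I3) (e1 p.1.1 p.1.2 p.2 + e2 p.1.1 p.1.2 p.2 + e3 p.1.1 p.1.2 p.2)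
  <= 3 * n%:R ^+ 2.
Proof.
move=> h1 h2 h3.
have sum2 (f : 'I_n -> 'I_n -> R) : (forall a b, f a b <= 1) -> \sum_a \sum_b f a b <= n%:R ^+ 2.
  move=> f1; apply: (@le_trans _ _ (\sum_(a < n) \sum_(b < n) 1)).
    by apply: ler_sum => a _; apply: ler_sum => b _; exact: f1.
  by rewrite !sumr_const !card_ord -[leLHS]mulr_natr expr2.
rewrite !big_split/=.
have -> : \sum_(p : I3) e1 p.1.1 p.1.2 p.2 = \sum_a \sum_b \sum_l e1 l a b.
  rewrite -(pair_bigA _ (fun (q : 'I_n * 'I_n) b => e1 q.1 q.2 b))/=.
  rewrite -(pair_bigA _ (fun l a => \sum_b e1 l a b))/=.
  by rewrite exchange_big/=; apply: eq_bigr => a _; rewrite exchange_big.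
have -> : \sum_(p : I3) e2 p.1.1 p.1.2 p.2 = \sum_l \sum_b \sum_a e2 l a b.
  rewrite -(pair_bigA _ (fun (q : 'I_n * 'I_n) b => e2 q.1 q.2 b))/=.
  rewrite -(pair_bigA _ (fun l a => \sum_b e2 l a b))/=.
  by apply: eq_bigr => a _; rewrite exchange_big.
have -> : \sum_(p : I3) e3 p.1.1 p.1.2 p.2 = \sum_l \sum_a \sum_b e3 l a b.
  rewrite -(pair_bigA _ (fun (q : 'I_n * 'I_n) b => e3 q.1 q.2 b))/=.
  by rewrite -(pair_bigA _ (fun l a => \sum_b e3 l a b)).
have := sum2 _ h1; have := sum2 _ h2; have := sum2 _ h3; lra.
Qed.

Lemma sum_eq_le1 (i : 'I_n) : \sum_l (l == i)%:R <= 1 :> R.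
Proof.
rewrite (bigD1 i)//= eqxx big1 ?addr0// => m /negbTE -> //.
Qed.

Lemma normr_triple_sign u v p : `|triple_sign u v p| <= 1.
Proof. by rewrite normrM !normr_sg -natrM lern1 mulnb leq_b1. Qed.

Lemma normr_triple_sum u v : `|triple_sum u v| <= n%:R ^+ 3.
Proof.
rewrite triple_sum_pair (le_trans (ler_norm_sum _ _ _))//.
apply: (@le_trans _ _ (\sum_(p : I3) 1)).
  by apply: ler_sum => p _; exact: normr_triple_sign.
by rewrite sumr_const !card_prod !card_ord !natrM !exprS expr0 mulr1 mulrA.
Qed.

(** Only triples containing the changed index [i] contribute; there are at most
[3 n^2] of them, and each changes by at most 2. *)
Lemma triple_sum_difference u v u' v' (i : 'I_n) :
  (forall l, l != i -> u l = u' l) -> (forall l, l != i -> v l = v' l) ->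
  `|triple_sum u v - triple_sum u' v'| <= 6 * n%:R ^+ 2.
Proof.
move=> uu vv; rewrite !triple_sum_pair -sumrB (le_trans (ler_norm_sum _ _ _))//.
apply: (@le_trans _ _ (2 * \sum_(p : I3) ((p.1.1 == i)%:R + (p.1.2 == i)%:R + (p.2 == i)%:R))).
  rewrite mulr_sumr; apply: ler_sum => p _.
  have [/and3P[e1 e2 e3]|] := boolP [&& p.1.1 != i, p.1.2 != i & p.2 != i].
    by rewrite /triple_sign !uu// !vv// subrr normr0 mulr_ge0// !addr_ge0.
  rewrite !negb_and !negbK => h.
  have hs : 1 <= (p.1.1 == i)%:R + (p.1.2 == i)%:R + (p.2 == i)%:R :> R.
    by rewrite -!natrD ler1n; case/or3P: h => ->; rewrite ?addnS ?addSn.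
  apply: (le_trans (ler_normB _ _)).
  have := normr_triple_sign u v p; have := normr_triple_sign u' v' p; lra.
have := @sum_triple_diag (fun l _ _ => (l == i)%:R) (fun _ a _ => (a == i)%:R)
  (fun _ _ b => (b == i)%:R) (fun _ _ => sum_eq_le1 i) (fun _ _ => sum_eq_le1 i)
  (fun _ _ => sum_eq_le1 i).
lra.
Qed.

End triple_sum_props.

(** * Concentration of the triple sum *)

Section concentration.
Context {R : realType} d (T : measurableType d) d' (Omega : measurableType d').
Variables (P : probability Omega R) (n : nat) (X : {mfun Omega >-> T}).
Variable x : 'I_n -> {mfun Omega >-> T}.
Hypothesis x_law : forall l A, measurable A -> P (x l @^-1` A) = P (X @^-1` A).
Hypothesis x_indep : forall A : 'I_n -> set T, (forall l, measurable (A l)) ->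
  P [set w | forall l, A l (x l w)] = (\prod_(l < n) P (x l @^-1` A l))%E.
Variables (u v : T -> R) (q : R).
Hypotheses (mu_u : measurable_fun [set: T] u) (mu_v : measurable_fun [set: T] v).
Local Notation mu := (distribution P X).
Hypothesis q_sign : (\int[iid_law mu 3]_s (Num.sg ((u (tnth s ord0) - u (tnth s (lift ord0 ord0)))
   * (v (tnth s ord0) - v (tnth s (lift ord0 (lift ord0 ord0))))))%:E = q%:E)%E.

Lemma measurable_sign_kernel : measurable_fun [set: 3.-tuple T] (fun s : 3.-tuple T =>
  (Num.sg ((u (tnth s ord0) - u (tnth s (lift ord0 ord0)))
   * (v (tnth s ord0) - v (tnth s (lift ord0 (lift ord0 ord0))))))%:E).
Proof.
apply/measurable_EFinP; apply: measurable_sg; apply: measurable_funM;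
  apply: measurable_funB; by [exact: (measurableT_comp mu_u (measurable_tnth _))|
    exact: (measurableT_comp mu_v (measurable_tnth _))].
Qed.

Lemma sign_mean_le1 : `|q| <= 1.
Proof.
rewrite -lee_fin -abse_EFin -q_sign.
have ms := measurable_sign_kernel.
apply: (le_trans (le_abse_integral _ _ _)) => //.
apply: integral_le_cst => //; first exact: measurableT_comp.
by move=> s; rewrite lee_fin normr_sg lern1 leq_b1.
Qed.

Definition tuple_triple_sum (s : n.-tuple T) : R :=
  triple_sum (fun l => u (tnth s l)) (fun l => v (tnth s l)).

Lemma measurable_sign_diff (f : T -> R) m (l a : 'I_m) : measurable_fun [set: T] f ->
  measurable_fun [set: m.-tuple T] (fun s => Num.sg (f (tnth s l) - f (tnth s a))).
Proof.
move=> mf; apply: measurable_sg; apply: measurable_funB.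
  exact: (measurableT_comp mf (measurable_tnth _)).
exact: (measurableT_comp mf (measurable_tnth _)).
Qed.

Lemma measurable_tuple_triple_sum : measurable_fun [set: n.-tuple T] tuple_triple_sum.
Proof.
rewrite /tuple_triple_sum /triple_sum; apply: measurable_sum => l.
apply: measurable_sum => a; apply: measurable_sum => b.
by apply: measurable_funM; exact: measurable_sign_diff.
Qed.

Lemma measurable_subsample_triple_sum (c a : R) :
  measurable [set w | (a <= `|tuple_triple_sum (subsample x id w) - c|)%R].
Proof.
have mn : measurable_fun [set: Omega] (fun w => `|tuple_triple_sum (subsample x id w) - c|).
  apply: (measurableT_comp (@normr_measurable R setT)); apply: measurable_funB => //.
  apply: (measurableT_comp measurable_tuple_triple_sum); exact: measurable_subsample.
have := mn measurableT _ (measurable_itv `[a, +oo[); rewrite setTI.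
by congr (measurable _); apply/seteqP; split => t/=; rewrite in_itv/= andbT.
Qed.

Let EG := fine (\int[iid_law mu n]_s (tuple_triple_sum s)%:E)%E.

(** Differences are bounded by [6 n^2], and [16 n (6 n^2)^2 = 576 n^5]. *)
Lemma triple_sum_mcdiarmid (a : R) : (0 < n)%N -> 0 < a ->
  (P [set w | (a <= `|tuple_triple_sum (subsample x id w) - EG|)%R] <=
   (2 * expR (- (a ^+ 2 / (576 * n%:R ^+ 5))))%:E)%E.
Proof.
move=> n0 a0.
have mG := measurable_tuple_triple_sum.
(* The shift makes the function nonnegative. *)
pose g s := tuple_triple_sum s + n%:R ^+ 3.
have mg : measurable_fun [set: n.-tuple T] g by apply: measurable_funD.
have gB s : 0 <= g s <= 2 * n%:R ^+ 3.
  have := normr_triple_sum (fun l => u (tnth s l)) (fun l => v (tnth s l)).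
  by rewrite /g /tuple_triple_sum ler_norml; lra.
have gc : bounded_difference (6 * n%:R ^+ 2) g.
  move=> s s' i ss'; rewrite /g opprD addrACA subrr addr0.
  by apply: (@triple_sum_difference _ _ _ _ _ _ i) => l li; rewrite ss'.
have nR : (0 : R) < n%:R by rewrite ltr0n.
have c0 : (0 : R) < 6 * n%:R ^+ 2 by rewrite mulr_gt0// exprn_gt0.
have Eg : fine (\int[iid_law mu n]_s (g s)%:E)%E = EG + n%:R ^+ 3.
  rewrite /EG (_ : (fun s => (g s)%:E) = (fun s => (tuple_triple_sum s)%:E + (n%:R ^+ 3)%:E)%E)//.
  have iG : (iid_law mu n).-integrable setT (fun s => (tuple_triple_sum s)%:E).
    apply: (@le_integrable _ _ _ _ _ measurableT _ (cst (n%:R ^+ 3)%:E)).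
    - exact/measurable_EFinP.
    - move=> s _; rewrite /= lee_fin (ger0_norm (exprn_ge0 _ _))//.
      exact: normr_triple_sum.
    - exact: finite_measure_integrable_cst.
  rewrite integralD//; last exact: finite_measure_integrable_cst.
  rewrite integral_cst//= probability_setT mule1 fineD//.
  exact: integrable_fin_num.
have := mcdiarmid mu mg gB gc n0 c0 a0.
rewrite Eg.
have -> : [set t | (a <= `|g t - (EG + n%:R ^+ 3)|)%R] = [set t | (a <= `|tuple_triple_sum t - EG|)%R].
  by apply/seteqP; split => t /=; rewrite /g opprD addrACA subrr addr0.
have mS : measurable [set t | (a <= `|tuple_triple_sum t - EG|)%R].
  rewrite -[X in measurable X]setTI.
  have mn : measurable_fun [set: n.-tuple T] (fun t => `|tuple_triple_sum t - EG|).
    by apply: (measurableT_comp (@normr_measurable R setT)); exact: measurable_funB.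
  have := mn measurableT _ (measurable_itv `[a, +oo[).
  by congr (measurable _); apply/seteqP; split => t/=; rewrite in_itv/= andbT.
rewrite -(subsample_law x_law x_indep (iota := id) _ mS)//.
have -> // : 16 * n%:R * (6 * n%:R ^+ 2) ^+ 2 = 576 * n%:R ^+ 5 :> R by ring.
Qed.

(** A triple with distinct indices is an i.i.d. sample of size three and contributes
exactly [q]; at most [3 n^2] triples have a repeated index, and for each of them
the error is at most 2. *)
Lemma triple_sum_expectation : `|EG - n%:R ^+ 3 * q| <= 6 * n%:R ^+ 2.
Proof.
pose J (p : 'I_n * 'I_n * 'I_n) (w : Omega) : R :=
  triple_sign (fun l => u (x l w)) (fun l => v (x l w)) p.
have mux (f : T -> R) l : measurable_fun [set: T] f -> measurable_fun [set: Omega] (fun w => f (x l w)).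
  by move=> mf; apply: (measurableT_comp mf); exact: measurable_funP.
have mJ p : measurable_fun [set: Omega] (J p).
  apply: measurable_funM; apply: measurable_sg; apply: measurable_funB; exact: mux.
have iJ p : P.-integrable [set: Omega] (fun w => (J p w)%:E).
  apply: (@le_integrable _ _ _ _ _ measurableT _ (cst 1%:E)).
  - exact/measurable_EFinP.
  - by move=> w _; rewrite /= lee_fin normr1 normr_triple_sign.
  - exact: finite_measure_integrable_cst.
pose e p := fine (\int[P]_w (J p w)%:E)%E.
have eE p : (\int[P]_w (J p w)%:E = (e p)%:E)%E by rewrite fineK// integrable_fin_num.
have e1 p : `|e p| <= 1.
  rewrite -lee_fin -abse_EFin -eE.
  apply: (le_trans (le_abse_integral _ _ _)) => //; first exact/measurable_EFinP.
  apply: integral_le_cst => //.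
  - by apply: measurableT_comp => //; exact/measurable_EFinP.
  - by move=> w; rewrite lee_fin normr_triple_sign.
have EGE : EG = \sum_p e p.
  rewrite /EG.
  have mEG : measurable_fun [set: n.-tuple T] (fun s => (tuple_triple_sum s)%:E).
    by apply/measurable_EFinP; exact: measurable_tuple_triple_sum.
  rewrite -(integral_law (measurable_subsample x id)
     (subsample_law x_law x_indep (iota := id) (fun _ _ h => h)) mEG).
  have -> : (\int[P]_w (tuple_triple_sum (subsample x id w))%:E =
      \int[P]_w \sum_p (J p w)%:E)%E.
    apply: eq_integral => w _; rewrite sumEFin; congr (_%:E).
    rewrite /tuple_triple_sum triple_sum_pair; apply: eq_bigr => p _.
    by rewrite /J /triple_sign /subsample !tnth_mktuple.
  by rewrite integral_sum//; under eq_bigr do rewrite eE; rewrite sumEFin.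
have q1 := sign_mean_le1.
have eq (p : 'I_n * 'I_n * 'I_n) : p.1.1 != p.1.2 -> p.1.1 != p.2 -> p.1.2 != p.2 -> e p = q.
  move=> h1 h2 h3; apply: EFin_inj; rewrite -eE -q_sign.
  pose iota (i : 'I_3) : 'I_n := tnth [tuple p.1.1; p.1.2; p.2] i.
  have iota_inj : injective iota.
    apply/tuple_uniqP; rewrite /= !inE negb_or h1 h2 h3//.
  have ms := measurable_sign_kernel.
  rewrite -(integral_law (measurable_subsample x iota)
     (subsample_law x_law x_indep iota_inj) ms).
  apply: eq_integral => w _; rewrite /J /triple_sign sgrM /subsample !tnth_mktuple.
  by congr (_%:E).
have -> : n%:R ^+ 3 * q = \sum_(p : 'I_n * 'I_n * 'I_n) q.
  by rewrite sumr_const !card_prod !card_ord -[RHS]mulr_natl !natrM; ring.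
rewrite EGE -sumrB (le_trans (ler_norm_sum _ _ _))//.
apply: (@le_trans _ _ (2 * \sum_(p : 'I_n * 'I_n * 'I_n)
   ((p.1.1 == p.1.2)%:R + (p.1.2 == p.2)%:R + (p.2 == p.1.1)%:R))).
  rewrite mulr_sumr; apply: ler_sum => p _.
  have [/and3P[h1 h2 h3]|] := boolP [&& p.1.1 != p.1.2, p.1.2 != p.2 & p.2 != p.1.1].
    by rewrite eq// 1?eq_sym// subrr normr0 mulr_ge0// !addr_ge0.
  rewrite !negb_and !negbK => h.
  have hs : 1 <= (p.1.1 == p.1.2)%:R + (p.1.2 == p.2)%:R + (p.2 == p.1.1)%:R :> R.
    by rewrite -!natrD ler1n; case/or3P: h => ->; rewrite ?addnS ?addSn.
  apply: (le_trans (ler_normB _ _)); have := e1 p; lra.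
have := @sum_triple_diag R n (fun l a _ => (l == a)%:R) (fun _ a b => (a == b)%:R)
  (fun l _ b => (b == l)%:R) (fun a _ => sum_eq_le1 a) (fun _ b => sum_eq_le1 b)
  (fun l _ => sum_eq_le1 l).
lra.
Qed.

End concentration.

(** * Events that depend on ranks, and trigonometry *)

(** The ranks are determined by finitely many comparisons between observations, so
the event is a finite union, whatever [Q] is.  This makes events about the
existence and all possible values of minimizers measurable. *)
Lemma measurable_rank_event (R : realType) d (Omega : measurableType d) (n p : nat)
    (x : 'I_n -> {mfun Omega >-> p.-tuple R}) (Q : 'M[R]_(n, p) -> Prop) :
  measurable [set w | Q (rank_mx (data_mx x w))].
Proof.
pose c (w : Omega) : {ffun 'I_n * 'I_n * 'I_p -> bool} :=
  [ffun t => tnth (x t.1.1 w) t.2 <= tnth (x t.1.2 w) t.2].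
pose F (k : {ffun 'I_n * 'I_n * 'I_p -> bool}) : 'M[R]_(n, p) :=
  \matrix_(l < n, i < p) (#|[pred m | k (m, l, i)]|)%:R.
have FE w : rank_mx (data_mx x w) = F (c w).
  apply/matrixP => l i; rewrite !mxE card_classical; congr (_%:R).
  by apply: eq_card => m; rewrite /in_mem /= ffunE !mxE.
have -> : [set w | Q (rank_mx (data_mx x w))] =
    \bigcup_(k in [set k | Q (F k)]) [set w | c w = k].
  apply/seteqP; split => w /=; first by rewrite FE => Qw; exists (c w).
  by move=> [k /= Qk ck]; rewrite FE ck.
apply: fin_bigcup_measurable; first exact: finite_finset.
move=> k _.
have -> : [set w | c w = k] = \bigcap_(t in [set: 'I_n * 'I_n * 'I_p]) [set w | c w t = k t].
  apply/seteqP; split => w /=; first by move=> ck t _ /=; rewrite ck.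
  by move=> h; apply/ffunP => t; exact: h.
apply: fin_bigcap_measurable; first exact: finite_finset.
move=> t _; rewrite -[X in measurable X]setTI.
have mt (l : 'I_n) (i : 'I_p) : measurable_fun [set: Omega] (fun w => tnth (x l w) i).
  by apply: (measurableT_comp (measurable_tnth i)); exact: measurable_funP.
have mle := measurable_fun_ler (mt t.1.1 t.2) (mt t.1.2 t.2).
have := mle measurableT [set (k t)] I.
congr (measurable _); apply/seteqP; split => w /=; rewrite /c ffunE//.
Qed.

Lemma measure_bigsetU_le (R : realType) d (T : measurableType d) (P : probability T R)
    (I : eqType) (s : seq I) (A : I -> set T) :
  (forall i, measurable (A i)) ->
  (P (\big[setU/set0]_(i <- s) A i) <= \sum_(i <- s) P (A i))%E.
Proof.
move=> mA; elim: s => [|i s IH]; first by rewrite !big_nil measure0.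
rewrite !big_cons (le_trans (measureU2 _ _ _))//; last exact: leeD.
by apply: bigsetU_measurable => ? _.
Qed.

Section trig.
Context {R : realType}.

Lemma sin_pi6 : sin (pi / 6) = 1 / 2 :> R.
Proof.
have p0 : (0 : R) < pi by exact: pi_gt0.
set y : R := sin (pi / 6); set z : R := cos (pi / 6).
have y0 : 0 < y by apply: sin_gt0_pi; apply/andP; split; lra.
have z2 : z ^+ 2 = 1 - y ^+ 2 by exact: cos2sin2.
have e1 : sin (pi / 6 *+ 2) = 2 * z * y by rewrite sin_mulr2n -/y -/z mulr2n; ring.
have e2 : cos (pi / 6 *+ 2) = 2 * z ^+ 2 - 1 by rewrite cos_mulr2n -/z mulr2n; ring.
have : sin (pi / 6 *+ 2 + pi / 6) = 1 :> R.
  by rewrite -mulrSr -[RHS]sin_pihalf; congr sin; rewrite -mulr_natr; field.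
rewrite sinD e1 e2 -/y -/z => h.
have h' : 2 * z ^+ 2 * y + (2 * z ^+ 2 - 1) * y = 1 by rewrite -[RHS]h; ring.
(* The triple-angle formula for sin (pi / 2) = 1, in factored form. *)
have {}h : (y + 1) * (2 * y - 1) ^+ 2 = 0.
  have -> : (y + 1) * (2 * y - 1) ^+ 2 = 1 - (2 * (1 - y ^+ 2) * y + (2 * (1 - y ^+ 2) - 1) * y) by ring.
  by rewrite -z2 h' subrr.
move/eqP: h; rewrite mulf_eq0 sqrf_eq0 => /orP[|] /eqP; lra.
Qed.

Lemma sin_lipschitz (a b : R) : `|sin a - sin b| <= `|a - b|.
Proof.
wlog ab : a b / b <= a.
  move=> h; have [/h//|/ltW/h] := leP b a.
  by rewrite distrC [leRHS]distrC.
have [c _ ->] : exists2 c, c \in `[b, a] & sin a - sin b = cos c * (a - b).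
  apply: MVT_segment => //; apply: continuous_subspaceT; exact: continuous_sin.
by rewrite normrM ler_piMl// ler_norml cos_geN1 cos_le1.
Qed.

Lemma spearman_sym n p (D : 'M[R]_(n, p)) i j : spearman D i j = spearman D j i.
Proof.
rewrite /spearman /pearson; congr (_ / _); last by rewrite mulrC.
by apply: eq_bigr => l _; rewrite mulrC.
Qed.

Lemma spearman_mx_le2 n p (D : 'M[R]_(n, p)) i j : `|spearman_mx D i j| <= 2.
Proof.
rewrite mxE normrM ger0_norm// ler_piMr// ler_norml sin_geN1 sin_le1//.
Qed.

End trig.

(** * Deviation of the rank correlation matrix *)

Definition pair_vector (R : realType) p (i j : 'I_p) (a b : R) : 'cV[R]_p :=
  a *: delta_mx i 0 + b *: delta_mx j 0.

Lemma quadform_pair (R : realType) p (S : 'M[R]_p) (i j : 'I_p) (a b : R) :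
  ((pair_vector i j a b)^T *m S *m pair_vector i j a b) 0 0 =
  a ^+ 2 * S i i + a * b * (S i j + S j i) + b ^+ 2 * S j j.
Proof.
have e k l : (delta_mx (0 : 'I_1) k *m S *m delta_mx l (0 : 'I_1)) 0 0 = S k l.
  by rewrite -rowE -colE !mxE.
rewrite /pair_vector.
have addE (A B : 'M[R]_1) : (A + B) 0 0 = A 0 0 + B 0 0 by rewrite mxE.
have sclE c (A : 'M[R]_1) : (c *: A) 0 0 = c * A 0 0 by rewrite mxE.
have -> : (a *: delta_mx i 0 + b *: delta_mx j 0 : 'cV[R]_p)^T =
    a *: delta_mx 0 i + b *: delta_mx 0 j.
  by apply/matrixP => k l; rewrite !mxE ![_ && (k == _)]andbC.
rewrite /= !mulmxDl !mulmxDr -!scalemxAl -!scalemxAr !addE !sclE !e.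
ring.
Qed.

Section corr.
Context {R : realType} p (Sigma : 'M[R]_p).
Hypotheses (Sigma_pd : posdefmx Sigma) (Sigma1 : forall i, Sigma i i = 1).

Lemma pair_vector_neq0 (i j : 'I_p) (a b : R) : i != j -> (a != 0) || (b != 0) ->
  pair_vector i j a b != 0.
Proof.
rewrite /pair_vector; move=> ij ab; apply/eqP => h.
have := congr1 (fun M : 'cV[R]_p => M i 0) h; have := congr1 (fun M : 'cV[R]_p => M j 0) h.
rewrite !mxE !eqxx (negbTE ij) eq_sym (negbTE ij)/= !mulr0 !mulr1 addr0 add0r => b0 a0.
by move: ab; rewrite a0 b0 eqxx.
Qed.

Lemma Sigma_sym i j : Sigma i j = Sigma j i.
Proof. by have [e _] := Sigma_pd; rewrite -[in LHS]e mxE. Qed.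

Lemma quadform_corr (i j : 'I_p) (a b : R) :
  ((pair_vector i j a b)^T *m Sigma *m pair_vector i j a b) 0 0 = a ^+ 2 + 2 * a * b * Sigma i j + b ^+ 2.
Proof.
by rewrite quadform_pair !Sigma1 (Sigma_sym j i); ring.
Qed.

(** Positive definiteness on [e_i + e_j] and [e_i - e_j]. *)
Lemma Sigma_lt1 i j : i != j -> `|Sigma i j| < 1.
Proof.
move=> ij; have [_ pd] := Sigma_pd.
have n1 : ((1 : R) != 0) || ((1 : R) != 0) by rewrite oner_eq0.
have n2 : ((1 : R) != 0) || ((-1 : R) != 0) by rewrite oner_eq0.
have := pd _ (pair_vector_neq0 ij n1); have := pd _ (pair_vector_neq0 ij n2).
by rewrite !quadform_corr ltr_norml !expr2; lra.
Qed.

Lemma Sigma_le1 i j : `|Sigma i j| <= 1.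
Proof.
have [->|ij] := eqVneq i j; first by rewrite Sigma1 normr1.
exact: ltW (Sigma_lt1 ij).
Qed.

End corr.

Section deviation.
Context {R : realType} d (Omega : measurableType d) (P : probability Omega R).
Variables (n p : nat) (Sigma : 'M[R]_p) (X : {mfun Omega >-> p.-tuple R}).
Variable x : 'I_n -> {mfun Omega >-> p.-tuple R}.
Hypotheses (Sigma_pd : posdefmx Sigma) (Sigma1 : forall i, Sigma i i = 1).
Hypotheses (npn : nonparanormal P X Sigma) (iid : iid_copies P X x).

Let x_law l A : measurable A -> P (x l @^-1` A) = P (X @^-1` A).
Proof. by move=> mA; have [h _] := iid; exact: h. Qed.

Let x_indep (A : 'I_n -> set (p.-tuple R)) : (forall l, measurable (A l)) ->
  P [set w | forall l, A l (x l w)] = (\prod_(l < n) P (x l @^-1` A l))%E.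
Proof. by move=> mA; have [_ h] := iid; exact: h. Qed.

Definition tie_free (w : Omega) (i : 'I_p) := injective (fun l => data_mx x w l i).

Let S w := spearman_mx (data_mx x w).

(** The Pearson correlation of a constant vector with itself is [0 / 0 = 0], so an
assumption on the ties is needed. *)
Lemma spearman_mx_diag w i : (1 < n)%N -> tie_free w i -> S w i i = 1.
Proof.
move=> n1 tf; have n0 : (0 < n)%N by apply: ltnW.
rewrite mxE spearmanE// triple_sumE.
have vE := sum_sqr_rk tf.
have -> : \sum_l centered_rank ((data_mx x w)^~ i) l * centered_rank ((data_mx x w)^~ i) l =
    n%:R * (n%:R ^+ 2 - 1) / 3 :> R.
  have -> : n%:R * (n%:R ^+ 2 - 1) / 3 = 4 * (n%:R * (n%:R ^+ 2 - 1) / 12) :> R by field.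
  rewrite -vE mulr_sumr; apply: eq_bigr => l _; rewrite rk_sg//; by field.
have e : n%:R * (n%:R ^+ 2 - 1) != 0 :> R.
  rewrite mulf_neq0 ?pnatr_eq0 -?lt0n// gt_eqF// subr_gt0 exprn_egt1//.
  by rewrite ltr1n.
have cancel3 (N : R) : N != 0 -> 3 * (N / 3) / N = 1 by move=> N0; field.
by rewrite cancel3// mulr1 sin_pi6; field.
Qed.

(** The exceptional set consists of the ties among the Gaussian coordinates, a null
set, and of a large deviation of the triple sum.  Outside of it the observations
have the same order as the Gaussian coordinates, since a nondecreasing function
preserves the order of points with distinct images.  The bounds [eps < 3] and
[12 * pi <= n * eps] force [n > 8], so that the normalization by [n^2 - 1]
instead of [n^2] is harmless. *)
Lemma spearman_pair_deviation (i j : 'I_p) (eps : R) : i != j ->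
  0 < eps -> eps < 3 -> 12 * pi <= n%:R * eps ->
  exists B : set Omega, [/\ measurable B,
    (P B <= (2 * expR (- (n%:R * (eps / 240) ^+ 2)))%:E)%E &
    forall w, ~ B w -> [/\ tie_free w i, tie_free w j & `|S w i j - Sigma i j| <= eps]].
Proof.
move=> ij e0 e3 ne; have [f f_nd npnE] := npn.
pose u (t : p.-tuple R) := f i (tnth t i).
pose v (t : p.-tuple R) := f j (tnth t j).
have mf k : measurable_fun [set: p.-tuple R] (fun t : p.-tuple R => f k (tnth t k)).
  apply: (measurableT_comp _ (measurable_tnth k)).
  by apply: nondecreasing_measurable => //; exact: f_nd.
have mu_u : measurable_fun setT u := mf i.
have mu_v : measurable_fun setT v := mf j.
have law_uv (i' j' : 'I_p) (a b : R) : i' != j' -> (a != 0) || (b != 0) -> forall A : set R, measurable A ->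
    distribution P X [set t | A (a * f i' (tnth t i') + b * f j' (tnth t j'))] =
    normal_prob 0 (Num.sqrt (a ^+ 2 + 2 * a * b * Sigma i' j' + b ^+ 2)) A.
  move=> ij' ab A mA; rewrite -quadform_corr//.
  rewrite -(npnE _ (pair_vector_neq0 ij' ab) A mA).
  rewrite /distribution /pushforward; congr (P _); apply/seteqP.
  have e w : \sum_k (pair_vector i' j' a b) k 0 * f k (tnth (X w) k) =
      a * f i' (tnth (X w) i') + b * f j' (tnth (X w) j').
    rewrite /pair_vector (bigD1 i')//= (bigD1 j')/=; last by rewrite eq_sym.
    rewrite big1 ?addr0.
      by rewrite !mxE !eqxx (negbTE ij') eq_sym (negbTE ij')/= !mulr0 !mulr1 addr0 add0r.
    by move=> k /andP[/negbTE k1 /negbTE k2]; rewrite !mxE k1 k2/= !mulr0 addr0 mul0r.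
  by split => w /=; rewrite e.
have s1 := Sigma_lt1 Sigma_pd Sigma1 ij.
have n_gt8 : 8 < n%:R :> R.
  by have pi2 := @pi_ge2 R; rewrite -(ltr_pM2r e0); lra.
have n0 : (0 < n)%N by rewrite -(ltr0n R); lra.
have ji : j != i by rewrite eq_sym.
have [phi q_sign phiE] := sign_correlation mu_u mu_v s1 (fun a b => law_uv i j a b ij).
set q := 2 / pi * phi in q_sign.
have tie0 k k' : k != k' -> forall l m : 'I_n, l != m ->
    let B := [set w | f k (tnth (x l w) k) = f k (tnth (x m w) k)] in
    measurable B /\ P B = 0%E.
  move=> kk l m lm B.
  pose iota (r : 'I_2) : 'I_n := tnth [tuple l; m] r.
  have iota_inj : injective iota by apply/tuple_uniqP; rewrite /= inE lm.
  pose C := [set s : 2.-tuple (p.-tuple R) |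
     f k (tnth (tnth s ord0) k) = f k (tnth (tnth s (lift ord0 ord0)) k)].
  have mC : measurable C.
    have md : measurable_fun [set: 2.-tuple (p.-tuple R)] (fun s : 2.-tuple (p.-tuple R) =>
        f k (tnth (tnth s ord0) k) - f k (tnth (tnth s (lift ord0 ord0)) k)).
      by apply: measurable_funB; exact: (measurableT_comp (mf k) (measurable_tnth _)).
    have := md measurableT _ (measurable_set1 0); rewrite setTI.
    congr (measurable _); apply/seteqP; split => s /=.
      by move/eqP; rewrite subr_eq0 => /eqP.
    by rewrite /C/= => ->; rewrite subrr.
  have BC : B = subsample x iota @^-1` C.
    by apply/seteqP; split => w; rewrite /B /C/= !tnth_mktuple.
  split.
    by rewrite BC -[X in measurable X]setTI; apply: measurable_subsample.
  rewrite BC; apply: etrans (subsample_law x_law x_indep iota_inj mC) _.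
  exact: (no_tie (mf k) (mf k') (fun a b => law_uv k k' a b kk)).
pose TU k := \big[setU/set0]_(z : 'I_n * 'I_n)
   (if z.1 == z.2 then set0 else [set w | f k (tnth (x z.1 w) k) = f k (tnth (x z.2 w) k)]).
have TU0 k k' : k != k' -> measurable (TU k) /\ P (TU k) = 0%E.
  move=> kk.
  have mA (z : 'I_n * 'I_n) : measurable (if z.1 == z.2 then set0 else
      [set w | f k (tnth (x z.1 w) k) = f k (tnth (x z.2 w) k)]).
    by case: ifPn => // z12; have [] := tie0 k k' kk _ _ z12.
  split; first by apply: bigsetU_measurable => z _; exact: mA.
  apply/eqP; rewrite -measure_le0 (le_trans (measure_bigsetU_le _ _ mA))//.
  rewrite big1// => z _; case: ifPn => z12; first exact: measure0.
  by have [] := tie0 k k' kk _ _ z12.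
have TUP k w : ~ TU k w -> injective (fun l => f k (tnth (x l w) k)).
  move=> nT l m e; apply/eqP/negPn/negP => lm; apply: nT.
  rewrite /TU -bigcup_seq; exists (l, m); first by rewrite /= mem_index_enum.
  by rewrite /= (negbTE lm).
have TUfree k w : ~ TU k w -> tie_free w k.
  move=> /TUP h l m; rewrite /data_mx !mxE => e; apply: h.
  by rewrite /= e.
have TUsg k w l m : ~ TU k w ->
    Num.sg (data_mx x w l k - data_mx x w m k) = Num.sg (f k (tnth (x l w) k) - f k (tnth (x m w) k)).
  move=> /TUP h; rewrite !mxE.
  have [->|lm] := eqVneq l m; first by rewrite !subrr.
  have nek : f k (tnth (x l w) k) != f k (tnth (x m w) k) by apply: contra lm => /eqP/h ->.
  have [lt|lt|e] := ltgtP (tnth (x l w) k) (tnth (x m w) k).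
  - rewrite !ltr0_sg ?subr_lt0// lt_neqAle nek; exact: f_nd (ltW lt).
  - rewrite !gtr0_sg ?subr_gt0// lt_neqAle eq_sym nek; exact: f_nd (ltW lt).
  - by move: nek; rewrite e eqxx.
pose G w := tuple_triple_sum u v (subsample x id w).
pose EG := fine (\int[iid_law (distribution P X) n]_s (tuple_triple_sum u v s)%:E)%E.
(* With this threshold, a^2 / (576 n^5) = n (eps / 240)^2. *)
pose a := n%:R ^+ 3 * eps / 10.
have nR : (0 : R) < n%:R by rewrite ltr0n.
have a0 : 0 < a by rewrite divr_gt0// mulr_gt0// exprn_gt0.
pose Dev := [set w | (a <= `|G w - EG|)%R].
have mDev : measurable Dev := measurable_subsample_triple_sum x mu_u mu_v EG a.
have [mTi Ti0] := TU0 i j ij.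
have [mTj Tj0] := TU0 j i ji.
exists (TU i `|` TU j `|` Dev); split.
- by apply: measurableU => //; exact: measurableU.
- apply: (le_trans (measureU2 _ _ _)) => //; first exact: measurableU.
  apply: (@le_trans _ _ (0 + P Dev)%E).
    apply: leeD => //.
    have h : (P (TU i `|` TU j) <= P (TU i) + P (TU j))%E by exact: measureU2.
    by move: h; rewrite Ti0 Tj0 adde0.
  rewrite add0e; apply: (le_trans (triple_sum_mcdiarmid x_law x_indep mu_u mu_v n0 a0)).
  rewrite lee_fin ler_pM2l// ler_expR lerN2 le_eqVlt; apply/orP; left; apply/eqP.
  by rewrite /a; field; rewrite pnatr_eq0 -lt0n.
move=> w /not_orP[/not_orP[nTi nTj] nDev].
split; [exact: TUfree|exact: TUfree|].
have q1 := sign_mean_le1 mu_u mu_v q_sign.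
have EGq := triple_sum_expectation x_law x_indep mu_u mu_v q_sign.
have GEG : `|G w - EG| < a by rewrite ltNge; apply/negP.
have Gq : `|G w - n%:R ^+ 3 * q| <= a + 6 * n%:R ^+ 2.
  apply: (le_trans (ler_distD EG _ _)); apply: lerD => //; exact: ltW.
have SE : S w i j = 2 * sin (pi / 6 * (3 * G w / (n%:R * (n%:R ^+ 2 - 1)))).
  rewrite /S mxE spearmanE//; [|exact: TUfree|exact: TUfree].
  congr (2 * sin (_ * (3 * _ / _))).
  rewrite /G /tuple_triple_sum /triple_sum; apply: eq_bigr => l _.
  apply: eq_bigr => r _; apply: eq_bigr => s _.
  by rewrite !TUsg// /subsample !tnth_mktuple.
have sigE : Sigma i j = 2 * sin (pi / 6 * (3 * q)).
  rewrite -phiE; congr (2 * sin _); rewrite /q.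
  have := @pi_gt0 R; move: (pi : R) => p' p'0; field; rewrite gt_eqF//.
rewrite SE sigE -mulrBr normrM ger0_norm//.
apply: (@le_trans _ _ (2 * `|pi / 6 * (3 * G w / (n%:R * (n%:R ^+ 2 - 1))) - pi / 6 * (3 * q)|)).
  by rewrite ler_pM2l// sin_lipschitz.
have m0 : 0 < n%:R ^+ 2 - 1 :> R by rewrite subr_gt0 exprn_egt1//; lra.
have -> : pi / 6 * (3 * G w / (n%:R * (n%:R ^+ 2 - 1))) - pi / 6 * (3 * q) =
    pi / 2 * (((G w - n%:R ^+ 3 * q) + n%:R * q) / (n%:R * (n%:R ^+ 2 - 1))) :> R.
  by field; rewrite !gt_eqF.
have p0 := @pi_gt0 R; have p4 : pi < 4 :> R by have := @pihalf_lt2 R; lra.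
rewrite normrM (ger0_norm (divr_ge0 (ltW p0) _))// normrM.
rewrite (ger0_norm (x := (_ * _)^-1)); last by rewrite invr_ge0 ltW// mulr_gt0.
have -> : 2 * (pi / 2 * (`|G w - n%:R ^+ 3 * q + n%:R * q| / (n%:R * (n%:R ^+ 2 - 1)))) =
    pi * `|G w - n%:R ^+ 3 * q + n%:R * q| / (n%:R * (n%:R ^+ 2 - 1)) :> R by field; rewrite !gt_eqF.
rewrite ler_pdivrMr ?mulr_gt0//.
have b1 : `|G w - n%:R ^+ 3 * q + n%:R * q| <= a + 6 * n%:R ^+ 2 + n%:R.
  rewrite (le_trans (ler_normD _ _))// lerD// normrM (ger0_norm (ltW nR)).
  by rewrite ler_piMr// ltW.
apply: (@le_trans _ _ (pi * (a + 6 * n%:R ^+ 2 + n%:R))); first by rewrite ler_pM2l.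
have -> : pi * (a + 6 * n%:R ^+ 2 + n%:R) =
    n%:R * (pi * (n%:R ^+ 2 * eps / 10) + 6 * n%:R * pi + pi) :> R by rewrite /a; field.
have -> : eps * (n%:R * (n%:R ^+ 2 - 1)) = n%:R * (eps * n%:R ^+ 2 - eps) :> R by ring.
rewrite ler_pM2l//.
move: (n%:R : R) (pi : R) n_gt8 nR ne p0 p4 => N p' N8 N0 Ne p0 p4.
have h1 : p' * (N ^+ 2 * eps / 10) <= 4 * (N ^+ 2 * eps / 10).
  by rewrite ler_wpM2r ?(ltW p4)// divr_ge0// mulr_ge0 ?sqr_ge0 ?(ltW e0).
(* The bias of order n^2 is absorbed by 12 pi <= n eps. *)
have h2 : 6 * N * p' <= N ^+ 2 * eps / 2.
  have : N * (12 * p') <= N * (N * eps) by rewrite ler_pM2l.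
  by rewrite expr2; lra.
have h3 : 8 * (N * eps) <= N ^+ 2 * eps.
  by rewrite expr2 -mulrA ler_pM2r ?ltW// mulr_gt0.
have h4 : 8 * eps <= N * eps by rewrite ler_pM2r// ltW.
lra.
Qed.

(** A union bound over the pairs [i < j], at most [p^2 / 2] of them.  For
[eps >= 3] the statement is trivial since all entries are bounded.  The index
[k != j] in the event restricts it to [p > 1]: a variable enters through a pair,
and this pair guarantees that it has no ties, which the diagonal entry [j = l]
requires. *)
Lemma spearman_mx_deviation (eps : R) : 0 < eps -> 12 * pi <= n%:R * eps ->
  let good := [set w | forall j k l, j != k -> `|S w j l - Sigma j l| <= eps] in
  measurable good /\
  ((1 - p%:R ^+ 2 * expR (- (n%:R * (eps / 240) ^+ 2)))%:E <= P good)%E.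
Proof.
move=> e0 ne good.
have mgood : measurable good.
  exact: (measurable_rank_event x (fun r => forall j k l, j != k ->
    `|(\matrix_(i, j) (2 * sin (pi / 6 * pearson (col i r) (col j r)))) j l - Sigma j l| <= eps)).
split=> //; set y := expR _; have y0 : 0 <= y := expR_ge0 _.
have [e3|e3] := leP 3 eps.
  have -> : good = setT.
    apply/seteqP; split => // w _ j k l _; apply: le_trans e3.
    have := ler_normB (S w j l) (Sigma j l).
    have := Sigma_le1 Sigma_pd Sigma1 j l.
    have : `|S w j l| <= 2 by exact: spearman_mx_le2.
    lra.
  by rewrite probability_setT lee_fin lerBlDr lerDl mulr_ge0// exprn_ge0.
have HB0 (z : 'I_p * 'I_p) : exists C : set Omega, (z.1 < z.2)%N ->
    [/\ measurable C, (P C <= (2 * y)%:E)%E & forall w, ~ C w ->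
     [/\ tie_free w z.1, tie_free w z.2 & `|S w z.1 z.2 - Sigma z.1 z.2| <= eps]].
  have [z12|z12] := boolP (z.1 < z.2)%N; last by exists set0.
  have zne : z.1 != z.2 by rewrite -(inj_eq val_inj) ltn_eqF.
  by have [C HC] := spearman_pair_deviation zne e0 e3 ne; exists C.
have [B HB] := choice HB0.
pose A (z : 'I_p * 'I_p) := if (z.1 < z.2)%N then B z else set0.
have mA z : measurable (A z) by rewrite /A; case: ifPn => // /HB[].
pose BB := \big[setU/set0]_(z : 'I_p * 'I_p) A z.
have mBB : measurable BB by apply: bigsetU_measurable => z _.
have AB w (z : 'I_p * 'I_p) : ~ BB w -> (z.1 < z.2)%N -> ~ B z w.
  move=> nB z12 Bz; apply: nB; rewrite /BB -bigcup_seq.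
  by exists z; [rewrite /= mem_index_enum|rewrite /A z12].
have sub : ~` BB `<=` good.
  move=> w nB j k l jk; have n1 : (1 < n)%N.
    rewrite -(ltr1n R); have pi2 := @pi_ge2 R.
    rewrite -(ltr_pM2r e0); lra.
  have tf : tie_free w j.
    have [lt|lt|e] := ltgtP j k.
    - by have [_ _ /(_ w (AB _ (j, k) nB lt))[]] := HB (j, k) lt.
    - by have [_ _ /(_ w (AB _ (k, j) nB lt))[]] := HB (k, j) lt.
    - by move: jk; rewrite -(inj_eq val_inj) /= e eqxx.
  have [lt|lt|e] := ltgtP j l.
  - by have [_ _ /(_ w (AB _ (j, l) nB lt))[]] := HB (j, l) lt.
  - have [_ _ /(_ w (AB _ (l, j) nB lt))[_ _]] := HB (l, j) lt.
    by rewrite /S !mxE spearman_sym (Sigma_sym Sigma_pd).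
  - by rewrite -e spearman_mx_diag// Sigma1 subrr normr0 ltW.
apply: (@le_trans _ _ (P (~` BB))); last by apply: le_measure; rewrite ?inE//; exact: measurableC.
rewrite probability_setC// EFinB leeB//.
apply: (le_trans (measure_bigsetU_le _ _ mA)).
apply: (@le_trans _ _ (\sum_(z : 'I_p * 'I_p) (if (z.1 < z.2)%N then 2 * y else 0)%:E)%E).
  apply: lee_sum => z _; rewrite /A; case: ifPn => [z12|_]; last by rewrite measure0.
  by have [] := HB z z12.
rewrite sumEFin lee_fin.
have -> : \sum_(z : 'I_p * 'I_p) (if (z.1 < z.2)%N then 2 * y else 0) =
   \sum_(z : 'I_p * 'I_p) ((z.1 < z.2)%N%:R * y + (z.2 < z.1)%N%:R * y).
  rewrite big_split/=.
  have -> : \sum_(z : 'I_p * 'I_p) (z.2 < z.1)%N%:R * y = \sum_(z : 'I_p * 'I_p) (z.1 < z.2)%N%:R * y.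
    by rewrite (reindex_inj (h := fun z : 'I_p * 'I_p => (z.2, z.1)))//= => -[? ?] [? ?] [-> ->].
  rewrite -big_split/=; apply: eq_bigr => z _.
  by case: ifP => _; rewrite ?mul1r ?mul0r ?addr0//; ring.
apply: (@le_trans _ _ (\sum_(z : 'I_p * 'I_p) y)).
  apply: ler_sum => z _; case: (ltngtP z.1 z.2) => _; rewrite ?mul1r ?mul0r ?addr0 ?add0r//.
by rewrite sumr_const card_prod card_ord -[leLHS]mulr_natl natrM expr2.
Qed.

End deviation.

(** * The precision matrix *)

Section precision.
Context {R : realType} p (Sigma : 'M[R]_p).
Hypotheses (Sigma_pd : posdefmx Sigma) (Sigma1 : forall i, Sigma i i = 1).
Local Notation Theta := (invmx Sigma).
Local Notation M := (mx_l1 Theta).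
Local Notation b := (mindiag Theta).

Lemma posdefmx_unit : Sigma \in unitmx.
Proof.
rewrite -row_free_unit -kermx_eq0; apply/rowV0P => v /sub_kermxP vS.
have [_ pd] := Sigma_pd; apply/eqP/negPn/negP => v0.
have : v^T != 0 by apply: contra v0 => /eqP h; rewrite -[v]trmxK h trmx0.
by move/pd; rewrite trmxK vS mul0mx mxE ltxx.
Qed.

Lemma precision_sym i j : Theta i j = Theta j i.
Proof.
have [e _] := Sigma_pd.
by rewrite -[in LHS](trmxK Theta) trmx_inv e mxE.
Qed.

Lemma Sigma_Theta i k : \sum_l Sigma i l * Theta l k = (i == k)%:R.
Proof.
by have := congr1 (fun A : 'M[R]_p => A i k) (mulmxV posdefmx_unit); rewrite !mxE.
Qed.

Lemma Theta_Sigma i k : \sum_l Theta i l * Sigma l k = (i == k)%:R.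
Proof.
by have := congr1 (fun A : 'M[R]_p => A i k) (mulVmx posdefmx_unit); rewrite !mxE.
Qed.

Lemma posdef_sum (a : 'I_p -> R) : (exists i, a i != 0) ->
  0 < \sum_i a i * \sum_j Sigma i j * a j.
Proof.
move=> [i0 ai0]; have [_ pd] := Sigma_pd.
have a0 : (\col_i a i : 'cV[R]_p) != 0.
  by apply: contra ai0 => /eqP/(congr1 (fun c : 'cV[R]_p => c i0 0)); rewrite !mxE => ->.
have := pd _ a0; rewrite -mulmxA mxE; congr (0 < _).
apply: eq_bigr => i _; rewrite !mxE; congr (_ * _).
by apply: eq_bigr => j _; rewrite !mxE.
Qed.

Lemma Theta_diag_gt0 k : 0 < Theta k k.
Proof.
have := @posdef_sum (fun i => Theta i k).
have e : \sum_i Theta i k * \sum_j Sigma i j * Theta j k = Theta k k.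
  under eq_bigr do rewrite Sigma_Theta.
  by rewrite (bigD1 k)//= eqxx mulr1 big1 ?addr0// => i /negbTE ->; rewrite mulr0.
rewrite e; apply; have h : \sum_l Sigma k l * Theta l k = 1 by rewrite Sigma_Theta eqxx.
apply: contrapT => /forallNP hn; have : (0 : R) = 1.
  rewrite -[RHS]h big1// => l _; have /negP/negPn/eqP -> := hn l.
  by rewrite mulr0.
by move/eqP; rewrite eq_sym oner_eq0.
Qed.

(** The residual variance [1 / Theta k k] is at most the variance 1: the fitted value,
with coefficients [e_k - Theta e_k / Theta k k], has variance
[1 - 1 / Theta k k]. *)
Lemma Theta_diag_ge1 k : 1 <= Theta k k.
Proof.
have t0 := Theta_diag_gt0 k; set t := Theta k k in t0 *.
pose a i : R := (i == k)%:R - Theta i k / t.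
have Sa i : \sum_j Sigma i j * a j = Sigma i k - (i == k)%:R / t.
  rewrite /a; under eq_bigr do rewrite mulrBr mulrA.
  rewrite sumrB -mulr_suml Sigma_Theta; congr (_ - _).
  by rewrite (bigD1 k)//= eqxx mulr1 big1 ?addr0// => l /negbTE ->; rewrite mulr0.
have e : \sum_i a i * \sum_j Sigma i j * a j = 1 - t^-1.
  under eq_bigr do rewrite Sa.
  under eq_bigr do rewrite {1}/a mulrBl.
  rewrite sumrB (bigD1 k)//= eqxx big1; last by move=> i /negbTE ->; rewrite mul0r.
  rewrite addr0 Sigma1 mul1r.
  under eq_bigr do rewrite mulrBr.
  rewrite sumrB.
  have -> : \sum_i Theta i k / t * Sigma i k = t^-1.
    transitivity (t^-1 * \sum_i Sigma k i * Theta i k).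
      rewrite mulr_sumr; apply: eq_bigr => i _.
      by rewrite (Sigma_sym Sigma_pd i k); ring.
    by rewrite Sigma_Theta eqxx mulr1.
  have -> : \sum_i Theta i k / t * ((i == k)%:R / t) = t^-1.
    rewrite (bigD1 k)//= eqxx big1 ?addr0; last by move=> i /negbTE ->; rewrite mul0r mulr0.
    by rewrite -/t divff ?gt_eqF// !mul1r.
  by rewrite mul1r subrr subr0.
have [[i ai]|/forallNP a0] := pselect (exists i, a i != 0).
  have : 0 < 1 - t^-1 by rewrite -e; apply: posdef_sum; exists i.
  by rewrite subr_gt0 invf_lt1// => /ltW.
have : (0 : R) = 1 - t^-1.
  by rewrite -e big1// => i _; have /negP/negPn/eqP -> := a0 i; rewrite mul0r.
by move/eqP; rewrite eq_sym subr_eq0 => /eqP h; rewrite -[t]invrK -h invr1.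
Qed.

Lemma col_le_mx_l1 (A : 'M[R]_p) k : \sum_i `|A i k| <= mx_l1 A.
Proof. by rewrite /mx_l1; exact: (le_bigmax _ (fun k => \sum_i `|A i k|)). Qed.

Lemma row_Theta_le k : \sum_j `|Theta k j| <= M.
Proof. by under eq_bigr do rewrite precision_sym; exact: col_le_mx_l1. Qed.

Lemma Theta_diag_le k : Theta k k <= M.
Proof.
apply: le_trans (col_le_mx_l1 Theta k).
rewrite (bigD1 k)//= (le_trans (ler_norm _))// lerDl sumr_ge0//.
Qed.

Lemma mindiag_le k : b <= Theta k k.
Proof.
apply: ge_inf; last by exists k.
by exists 1 => _ [i _ <-]; exact: Theta_diag_ge1.
Qed.

Lemma mindiag_ge1 : (0 < p)%N -> 1 <= b.
Proof.
move=> p0; apply: lb_le_inf; first by exists (Theta (Ordinal p0) (Ordinal p0)); exists (Ordinal p0).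
by move=> _ [i _ <-]; exact: Theta_diag_ge1.
Qed.

Lemma mindiag_le_mx_l1 : (0 < p)%N -> b <= M.
Proof.
by move=> p0; apply: le_trans (Theta_diag_le (Ordinal p0)); exact: mindiag_le.
Qed.

Lemma maxdeg_ge k : (#|[pred j | (j != k) && (Theta k j != 0%R)]| <= maxdeg Theta)%N.
Proof.
rewrite /maxdeg -card_classical.
exact: (leq_bigmax k).
Qed.

End precision.

(** * Error of one column of the estimator *)

Section column.
Context {R : realType} p (Sigma S : 'M[R]_p).
Hypotheses (p0 : (0 < p)%N) (Sigma_pd : posdefmx Sigma) (Sigma1 : forall i, Sigma i i = 1).
Local Notation Theta := (invmx Sigma).
Local Notation M := (mx_l1 Theta).
Local Notation b := (mindiag Theta).
Local Notation d := (maxdeg Theta).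
Variable lambda : R.
Hypothesis lambda_gt0 : 0 < lambda.
Local Notation eps := (b * lambda / M).
Hypothesis S_close : forall j k l, j != k -> `|S j l - Sigma j l| <= eps.

Let b1 : 1 <= b. Proof. exact: mindiag_ge1. Qed.
Let bM : b <= M. Proof. exact: mindiag_le_mx_l1. Qed.
Let M1 : 1 <= M. Proof. exact: le_trans bM. Qed.
Let M0 : 0 < M. Proof. exact: lt_le_trans M1. Qed.
Let b0 : 0 < b. Proof. exact: lt_le_trans b1. Qed.
Let epsM : eps * (M / b) = lambda.
Proof. by field; rewrite !gt_eqF. Qed.
Let eps0 : 0 <= eps. Proof. by rewrite divr_ge0 ?mulr_ge0// ltW. Qed.
Let L0 : 0 <= 2 * lambda. Proof. by rewrite mulr_ge0// ltW. Qed.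
Let eps_le : eps <= lambda.
Proof. by rewrite ler_pdivrMr// mulrC ler_pM2l. Qed.

Variable k : 'I_p.
Local Notation theta := (Theta k k).
Let t0 : 0 < theta. Proof. exact: Theta_diag_gt0. Qed.
Let t1 : 1 <= theta. Proof. exact: Theta_diag_ge1. Qed.
Let tM : theta <= M. Proof. exact: Theta_diag_le. Qed.
Let bt : b <= theta. Proof. exact: mindiag_le. Qed.

(** The coefficients of the population residual of variable [k] given the others. *)
Definition oracle (j : 'I_p) : R := Theta j k / theta.

Lemma oracle_k : oracle k = 1. Proof. by rewrite /oracle divff// gt_eqF. Qed.

Lemma Sigma_oracle j : \sum_l Sigma j l * oracle l = (j == k)%:R / theta.
Proof.
rewrite /oracle; under eq_bigr do rewrite mulrA.
by rewrite -mulr_suml Sigma_Theta.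
Qed.

(** The quotient [M / b] matches the radius [b * lambda / M] of the neighborhood of
[Sigma], so that replacing [Sigma] by [S] costs exactly [lambda]. *)
Lemma oracle_l1 : \sum_j `|oracle j| <= M / b.
Proof.
rewrite /oracle; under eq_bigr do rewrite normrM.
rewrite -mulr_suml ger0_norm ?invr_ge0 ?(ltW t0)//.
apply: ler_pM; rewrite ?sumr_ge0 ?invr_ge0 ?(ltW t0)//; first exact: col_le_mx_l1.
by rewrite lef_pV2 ?posrE.
Qed.

Lemma Mb_le : M / b <= M.
Proof. by rewrite ler_pdivrMr// ler_peMr// ltW. Qed.

Lemma perturbation (v : 'I_p -> R) j : j != k -> \sum_l `|v l| <= M / b ->
  `|\sum_l S j l * v l - \sum_l Sigma j l * v l| <= lambda.
Proof.
move=> jk vl; rewrite -sumrB (le_trans (ler_norm_sum _ _ _))//.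
rewrite -epsM; apply: (@le_trans _ _ (\sum_l eps * `|v l|)).
  by apply: ler_sum => l _; rewrite -mulrBl normrM ler_wpM2r//; exact: S_close jk.
by rewrite -mulr_sumr ler_wpM2l.
Qed.

Lemma oracle_feasible j : j != k -> `|\sum_l S j l * oracle l| <= lambda.
Proof.
move=> jk; have := perturbation jk oracle_l1.
by rewrite Sigma_oracle (negbTE jk) mul0r subr0.
Qed.

Variable v : 'I_p -> R.
Hypotheses (vk : v k = 1) (v_feasible : forall j, j != k -> `|\sum_l S j l * v l| <= lambda).
Hypothesis v_l1 : \sum_(j | j != k) `|v j| <= \sum_(j | j != k) `|oracle j|.

Let D j := v j - oracle j.
Let g j := \sum_l Sigma j l * D l.

Let v_l1' : \sum_j `|v j| <= M / b.
Proof.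
apply: le_trans oracle_l1; rewrite (bigD1 k)//= [leRHS](bigD1 k)//= vk oracle_k.
by rewrite lerD2l.
Qed.

Let g_off j : j != k -> `|g j| <= 2 * lambda.
Proof.
move=> jk; rewrite /g; under eq_bigr do rewrite /D mulrBr.
rewrite sumrB Sigma_oracle (negbTE jk) mul0r subr0.
have := perturbation jk v_l1'; have := v_feasible jk.
rewrite !ler_norml => /andP[h1 h2] /andP[h3 h4]; apply/andP; split; lra.
Qed.

Let Dg i : D i = \sum_j Theta i j * g j.
Proof.
rewrite /g; under eq_bigr do rewrite mulr_sumr.
rewrite exchange_big/=.
under eq_bigr do under eq_bigr do rewrite mulrA.
under eq_bigr do rewrite -mulr_suml (Theta_Sigma Sigma_pd).
rewrite (bigD1 i)//= eqxx mul1r big1 ?addr0// => j.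
by rewrite eq_sym => /negbTE ->; rewrite mul0r.
Qed.

(** The constraint says nothing about row [k]; but [D k = 0] expresses [g k] through
the other entries of [g], which are controlled. *)
Let g_k : `|g k| <= 2 * lambda * M.
Proof.
have Dk : D k = 0 by rewrite /D vk oracle_k subrr.
have : theta * g k = - \sum_(j | j != k) Theta k j * g j.
  by have := Dg k; rewrite Dk (bigD1 k)//= => /esym/eqP; rewrite addr_eq0 => /eqP.
move/(congr1 (fun r => `|r|)); rewrite normrN normrM (gtr0_norm t0) => h.
have : theta * `|g k| <= 2 * lambda * M.
  rewrite h (le_trans (ler_norm_sum _ _ _))//.
  apply: (@le_trans _ _ (\sum_(j | j != k) (2 * lambda) * `|Theta k j|)).
    by apply: ler_sum => j jk; rewrite normrM mulrC ler_wpM2r// g_off.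
  rewrite -mulr_sumr ler_wpM2l//.
  apply: le_trans (row_Theta_le Sigma_pd k).
  by rewrite [leRHS](bigD1 k)//= lerDr.
by apply: le_trans; rewrite ler_peMl.
Qed.

Let g_le j : `|g j| <= 2 * lambda * M.
Proof.
have [->//|jk] := eqVneq j k; apply: (le_trans (g_off jk)).
by rewrite ler_peMr.
Qed.

Let D_le i : `|D i| <= 2 * lambda * M ^+ 2.
Proof.
rewrite Dg (le_trans (ler_norm_sum _ _ _))//.
apply: (@le_trans _ _ (\sum_j (2 * lambda * M) * `|Theta i j|)).
  by apply: ler_sum => j _; rewrite normrM mulrC ler_wpM2r.
rewrite -mulr_sumr expr2 mulrA ler_wpM2l ?(mulr_ge0 L0 (ltW M0))//.
exact: row_Theta_le.
Qed.

Let A j := (j != k) && (Theta k j != 0).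

Let oracle_off j : j != k -> ~~ A j -> oracle j = 0.
Proof.
move=> jk; rewrite /A jk negbK /= => /eqP h.
by rewrite /oracle (precision_sym Sigma_pd) h mul0r.
Qed.

Let cardA (c : R) : 0 <= c -> \sum_(j | A j) c <= c * d%:R.
Proof.
move=> c0; rewrite sumr_const -[leLHS]mulr_natr ler_wpM2l// ler_nat.
exact: maxdeg_ge.
Qed.

(** The cone argument: off the support [A] of [oracle] the error is the size of [v]
there, which the minimality of the l1 norm bounds by the error on [A]; and on
[A], with at most [d] elements, the entrywise bound suffices. *)
Let D_l1 : \sum_j `|D j| <= 4 * M ^+ 2 * (d%:R * lambda).
Proof.
have Dk : D k = 0 by rewrite /D vk oracle_k subrr.
have split_ (f : 'I_p -> R) : \sum_(j | j != k) f j = \sum_(j | A j) f j + \sum_(j | (j != k) && ~~ A j) f j.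
  rewrite (bigID A)/=; congr (_ + _).
  by apply: eq_bigl => j; rewrite /A andbA andbb.
rewrite (bigD1 k)//= Dk normr0 add0r split_.
have e1 : \sum_(j | (j != k) && ~~ A j) `|D j| = \sum_(j | (j != k) && ~~ A j) `|v j|.
  by apply: eq_bigr => j /andP[jk nA]; rewrite /D (oracle_off jk nA) subr0.
have e2 : \sum_(j | (j != k) && ~~ A j) `|oracle j| = 0.
  by rewrite big1// => j /andP[jk nA]; rewrite (oracle_off jk nA) normr0.
have h := v_l1; rewrite !split_ e2 addr0 in h.
have h2 : \sum_(j | A j) `|oracle j| <= \sum_(j | A j) `|v j| + \sum_(j | A j) `|D j|.
  rewrite -big_split/=; apply: ler_sum => j _.
  have := ler_normB (v j) (v j - oracle j); rewrite subKr.
  by rewrite /D.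
have h3 : \sum_(j | A j) `|D j| <= 2 * lambda * M ^+ 2 * d%:R.
  apply: le_trans (cardA _); first by apply: ler_sum.
  by rewrite !mulr_ge0 ?ltW// exprn_gt0.
rewrite e1.
apply: (@le_trans _ _ (2 * (2 * lambda * M ^+ 2 * d%:R))); first by lra.
by rewrite le_eqVlt; apply/orP; left; apply/eqP; ring.
Qed.

(** The factor [d] matters when [d = 0]: then [v] must vanish off [k]. *)
Let v_off : \sum_(j | j != k) `|v j| <= M * d%:R.
Proof.
apply: (le_trans v_l1).
have [d0|d0] := posnP d.
  rewrite d0 mulr0 big1// => j jk; rewrite oracle_off ?normr0//.
  have := maxdeg_ge Sigma k; rewrite d0 leqn0 => /eqP/card0_eq/(_ j).
  by rewrite inE => h; rewrite /A h.
apply: (@le_trans _ _ M); last by rewrite ler_peMr ?ler1n// ltW.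
apply: le_trans Mb_le; apply: le_trans oracle_l1.
by rewrite [leRHS](bigD1 k)//= lerDr.
Qed.

Variable that : R.
Hypothesis thatE : that = (\sum_(j | j != k) v j * (\sum_l S j l * v l)
   + \sum_(j | j != k) S j k * v j + 1)^-1.
Hypothesis small : 12 * M ^+ 3 * (d%:R * lambda) <= 1.

(** The inverse [that^-1] differs from the residual variance [1 / Theta k k] by at
most [6 M^2 d lambda]: one [M d lambda] from the constraint, one from replacing
[S] by [Sigma], and [4 M^2 d lambda] from [D_l1].  As [1 / Theta k k >= 1 / M],
the smallness assumption keeps [that^-1] above [1 / (2 M)], and inverting
costs a factor [2 M^2]. *)
Lemma column_error : \sum_j `|that * v j - Theta j k| <= 16 * M ^+ 5 * (d%:R * lambda).
Proof.
have small' := small; set s := d%:R * lambda in small' *.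
have s0 : 0 <= s by rewrite mulr_ge0// ltW.
pose q := \sum_(j | j != k) v j * (\sum_l S j l * v l) + \sum_(j | j != k) S j k * v j + 1.
have thatE' : that = q^-1 := thatE.
have qE : theta^-1 = 1 + \sum_(j | j != k) Sigma j k * oracle j.
  have := Sigma_oracle k; rewrite eqxx mul1r => <-.
  rewrite (bigD1 k)//= Sigma1 oracle_k mul1r; congr (_ + _).
  by apply: eq_bigr => j _; rewrite (Sigma_sym Sigma_pd).
have dq : q - theta^-1 = \sum_(j | j != k) v j * (\sum_l S j l * v l) +
   \sum_(j | j != k) (S j k - Sigma j k) * v j + \sum_(j | j != k) Sigma j k * D j.
  have -> : \sum_(j | j != k) (S j k - Sigma j k) * v j =
      \sum_(j | j != k) S j k * v j - \sum_(j | j != k) Sigma j k * v j.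
    by rewrite -sumrB; apply: eq_bigr => j _; rewrite mulrBl.
  have -> : \sum_(j | j != k) Sigma j k * D j =
      \sum_(j | j != k) Sigma j k * v j - \sum_(j | j != k) Sigma j k * oracle j.
    by rewrite -sumrB; apply: eq_bigr => j _; rewrite mulrBr.
  by rewrite qE /q; ring.
have q1 : `|\sum_(j | j != k) v j * (\sum_l S j l * v l)| <= M * s.
  rewrite (le_trans (ler_norm_sum _ _ _))//.
  apply: (@le_trans _ _ (\sum_(j | j != k) `|v j| * lambda)).
    by apply: ler_sum => j jk; rewrite normrM ler_wpM2l// v_feasible.
  by rewrite -mulr_suml /s mulrA ler_pM2r.
have q2 : `|\sum_(j | j != k) (S j k - Sigma j k) * v j| <= M * s.
  rewrite (le_trans (ler_norm_sum _ _ _))//.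
  apply: (@le_trans _ _ (\sum_(j | j != k) `|v j| * lambda)).
    apply: ler_sum => j jk; rewrite normrM mulrC ler_wpM2l//.
    exact: le_trans (S_close _ jk) eps_le.
  by rewrite -mulr_suml /s mulrA ler_pM2r.
have q3 : `|\sum_(j | j != k) Sigma j k * D j| <= 4 * M ^+ 2 * s.
  rewrite (le_trans (ler_norm_sum _ _ _))//; apply: le_trans D_l1.
  rewrite [leRHS](bigD1 k)//=; apply: (@le_trans _ _ (\sum_(j | j != k) `|D j|)).
    by apply: ler_sum => j _; rewrite normrM ler_piMl// Sigma_le1.
  by rewrite lerDr.
pose h := 6 * M ^+ 2 * s.
have M2 : M * s <= M ^+ 2 * s by rewrite ler_wpM2r// expr2 ler_peMl// ltW.
have qh : `|q - theta^-1| <= h.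
  rewrite dq (le_trans (ler_normD _ _))//.
  have := ler_normD (\sum_(j | j != k) v j * (\sum_l S j l * v l)) (\sum_(j | j != k) (S j k - Sigma j k) * v j).
  rewrite /h; lra.
have hM : 2 * M * h <= 1 by rewrite (le_trans _ small')// /h le_eqVlt; apply/orP; left; apply/eqP; ring.
have tV : M^-1 <= theta^-1 by rewrite lef_pV2 ?posrE.
have hV : h <= (2 * M)^-1 by rewrite -[leRHS]mul1r ler_pdivlMr ?mulr_gt0// mulrC.
have VM : (2 * M)^-1 + (2 * M)^-1 = M^-1 by field; rewrite gt_eqF.
have qlow : (2 * M)^-1 <= q.
  by have := qh; rewrite ler_norml => /andP[h1 _]; lra.
have q0 : 0 < q by apply: lt_le_trans qlow; rewrite invr_gt0 mulr_gt0.
have that0 : 0 < that by rewrite thatE' invr_gt0.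
have that_le : that <= 2 * M by rewrite thatE' -[leRHS]invrK lef_pV2 ?posrE// invr_gt0 mulr_gt0.
have h0 : 0 <= h by rewrite /h mulr_ge0// mulr_ge0// sqr_ge0.
have tt : `|that - theta| <= 2 * M ^+ 2 * h.
  have -> : that - theta = - (q - theta^-1) * (that * theta).
    by rewrite thatE'; field; rewrite !gt_eqF.
  rewrite normrM normrN (ger0_norm (mulr_ge0 (ltW that0) (ltW t0))).
  have -> : 2 * M ^+ 2 * h = h * (2 * M * M) by ring.
  apply: ler_pM => //; first by rewrite mulr_ge0// ltW.
  by apply: ler_pM => //; exact: ltW.
apply: (@le_trans _ _ (\sum_j (`|that - theta| * `|v j| + theta * `|D j|))).
  apply: ler_sum => j _.
  have -> : that * v j - Theta j k = (that - theta) * v j + theta * D j.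
    by rewrite /D /oracle; field; rewrite gt_eqF.
  by rewrite (le_trans (ler_normD _ _))// !normrM (gtr0_norm t0).
rewrite big_split/= -!mulr_sumr.
apply: (@le_trans _ _ (2 * M ^+ 2 * h * M + M * (4 * M ^+ 2 * s))).
  apply: lerD; apply: ler_pM => //; rewrite ?sumr_ge0 ?(ltW t0)//.
  exact: le_trans v_l1' Mb_le.
have -> : 2 * M ^+ 2 * h * M + M * (4 * M ^+ 2 * s) = 12 * M ^+ 5 * s + 4 * M ^+ 3 * s.
  by rewrite /h; ring.
have : M ^+ 3 * s <= M ^+ 5 * s by rewrite ler_wpM2r// ler_weXn2l.
lra.
Qed.

End column.

(** * Existence of the estimator *)

Section minimization.
Context {R : realType}.

Lemma continuous_bigsum (T : topologicalType) I (s : seq I) (F : I -> T -> R) :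
  (forall i, continuous (F i)) -> continuous (fun y => \sum_(i <- s) F i y).
Proof.
move=> cF; elim: s => [|i s IH].
  by under eq_fun do rewrite big_nil; exact: cst_continuous.
under eq_fun do rewrite big_cons.
by move=> y; apply: cvgD; [exact: cF|exact: IH].
Qed.

Lemma continuous_bigmax (T : topologicalType) I (s : seq I) (F : I -> T -> R) :
  (forall i, continuous (F i)) -> continuous (fun y => \big[Num.max/0]_(i <- s) F i y).
Proof.
move=> cF; elim: s => [|i s IH].
  by under eq_fun do rewrite big_nil; exact: cst_continuous.
under eq_fun do rewrite big_cons.
exact: (max_fun_continuous (cF i) IH).
Qed.

Lemma continuous_normr (T : topologicalType) (f : T -> R) :
  continuous f -> continuous (fun y => `|f y|).
Proof. by move=> cf y; apply: cvg_norm; exact: cf. Qed.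

Lemma continuous_opp (T : topologicalType) (f : T -> R) :
  continuous f -> continuous (fun y => - f y).
Proof. by move=> cf y; apply: cvgN; exact: cf. Qed.

Lemma continuous_sub (T : topologicalType) (f g : T -> R) :
  continuous f -> continuous g -> continuous (fun y => f y - g y).
Proof. by move=> cf cg y; apply: cvgB; [exact: cf|exact: cg]. Qed.

Lemma continuous_cmul (T : topologicalType) (a : R) (f : T -> R) :
  continuous f -> continuous (fun y => a * f y).
Proof. by move=> cf y; apply: cvgM; [exact: cvg_cst|exact: cf]. Qed.

Lemma mx_norm_le m n (A : 'M[R]_(m, n)) (c : R) : 0 <= c ->
  `|A| <= c <-> (forall i j, `|A i j| <= c).
Proof.
move=> c0; rewrite [`|A|]mx_normrE; split.
  by move=> /bigmax_leP[_ h] i j; exact: (h (i, j)).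
by move=> h; apply/bigmax_leP; split => // -[i j] _; exact: h.
Qed.

(** Coercivity makes the sublevel set of [f x0] bounded, hence compact. *)
Lemma exists_argmin N (A : set 'rV[R]_N) (f : 'rV[R]_N -> R) (x0 : 'rV[R]_N) (c : R) :
  A x0 -> closed A -> continuous f -> (forall x, `|x| <= f x + c) ->
  exists2 x, A x & forall y, A y -> f x <= f y.
Proof.
move=> Ax0 cA cf coer.
pose B := A `&` [set x | f x <= f x0].
have B0 : B !=set0 by exists x0; split => //=.
have cB : compact B.
  apply: bounded_closed_compact; last first.
    by apply: closedI => //; apply: (closed_comp _ (@closed_le _ (f x0))) => x _; exact: cf.
  exists (f x0 + c); split; first exact: num_real.
  move=> r rM x [_ /= xf]; apply: (le_trans (coer x)).
  by rewrite (le_trans _ (ltW rM))// lerD2r.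
have [x xB xmin] := EVT_min_rV B0 cB (continuous_subspaceT cf).
move: xB; rewrite inE => -[Ax fx]; exists x => // y Ay.
have [yx0|/ltW] := leP (f y) (f x0); last exact: le_trans.
by apply: xmin; rewrite inE.
Qed.

End minimization.

Section contrast.
Context {R : realType} p (S : 'M[R]_p) (lambda : R).
Hypothesis lambda0 : 0 <= lambda.
Variable k : 'I_p.
Implicit Types beta : 'cV[R]_(p.-1).

(** The vector [e_k - beta] in dimension [p], which turns the constraint and the
residual variance into expressions in the full matrix [S]. *)
Definition contrast beta (j : 'I_p) : R :=
  if unlift k j is Some j' then - beta j' 0 else 1.

Lemma contrast_k beta : contrast beta k = 1.
Proof. by rewrite /contrast unlift_none. Qed.

Lemma contrast_lift beta j : contrast beta (lift k j) = - beta j 0.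
Proof. by rewrite /contrast liftK. Qed.

Lemma sum_lift (F : 'I_p -> R) : \sum_j F j = F k + \sum_j F (lift k j).
Proof. by rewrite (bigD1_ord k). Qed.

Lemma sum_lift_neq (F : 'I_p -> R) : \sum_(j | j != k) F j = \sum_j F (lift k j).
Proof. by apply: (addrI (F k)); rewrite -sum_lift [RHS](bigD1 k). Qed.

Lemma forall_lift (Q : 'I_p -> Prop) : (forall j, j != k -> Q j) <-> (forall j, Q (lift k j)).
Proof.
split=> h j; first by apply: h; rewrite eq_sym neq_lift.
by case: (unliftP k j) => [j'|] ->; rewrite ?eqxx.
Qed.

Lemma constraintE beta j :
  (minor_mx S k *m beta - minor_col S k) j 0 = - \sum_l S (lift k j) l * contrast beta l.
Proof.
rewrite sum_lift contrast_k mulr1 !mxE opprD addrC; congr (_ + _).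
rewrite -sumrN; apply: eq_bigr => l _.
by rewrite contrast_lift mulrN opprK !mxE.
Qed.

Lemma feasibleE beta : dantzig_feasible lambda S k beta <->
  (forall j, j != k -> `|\sum_l S j l * contrast beta l| <= lambda).
Proof.
rewrite /dantzig_feasible (mx_norm_le _ lambda0).
apply: (@iff_trans _ (forall j, `|\sum_l S (lift k j) l * contrast beta l| <= lambda)).
  split=> [h j|h j i]; first by have := h j 0; rewrite constraintE normrN.
  by rewrite (ord1 i) constraintE normrN.
by apply: iff_sym; exact: forall_lift.
Qed.

Lemma vec_l1E beta : vec_l1 beta = \sum_(j | j != k) `|contrast beta j|.
Proof.
by rewrite sum_lift_neq; apply: eq_bigr => j _; rewrite contrast_lift normrN.
Qed.

(** The right side separates the residuals in the rows [j != k], small by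
feasibility, from the row [k]. *)
Lemma noiseE beta :
  (beta^T *m minor_mx S k *m beta) 0 0 - 2 * (beta^T *m minor_col S k) 0 0 + 1 =
  \sum_(j | j != k) contrast beta j * (\sum_l S j l * contrast beta l)
  + \sum_(j | j != k) S j k * contrast beta j + 1.
Proof.
congr (_ + _); rewrite !sum_lift_neq.
have -> : (beta^T *m minor_col S k) 0 0 = - \sum_j S (lift k j) k * contrast beta (lift k j).
  rewrite mxE -sumrN; apply: eq_bigr => j _.
  by rewrite contrast_lift !mxE; ring.
have -> : \sum_j contrast beta (lift k j) * (\sum_l S (lift k j) l * contrast beta l) =
    (beta^T *m minor_mx S k *m beta) 0 0 + \sum_j S (lift k j) k * contrast beta (lift k j).
  rewrite -mulmxA mxE -big_split/=; apply: eq_bigr => j _.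
  have -> : (minor_mx S k *m beta) j 0 = - \sum_l S (lift k j) (lift k l) * contrast beta (lift k l).
    rewrite mxE -sumrN; apply: eq_bigr => l _.
    by rewrite contrast_lift !mxE; ring.
  rewrite sum_lift contrast_k contrast_lift [beta^T _ _]mxE; ring.
by ring.
Qed.

Definition contrast_coef (v : 'I_p -> R) : 'cV[R]_(p.-1) := \col_j - v (lift k j).

Lemma contrast_coefK v : v k = 1 -> contrast (contrast_coef v) =1 v.
Proof.
move=> vk j; case: (unliftP k j) => [j'|] ->; last by rewrite contrast_k.
by rewrite contrast_lift mxE opprK.
Qed.

Lemma dantzig_solution_exists beta0 : dantzig_feasible lambda S k beta0 ->
  exists beta, dantzig_solution lambda S k beta.
Proof.
move=> fb0.
pose f (y : 'rV[R]_(p.-1)) : R := vec_l1 y^T.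
have cf : continuous f.
  apply: continuous_bigsum => i.
  have -> : (fun y : 'rV[R]_(p.-1) => `|y^T i 0|) = (fun y => `|y 0 i|).
    by apply/funext => y; rewrite mxE.
  by apply: continuous_normr; exact: coord_continuous.
have ccontrast l : continuous (fun y : 'rV[R]_(p.-1) => contrast y^T l).
  rewrite /contrast; case: (unliftP k l) => [l'|] _; last exact: cst_continuous.
  have -> : (fun y : 'rV[R]_(p.-1) => - y^T l' 0) = (fun y => - y 0 l').
    by apply/funext => y; rewrite mxE.
  by apply: continuous_opp; exact: coord_continuous.
have clA : closed [set y : 'rV[R]_(p.-1) | dantzig_feasible lambda S k y^T].
  have -> : [set y : 'rV[R]_(p.-1) | dantzig_feasible lambda S k y^T] =
      \bigcap_(j in [set j | j != k]) [set y : 'rV[R]_(p.-1) | `|\sum_l S j l * contrast y^T l| <= lambda].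
    by apply/seteqP; split => y /=; rewrite feasibleE.
  apply: closed_bigI => j _.
  apply: (closed_comp _ (@closed_le _ lambda)) => y _; move: y.
  apply: continuous_normr; apply: continuous_bigsum => l.
  by apply: continuous_cmul; exact: ccontrast.
have coer y : `|y| <= f y + 0.
  rewrite addr0; apply/mx_norm_le; first by rewrite sumr_ge0.
  move=> i j; rewrite (ord1 i) /f /vec_l1 (bigD1 j)//= mxE lerDl sumr_ge0//.
have fb0' : [set y : 'rV[R]_(p.-1) | dantzig_feasible lambda S k y^T] beta0^T by rewrite /= trmxK.
have [y fy miny] := exists_argmin fb0' clA cf coer.
exists y^T; split => // beta' fb'.
by have := miny beta'^T; rewrite /f /= trmxK; exact.
Qed.

End contrast.

Lemma mx_l1_ge0 (R : realType) m n (A : 'M[R]_(m, n)) : 0 <= mx_l1 A.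
Proof.
by rewrite /mx_l1; elim/big_ind: _ => // [x y x0 y0|i _]; rewrite ?le_max ?x0// sumr_ge0.
Qed.

Lemma mx_l1_triangle (R : realType) m n (A B : 'M[R]_(m, n)) : mx_l1 (A + B) <= mx_l1 A + mx_l1 B.
Proof.
apply/bigmax_leP; split; first by rewrite addr_ge0 ?mx_l1_ge0.
move=> j _; apply: (@le_trans _ _ (\sum_i `|A i j| + \sum_i `|B i j|)).
  by rewrite -big_split/=; apply: ler_sum => i _; rewrite mxE ler_normD.
apply: lerD.
  exact: (le_bigmax _ (fun j => \sum_i `|A i j|)).
exact: (le_bigmax _ (fun j => \sum_i `|B i j|)).
Qed.

Lemma mx_l1_sub_sym (R : realType) m n (A B : 'M[R]_(m, n)) : mx_l1 (A - B) = mx_l1 (B - A).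
Proof.
by apply: eq_bigr => j _; apply: eq_bigr => i _; rewrite !mxE distrC.
Qed.

(** The symmetric matrix [T0] is a competitor in the minimization, so [U] is at least
as close to [T] as [T0] is. *)
Lemma symmetrization_le (R : realType) p (T U T0 : 'M[R]_p) : T0^T = T0 ->
  symmetrization T U -> mx_l1 (U - T0) <= 2 * mx_l1 (T - T0).
Proof.
move=> T0s [_ Umin]; have := Umin _ T0s; rewrite (mx_l1_sub_sym T0 T).
have := mx_l1_triangle (U - T) (T - T0); rewrite addrA subrK; lra.
Qed.

Lemma symmetrization_exists (R : realType) p (T : 'M[R]_p) : exists U, symmetrization T U.
Proof.
pose f (y : 'rV[R]_(p * p)) : R := mx_l1 (vec_mx y - T).
have cco i j : continuous (fun y : 'rV[R]_(p * p) => vec_mx y i j).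
  have -> : (fun y : 'rV[R]_(p * p) => vec_mx y i j) = (fun y => y 0 (mxvec_index i j)).
    by apply/funext => y; rewrite mxE.
  exact: coord_continuous.
have cf : continuous f.
  apply: continuous_bigmax => j; apply: continuous_bigsum => i.
  have -> : (fun y : 'rV[R]_(p * p) => `|(vec_mx y - T) i j|) =
      (fun y => `|vec_mx y i j - T i j|).
    by apply/funext => y; rewrite !mxE.
  by apply: continuous_normr; apply: continuous_sub; [exact: cco|exact: cst_continuous].
pose A := [set y : 'rV[R]_(p * p) | (vec_mx y)^T = vec_mx y].
have clA : closed A.
  have -> : A = \bigcap_(z in [set: 'I_p * 'I_p])
      [set y : 'rV[R]_(p * p) | vec_mx y z.2 z.1 - vec_mx y z.1 z.2 = 0].
    apply/seteqP; split => y /=.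
      move=> h z _ /=; have -> : vec_mx y z.2 z.1 = (vec_mx y)^T z.1 z.2 by rewrite [RHS]mxE.
      by rewrite h subrr.
    move=> h; apply/matrixP => i j; rewrite [LHS]mxE.
    by have /eqP := h (i, j) I; rewrite /= subr_eq0 => /eqP.
  apply: closed_bigI => z _.
  apply: (closed_comp _ (@closed_eq _ 0)) => y _; move: y.
  by apply: continuous_sub; exact: cco.
have coer y : `|y| <= f y + mx_l1 T.
  have ent (C : 'M[R]_p) i j : `|C i j| <= mx_l1 C.
    apply: (@le_trans _ _ (\sum_i `|C i j|)).
      by rewrite (bigD1 i)//= lerDl sumr_ge0.
    exact: (le_bigmax _ (fun j => \sum_i `|C i j|)).
  apply/mx_norm_le; first by rewrite addr_ge0 ?mx_l1_ge0.
  move=> i k; rewrite (ord1 i); case/mxvec_indexP: k => a c.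
  have -> : y 0 (mxvec_index a c) = vec_mx y a c by rewrite mxE.
  have -> : vec_mx y a c = (vec_mx y - T) a c + T a c by rewrite !mxE subrK.
  by rewrite (le_trans (ler_normD _ _))// lerD ?ent.
have A0 : A 0 by rewrite /A/= linear0 trmx0.
have [y Ay miny] := exists_argmin A0 clA cf coer.
exists (vec_mx y); split => // V Vs.
by have := miny (mxvec V); rewrite /A /f /= mxvecK; exact.
Qed.

(** * The neighborhood Dantzig selector *)

Section selector.
Context {R : realType} p (Sigma S : 'M[R]_p).
Hypotheses (p0 : (0 < p)%N) (Sigma_pd : posdefmx Sigma) (Sigma1 : forall i, Sigma i i = 1).
Local Notation Theta := (invmx Sigma).
Local Notation M := (mx_l1 Theta).
Local Notation b := (mindiag Theta).
Local Notation d := (maxdeg Theta).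
Variable lambda : R.
Hypothesis lambda_gt0 : 0 < lambda.
Hypothesis S_close : forall j k l, j != k -> `|S j l - Sigma j l| <= b * lambda / M.

Lemma contrast_coef_oracle_feasible k : dantzig_feasible lambda S k (contrast_coef k (oracle Sigma k)).
Proof.
apply/(feasibleE _ (ltW lambda_gt0)) => j jk.
under eq_bigr do rewrite contrast_coefK ?(oracle_k Sigma_pd)//.
exact: oracle_feasible.
Qed.

Lemma neighborhood_dantzig_exists : exists T, neighborhood_dantzig lambda S T.
Proof.
have [beta Hbeta] := choice (fun k =>
  dantzig_solution_exists (ltW lambda_gt0) (contrast_coef_oracle_feasible k)).
pose t k := (((beta k)^T *m minor_mx S k *m beta k) 0 0
             - 2 * ((beta k)^T *m minor_col S k) 0 0 + 1)^-1.
have tk k : (\matrix_(j, k) (t k * contrast k (beta k) j)) k k = t k.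
  by rewrite mxE contrast_k mulr1.
exists (\matrix_(j, k) (t k * contrast k (beta k) j)); exists beta => k; split => //.
by apply/colP => j; rewrite tk !mxE contrast_lift mulrN.
Qed.

(** Column [k] of [T] is [T k k] times the vector [contrast k beta], whose off-[k]
l1 norm is minimal among feasible vectors, in particular at most that of
[oracle]. *)
Lemma neighborhood_dantzig_error T : 12 * M ^+ 3 * (d%:R * lambda) <= 1 ->
  neighborhood_dantzig lambda S T -> mx_l1 (T - Theta) <= 16 * M ^+ 5 * (d%:R * lambda).
Proof.
move=> small [beta Hbeta].
have M0 : 0 <= M.
  by rewrite (le_trans _ (mindiag_le_mx_l1 Sigma_pd Sigma1 p0))// (le_trans ler01)// mindiag_ge1.
apply/bigmax_leP; split.
  by rewrite mulr_ge0 ?mulr_ge0 ?exprn_ge0// ltW.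
move=> k _; have [[fb minb] tE colE] := Hbeta k.
have TE j : T j k = T k k * contrast k (beta k) j.
  case: (unliftP k j) => [j'|] ->; last by rewrite contrast_k mulr1.
  have := congr1 (fun c : 'cV[R]_(p.-1) => c j' 0) colE.
  by rewrite !mxE contrast_lift => ->; rewrite mulrN.
under eq_bigr => j _ do rewrite !mxE TE.
apply: (column_error p0 Sigma_pd Sigma1 lambda_gt0 S_close) => //.
- exact: contrast_k.
- exact/(feasibleE _ (ltW lambda_gt0)).
- rewrite -(vec_l1E k) (le_trans (minb _ (contrast_coef_oracle_feasible k)))// (vec_l1E k).
  by apply: ler_sum => j _; rewrite contrast_coefK ?(oracle_k Sigma_pd).
- by rewrite tE noiseE.
Qed.

End selector.

(** The Dantzig selector depends on the data only through the ranks. *)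
Lemma measurable_nds_event (R : realType) d (Omega : measurableType d) (n p : nat)
    (x : 'I_n -> {mfun Omega >-> p.-tuple R}) lambda (T0 : 'M[R]_p) (r : R) :
  measurable (nds_event x lambda T0 r).
Proof.
exact: (measurable_rank_event x (fun D =>
  let S := \matrix_(i, j) (2 * sin (pi / 6 * pearson (col i D) (col j D))) in
  (exists T U, neighborhood_dantzig lambda S T /\ symmetrization T U) /\
  (forall T U, neighborhood_dantzig lambda S T -> symmetrization T U ->
     mx_l1 (U - T0) <= 2 * mx_l1 (T - T0) /\ 2 * mx_l1 (T - T0) <= r))).
Qed.

Lemma regularization_gt0 (R : realType) (a c lambda : R) :
  0 < a -> 0 <= c -> a <= c * lambda -> 0 < lambda.
Proof.
move=> a0 c0 acl; rewrite ltNge; apply/negP => l0.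
have := lt_le_trans a0 acl; rewrite ltNge => /negP; apply.
by rewrite mulr_ge0_le0.
Qed.

(** Apply [spearman_mx_deviation] with radius [eps = b * lambda / M], for which
[n * (eps / 240)^2] is the exponent and [12 * pi <= n * eps] is the lower bound
on [lambda].  The radius [32 M^5 d lambda] is twice the bound of
[neighborhood_dantzig_error]. *)
Lemma neighborhood_dantzig_event (R : realType) (disp : measure_display)
    (Omega : measurableType disp) (P : probability Omega R) (n p : nat)
    (Sigma : 'M[R]_p) (X : {mfun Omega >-> p.-tuple R})
    (x : 'I_n -> {mfun Omega >-> p.-tuple R}) (lambda : R) :
  let Theta := invmx Sigma in
  let b := mindiag Theta in
  let M := mx_l1 Theta in
  let d := maxdeg Theta in
  (0 < p)%N -> posdefmx Sigma -> (forall i, Sigma i i = 1) ->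
  nonparanormal P X Sigma -> iid_copies P X x ->
  12 * pi * M <= b * n%:R * lambda ->
  12 * M ^+ 3 * (d%:R * lambda) <= 1 ->
  forall r, 32 * M ^+ 5 * (d%:R * lambda) <= r ->
  ((1 - p%:R ^+ 2 * expR (- (240 ^- 2) * (b ^+ 2 / M ^+ 2) * n%:R * lambda ^+ 2))%:E
   <= P (nds_event x lambda Theta r))%E.
Proof.
move=> Theta b M d p0 pd S1 npn iid lamM small r rM.
have b1 : 1 <= b by exact: mindiag_ge1.
have b0 : 0 < b by rewrite (lt_le_trans ltr01).
have M0 : 0 < M by rewrite (lt_le_trans b0)//; exact: mindiag_le_mx_l1.
have pi0 : 0 < pi :> R by exact: pi_gt0.
have lam0 : 0 < lambda.
  by apply: (regularization_gt0 _ _ lamM); rewrite ?mulr_gt0// mulr_ge0// ltW.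
pose eps := b * lambda / M.
have eps0 : 0 < eps by rewrite divr_gt0// mulr_gt0.
have neps : 12 * pi <= n%:R * eps.
  by rewrite /eps mulrA ler_pdivlMr// mulrA [n%:R * b]mulrC.
have [mgood Pgood] := spearman_mx_deviation pd S1 npn iid eps0 neps.
have <- : - (n%:R * (eps / 240) ^+ 2) = - (240 ^- 2) * (b ^+ 2 / M ^+ 2) * n%:R * lambda ^+ 2.
  by rewrite /eps; field; rewrite gt_eqF.
apply: (le_trans Pgood); apply: le_measure; rewrite ?inE//.
  exact: measurable_nds_event.
move=> w /= close.
have Ts : Theta^T = Theta by apply/matrixP => i j; rewrite mxE (precision_sym pd).
split.
  have [T HT] := neighborhood_dantzig_exists p0 pd S1 lam0 close.
  by have [U HU] := symmetrization_exists T; exists T, U.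
move=> T U HT HU; split; first exact: symmetrization_le.
have := neighborhood_dantzig_error p0 pd S1 lam0 close small HT.
move: rM; rewrite -/Theta -/M -/d; lra.
Qed.

Theorem theorem2 (R : realType) :
  exists (c0 : R) (C : R -> R -> R -> R),
    [/\ 0 < c0, (forall b B M : R, 0 < C b B M) &
    forall (disp : nat -> measure_display)
      (Omega : forall m, measurableType (disp m))
      (P : forall m, probability (Omega m) R)
      (n p : nat -> nat)
      (Sigma : forall m, 'M[R]_(p m))
      (X : forall m, {mfun Omega m >-> (p m).-tuple R})
      (x : forall m, 'I_(n m) -> {mfun Omega m >-> (p m).-tuple R})
      (lambda : nat -> R) (K : R),
      let Theta := fun m => invmx (Sigma m) in
      let b := fun m => mindiag (Theta m) in
      let B := fun m => lambda_max (Theta m) in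
      let M := fun m => mx_l1 (Theta m) in
      let d := fun m => maxdeg (Theta m) in
      (forall m, (0 < p m)%N) ->
      (forall m, posdefmx (Sigma m)) ->
      (forall m i, Sigma m i i = 1) ->
      (forall m, nonparanormal (P m) (X m) (Sigma m)) ->
      (forall m, iid_copies (P m) (X m) (x m)) ->
      (forall m, M m <= K) ->
      (fun m => (d m)%:R * lambda m) @ \oo --> (0 : R) ->
      (forall m, 12 * pi * M m <= b m * (n m)%:R * lambda m) ->
      \forall m \near \oo,
        let E := nds_event (x m) (lambda m) (Theta m)
                   (C (b m) (B m) (M m) * (d m)%:R * lambda m) in
        measurable E /\
        ((1 - (p m)%:R ^+ 2 *
            expR (- c0 * (b m ^+ 2 / M m ^+ 2) * (n m)%:R * lambda m ^+ 2))%:E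
          <= P m E)%E].
Proof.
(* The summand 1 keeps the second constant positive for every value of M. *)
exists (240 ^- 2), (fun _ _ M => 1 + 32 * `|M| ^+ 5); split.
- by rewrite invr_gt0 exprn_gt0.
- by move=> _ _ M; rewrite ltr_pwDl// mulr_ge0// exprn_ge0.
move=> disp Omega P n p Sigma X x lambda K Theta b B M d p0 pd S1 npn iid MK dlam lamM.
have M1 m : 1 <= M m.
  exact: le_trans (mindiag_ge1 (pd m) (S1 m) (p0 m)) (mindiag_le_mx_l1 (pd m) (S1 m) (p0 m)).
have K0 : 0 < K by rewrite (lt_le_trans ltr01)// (le_trans (M1 0%N)).
(* The uniform bound K on M turns d * lambda -> 0 into the smallness condition. *)
have e0 : 0 < (12 * K ^+ 3)^-1 by rewrite invr_gt0 mulr_gt0// exprn_gt0.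
have /cvgrPdist_le/(_ _ e0) near_small := dlam.
near=> m; split; first exact: measurable_nds_event.
have small_m : `|(d m)%:R * lambda m| <= (12 * K ^+ 3)^-1.
  by rewrite -normrN -sub0r; near: m.
have M0 : 0 <= M m by rewrite (le_trans ler01).
have small : 12 * M m ^+ 3 * ((d m)%:R * lambda m) <= 1.
  apply: (@le_trans _ _ (12 * K ^+ 3 * `|(d m)%:R * lambda m|)).
    apply: (@le_trans _ _ (12 * M m ^+ 3 * `|(d m)%:R * lambda m|)).
      by rewrite ler_wpM2l ?ler_norm// mulr_ge0// exprn_ge0.
    by rewrite ler_wpM2r// ler_wpM2l// lerXn2r// nnegrE// ltW.
  by rewrite -ler_pdivlMl ?mulr1// mulr_gt0// exprn_gt0.
apply: (neighborhood_dantzig_event (p0 m) (pd m) (S1 m) (npn m) (iid m) (lamM m) small).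
rewrite -[X in _ <= X]mulrA ger0_norm// ler_wpM2r ?lerDr// mulr_ge0//.
apply/ltW; apply: (regularization_gt0 _ _ (lamM m)).
  by rewrite !mulr_gt0// ?pi_gt0// (lt_le_trans ltr01).
by rewrite mulr_ge0// (le_trans ler01)//; exact: mindiag_ge1.
Unshelve. all: by end_near.
Qed.
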